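(* There is an algorithm that, given a set $D$ of $n$ unit disks in the plane, computes in $O(n^2)$ time and $O(n^2)$ space a subset $S\subseteq D$ of pairwise non-intersecting disks such that $2|S|\ge |\mathrm{OPT}|$, where $\mathrm{OPT}$ is a maximum-cardinality subset of pairwise non-intersecting disks of $D$. In other words, the problem MISUDG admits a factor $2$ approximation algorithm with time and space complexities both $O(n^2)$.
   Context: A unit disk is a closed disk of diameter $1$ in the plane; two unit disks intersect if and only if their centers are at Euclidean distance at most $1$. The unit disk graph $G(V,E)$ of a set of unit disks has one vertex per disk and an edge between two vertices if and only if the corresponding disks intersect. An independent set of $G$ is a set of vertices no two of which are joined by an edge. The problem MISUDG is: given a unit disk graph, find an independent set of maximum cardinality. The input is given geometrically, as the set $D$ of $n$ unit disks (coordinates of their centers). Time and space are measured in the standard unit-cost model of computational geometry (real RAM). *)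

(* Defs.v *)
(* MathComp / MathComp-Analysis. *)
From mathcomp Require Import all_boot all_order all_algebra.
From mathcomp Require Import all_classical all_reals all_analysis.

Set Implicit Arguments.
Unset Strict Implicit.
Unset Printing Implicit Defensive.

Import Order.TTheory GRing.Theory Num.Theory.
Local Open Scope ring_scope.
Local Open Scope classical_set_scope.

Section UnitDisks.
Variable R : realType.

(* The library norm on [R * R] is the sup norm, hence the explicit formula. *)
Definition eucl_dist (p q : R * R) : R :=
  Num.sqrt ((p.1 - q.1) ^+ 2 + (p.2 - q.2) ^+ 2).

Definition unit_disk (c : R * R) : set (R * R) :=
  [set q | eucl_dist c q <= 2^-1].

Definition intersecting (A B : set (R * R)) : Prop := A `&` B !=set0.

(* Vertex [i] stands for the disk centred at [c i]. *)
Definition udg (n : nat) (c : 'I_n -> R * R) : rel 'I_n :=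
  fun i j => (i != j) && `[< intersecting (unit_disk (c i)) (unit_disk (c j)) >].

End UnitDisks.

Definition independent (V : finType) (e : rel V) (A : {set V}) : bool :=
  [forall i in A, forall j in A, ~~ e i j].

Definition maximum_independent (V : finType) (e : rel V) (A : {set V}) : Prop :=
  independent e A /\
  (forall B : {set V}, independent e B -> (#|B| <= #|A|)%N).

(* Real RAM.  A machine has registers and random-access memory, each in two
   kinds: integer cells (holding natural numbers, used for indices and
   addresses) and real cells.  Registers are named by constants in the
   program, so a program uses only finitely many of them; memory is accessed
   only by indirect addressing through an integer register.  Real cells
   support exact field arithmetic and comparison, with no rounding and no
   conversion from reals to integers; integer cells support addition,
   truncated subtraction and comparison.  Constants are integers, so that a
   program does not depend on the field of real numbers.  Jump targets are
   absolute instruction indices. *)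
Inductive instr : Type :=
| IConst (d k : nat)           (* I[d] := k *)
| IAdd   (d a b : nat)         (* I[d] := I[a] + I[b] *)
| ISub   (d a b : nat)         (* I[d] := max (I[a] - I[b]) 0 *)
| ILoad  (d a : nat)           (* I[d] := IM[I[a]] *)
| IStore (a b : nat)           (* IM[I[a]] := I[b] *)
| RConst (d : nat) (k : int)   (* F[d] := k *)
| RAdd   (d a b : nat)         (* F[d] := F[a] + F[b] *)
| RSub   (d a b : nat)
| RMul   (d a b : nat)
| RDiv   (d a b : nat)
| RLoad  (d a : nat)           (* F[d] := FM[I[a]] *)
| RStore (a b : nat)           (* FM[I[a]] := F[b] *)
| Jmp    (l : nat)
| JmpILe (a b l : nat)         (* if I[a] <= I[b] go to l *)
| JmpRLe (a b l : nat)         (* if F[a] <= F[b] go to l *)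
| Halt.

Definition program := seq instr.

Section RealRAM.
Variable R : realType.

Record state : Type := State {
  pc : nat;
  ireg : nat -> nat;
  rreg : nat -> R;
  imem : nat -> nat;
  rmem : nat -> R
}.

Definition upd (T : Type) (f : nat -> T) (a : nat) (v : T) : nat -> T :=
  fun b => if b == a then v else f b.

Definition set_ireg (s : state) (d v : nat) : state :=
  State (pc s).+1 (upd (ireg s) d v) (rreg s) (imem s) (rmem s).

Definition set_rreg (s : state) (d : nat) (v : R) : state :=
  State (pc s).+1 (ireg s) (upd (rreg s) d v) (imem s) (rmem s).

Definition set_imem (s : state) (a v : nat) : state :=
  State (pc s).+1 (ireg s) (rreg s) (upd (imem s) a v) (rmem s).

Definition set_rmem (s : state) (a : nat) (v : R) : state :=
  State (pc s).+1 (ireg s) (rreg s) (imem s) (upd (rmem s) a v).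

Definition goto (s : state) (l : nat) : state :=
  State l (ireg s) (rreg s) (imem s) (rmem s).

(* [None]: no successor.  Division by zero is a fault. *)
Definition exec (i : instr) (s : state) : option state :=
  match i with
  | IConst d k => Some (set_ireg s d k)
  | IAdd d a b => Some (set_ireg s d (ireg s a + ireg s b)%N)
  | ISub d a b => Some (set_ireg s d (ireg s a - ireg s b)%N)
  | ILoad d a => Some (set_ireg s d (imem s (ireg s a)))
  | IStore a b => Some (set_imem s (ireg s a) (ireg s b))
  | RConst d k => Some (set_rreg s d k%:~R)
  | RAdd d a b => Some (set_rreg s d (rreg s a + rreg s b))
  | RSub d a b => Some (set_rreg s d (rreg s a - rreg s b))
  | RMul d a b => Some (set_rreg s d (rreg s a * rreg s b))
  | RDiv d a b =>
      if rreg s b == 0 then None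
      else Some (set_rreg s d (rreg s a / rreg s b))
  | RLoad d a => Some (set_rreg s d (rmem s (ireg s a)))
  | RStore a b => Some (set_rmem s (ireg s a) (rreg s b))
  | Jmp l => Some (goto s l)
  | JmpILe a b l =>
      Some (goto s (if (ireg s a <= ireg s b)%N then l else (pc s).+1))
  | JmpRLe a b l =>
      Some (goto s (if rreg s a <= rreg s b then l else (pc s).+1))
  | Halt => None
  end.

Definition fetch (P : program) (s : state) : option instr := onth P (pc s).

Definition step (P : program) (s : state) : option state :=
  obind (fun i => exec i s) (fetch P s).

Definition run (P : program) (t : nat) (s : state) : option state :=
  iter t (obind (step P)) (Some s).

(* [P] started in [s] reaches a [Halt] instruction, in state [s'], after
   exactly [t] unit-cost steps; faults and jumps outside of the program are
   not halting. *)
Definition halts_in (P : program) (s : state) (t : nat) (s' : state) : Prop :=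
  run P t s = Some s' /\ fetch P s' = Some Halt.

(* One more than the address accessed by the next instruction in the integer
   (resp. real) memory, 0 if there is no such access. *)
Definition iextent (P : program) (s : state) : nat :=
  match fetch P s with
  | Some (ILoad _ a) | Some (IStore a _) => (ireg s a).+1
  | _ => 0%N
  end.

Definition rextent (P : program) (s : state) : nat :=
  match fetch P s with
  | Some (RLoad _ a) | Some (RStore a _) => (ireg s a).+1
  | _ => 0%N
  end.

(* Lengths of the initial segments of the two memories in which the first [t]
   steps take place: an upper bound on the number of memory cells used.  The
   registers contribute only a constant depending on the program. *)
Definition space_used (P : program) (s : state) (t : nat) : nat :=
  (\max_(k < t) oapp (iextent P) 0 (run P k s) +
   \max_(k < t) oapp (rextent P) 0 (run P k s))%N.

(* [n] is in integer register 0 and the coordinates of the [i]-th centre are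
   at addresses [2 i] and [2 i + 1] of the real memory; all else is 0. *)
Definition input (n : nat) (c : 'I_n -> R * R) : state :=
  State 0
    (fun r => if r == 0%N then n else 0%N)
    (fun=> 0)
    (fun=> 0%N)
    (fun a => if insub a./2 is Some i then
                if odd a then (c i).2 else (c i).1
              else 0).

(* Characteristic vector of the answer, in the first [n] integer cells. *)
Definition output (n : nat) (s : state) : {set 'I_n} :=
  [set i : 'I_n | imem s i != 0%N]%SET.

(* [T n] and [M n] bound the running time and the space of [P] on all inputs
   of [n] distinct unit disks (equivalently, with distinct centres), and the
   answer is always an independent set of the unit disk graph of size at
   least [1 / rho] times the optimum. *)
Definition approximates_MISUDG (rho : nat) (P : program) (T M : nat -> nat) :
    Prop :=
  forall (n : nat) (c : 'I_n -> R * R), injective c ->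
  exists (t : nat) (s : state),
    [/\ halts_in P (input c) t s,
        (t <= T n)%N,
        (space_used P (input c) t <= M n)%N,
        independent (udg c) (output n s) &
        forall OPT : {set 'I_n}, maximum_independent (udg c) OPT ->
          (#|OPT| <= rho * #|output n s|)%N].

End RealRAM.

(* Main.v *)
Require Import Defs.
From mathcomp Require Import all_boot all_order all_algebra.
From mathcomp Require Import all_classical all_reals all_analysis.
From mathcomp Require Import ring lra zify.

Set Implicit Arguments.
Unset Strict Implicit.
Unset Printing Implicit Defensive.

Import Order.TTheory GRing.Theory Num.Theory.
Import numFieldNormedType.Exports.
Local Open Scope ring_scope.
Local Open Scope classical_set_scope.

(* Sweeping upwards, cut the plane greedily into horizontal strips of height
   less than 1; centres in strips of the same parity, but not in the same
   strip, are at distance more than 1, so it suffices to find a maximum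
   independent set inside every strip and to keep the better parity.  Putting
   the strips one after the other, far apart, gives a single strip.

   In a strip, order the centres by abscissa.  The key fact is [chain_far_skip]:
   if h < i < j < k and hi, ij and jk are far apart, then so are h and k.
   So, if F j is the best size of an independent set ending in j, the best size
   of one ending in j, k is F j + 1 if some i that is second to last in an
   optimal set ending in j is far from k, and F j otherwise.  Whether such an i
   exists for k is read off the lower envelope of the right unit half circles
   around all these i.  Two half circles cross at most once, in an order given
   by their heights, so that the envelope is built by a stack in linear time as
   soon as the crossings are known; all O(n^2) crossings, rounded to the heights
   of the centres, are found by an insertion sort that is continued from height
   to height, each pair being swapped at most once.

   Time is counted in loop iterations of a while language with two-dimensional
   arrays; its compilation to the real RAM, which has no multiplication of
   addresses, costs a constant factor and a table of row addresses. *)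

(** * Geometry of unit circles in a strip *)

(** The strips are based at heights of centres because the machine cannot round a real number to an
    integer, which rules out a fixed grid. The recursion over pairs j, k, computed directly, would
    take cubic time, as each pair searches all i. For a fixed j, the predecessors that matter are
    those attaining F j, and a centre k further right is far from one of them exactly when, at its
    own height, it lies to the right of the lower envelope of their half circles. If the k are
    visited by increasing height, the answers for one j are found in a single walk along the
    envelope. Only heights of centres are queried, so it is enough to know between which two of them
    a crossing lies, and no crossing point is ever computed. Two orders are therefore in play:
    chains follow the abscissa, the envelope follows the height. The half circles involve square
    roots, which the machine lacks, so their comparison has to be turned into a polynomial one. The
    factor 2 is lost only in the choice of a parity; the strip problem itself is solved exactly. *)

Section Geometry.
Variable R : realType.
Implicit Types x y t u : R.

(** On [[0, 1]] a number is at most its square root, here with [1 - y ^+ 2]. The weaker bound is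
    free of roots and adds up along a path. *)
Lemma far_dx (x y : R) : 0 <= x -> y ^+ 2 < 1 -> 1 < x ^+ 2 + y ^+ 2 ->
  1 - y ^+ 2 < x.
Proof.
move=> x0 y1 h; rewrite ltNge; apply/negP => le.
have : x ^+ 2 <= (1 - y ^+ 2) ^+ 2 by rewrite ler_sqr ?nnegrE //; lra.
have := sqr_ge0 y; nra.
Qed.

(** With vertical steps [a] and [b] of the same sign, [far_dx] bounds the horizontal steps below by
    [1 - a ^+ 2] and [1 - b ^+ 2], and [a ^+ 2 + b ^+ 2 <= (a + b) ^+ 2 < 1]. *)
Lemma far_monotone_path x1 x2 x3 y1 y2 y3 :
  x1 <= x2 -> x2 <= x3 -> y1 <= y2 -> y2 <= y3 -> y3 - y1 < 1 ->
  1 < (x1 - x2) ^+ 2 + (y1 - y2) ^+ 2 -> 1 < (x2 - x3) ^+ 2 + (y2 - y3) ^+ 2 ->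
  1 < x3 - x1.
Proof.
move=> h12 h23 g12 g23 h d12 d23.
have := @far_dx (x2 - x1) (y2 - y1); have := @far_dx (x3 - x2) (y3 - y2).
have e (a b : R) : (a - b) ^+ 2 = (b - a) ^+ 2 by ring.
rewrite !subr_ge0 (e x2 x1) (e y2 y1) (e x3 x2) (e y3 y2).
move=> /(_ h23 _ d23) A /(_ h12 _ d12) B.
have : 1 - (y1 - y2) ^+ 2 < x2 - x1 by apply: B; nra.
have : 1 - (y2 - y3) ^+ 2 < x3 - x2 by apply: A; nra.
nra.
Qed.

Lemma far_skip_up x1 x2 x3 x4 y1 y2 y3 y4 :
  x1 <= x2 -> x2 <= x3 -> x3 <= x4 ->
  `|y1 - y2| < 1 -> `|y3 - y1| < 1 -> `|y3 - y2| < 1 -> `|y4 - y2| < 1 -> y2 <= y3 ->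
  1 < (x1 - x2) ^+ 2 + (y1 - y2) ^+ 2 -> 1 < (x2 - x3) ^+ 2 + (y2 - y3) ^+ 2 ->
  1 < (x3 - x4) ^+ 2 + (y3 - y4) ^+ 2 ->
  1 < (x1 - x4) ^+ 2 + (y1 - y4) ^+ 2.
Proof.
move=> h12 h23 h34 /ltr_normlP [a1 a2] /ltr_normlP[b1 b2] /ltr_normlP[c1 c2].
move=> /ltr_normlP[e1 e2] y23 d12 d23 d34.
have sq (a b : R) : 1 < b - a -> forall c, 1 < (a - b) ^+ 2 + c ^+ 2.
  by move=> lt c; have := sqr_ge0 c; nra.
case: (ltP y1 y2) => y12.
  apply: sq; apply: lt_le_trans (_ : x3 - x1 <= _); last by lra.
  by apply: (far_monotone_path h12 h23 (ltW y12) y23).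
(* If [y4 <= y2 <= y1], points 1 and 4 are at least as far apart as points 1 and 2 in both
   coordinates. *)
case: (leP y4 y2) => y42; first nra.
case: (leP y4 y3) => y43; last first.
  apply: sq; apply: lt_le_trans (_ : x4 - x2 <= _); last by lra.
  by apply: (far_monotone_path h23 h34 y23 (ltW y43)).
(* What remains is [y2 < y4 <= y3]. With [a = y1 - y2] and [b = y4 - y2], the vertical gap between
   points 3 and 4 is below [1 - b], and the two bounds plus [(a - b) ^+ 2] add up to
   [1 + 2 * b * (1 - a)]. *)
have A : 1 - (y1 - y2) ^+ 2 < (x2 - x1) ^+ 2 by nra.
have B : 1 - (1 - (y4 - y2)) ^+ 2 < (x4 - x3) ^+ 2 by nra.
have : (x2 - x1) ^+ 2 + (x4 - x3) ^+ 2 <= (x1 - x4) ^+ 2 by nra.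
have : 0 <= (y4 - y2) * (1 - (y1 - y2)) by apply: mulr_ge0; lra.
nra.
Qed.

Lemma far_skip x1 x2 x3 x4 y1 y2 y3 y4 :
  x1 <= x2 -> x2 <= x3 -> x3 <= x4 ->
  `|y1 - y2| < 1 -> `|y3 - y1| < 1 -> `|y3 - y2| < 1 -> `|y4 - y2| < 1 ->
  1 < (x1 - x2) ^+ 2 + (y1 - y2) ^+ 2 -> 1 < (x2 - x3) ^+ 2 + (y2 - y3) ^+ 2 ->
  1 < (x3 - x4) ^+ 2 + (y3 - y4) ^+ 2 ->
  1 < (x1 - x4) ^+ 2 + (y1 - y4) ^+ 2.
Proof.
move=> h12 h23 h34 a b c e d12 d23 d34; case: (leP y2 y3) => y23.
  exact: (far_skip_up h12 h23 h34 a b c e).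
have N (u v : R) : - u - - v = - (u - v) by ring.
have := @far_skip_up x1 x2 x3 x4 (- y1) (- y2) (- y3) (- y4) h12 h23 h34.
by rewrite !N !normrN !sqrrN; apply => //; lra.
Qed.

(* Abscissa of the point at height [y] of the right half of the unit circle
   centred at [(x, t)]. *)
Definition disk_arc x t y : R := x + Num.sqrt (1 - (y - t) ^+ 2).

(** For the points [(u, p)] and [(v, q)] of the unit circle, the Cauchy-Schwarz bound
    [p * q + u * v <= 1] controls the mixed terms after squaring. *)
Lemma sqrt_circle_concave (u v : R) l : `|u| <= 1 -> `|v| <= 1 -> 0 <= l <= 1 ->
  l * Num.sqrt (1 - u ^+ 2) + (1 - l) * Num.sqrt (1 - v ^+ 2) <=
  Num.sqrt (1 - (l * u + (1 - l) * v) ^+ 2).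
Proof.
move=> u1 v1 /andP[l0 l1].
have U : 0 <= 1 - u ^+ 2 by move: u1 => /ler_normlP[]; nra.
have V : 0 <= 1 - v ^+ 2 by move: v1 => /ler_normlP[]; nra.
have := sqr_sqrtr U; have := sqr_sqrtr V; have := sqrtr_ge0 (1 - u ^+ 2); have := sqrtr_ge0 (1 - v ^+ 2).
set p := Num.sqrt (1 - u ^+ 2); set q := Num.sqrt (1 - v ^+ 2) => q0 p0 qE pE.
have s0 : 0 <= l * p + (1 - l) * q by apply: addr_ge0; apply: mulr_ge0; lra.
rewrite -(ger0_norm s0) -sqrtr_sqr; apply: ler_wsqrtr.
have pq : p * q + u * v <= 1.
  by have := sqr_ge0 (p - q); have := sqr_ge0 (u - v); rewrite !sqrrB pE qE; lra.
have : l * (1 - l) * (p * q + u * v) <= l * (1 - l) * 1.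
  by apply: ler_wpM2l => //; apply: mulr_ge0; lra.
nra.
Qed.

(** Among two pairs of arguments with the same sum, a concave function has the larger sum of values
    on the inner pair: [p] and [q] are convex combinations of [u] and [w] with exchanged weights. *)
Lemma sqrt_circle_increment (u p q w : R) : `|u| <= 1 -> `|w| <= 1 ->
  u <= p -> u <= q -> p + q = u + w ->
  Num.sqrt (1 - u ^+ 2) + Num.sqrt (1 - w ^+ 2) <=
  Num.sqrt (1 - p ^+ 2) + Num.sqrt (1 - q ^+ 2).
Proof.
move=> u1 w1 up uq pq; have [wu|uw] := leP w u.
  have -> : p = u by lra.
  by have -> : q = w by lra.
have d0 : 0 < w - u by lra.
pose l := (w - p) / (w - u).
have l01 : 0 <= l <= 1.
  by rewrite /l divr_ge0 ?ler_pdivrMr //=; lra.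
have lE : l * (w - u) = w - p by rewrite /l divfK ?gt_eqF.
have l01' : 0 <= 1 - l <= 1 by lra.
have := sqrt_circle_concave u1 w1 l01; have := sqrt_circle_concave u1 w1 l01'.
have -> : l * u + (1 - l) * w = p by nra.
have -> : (1 - l) * u + (1 - (1 - l)) * w = q by nra.
set a := Num.sqrt _; set b := Num.sqrt _; nra.
Qed.

(** The numbers [y - ya] and [y' - yb] enclose [y' - ya] and [y - yb], which have the same sum; by
    concavity, the lead of the arc with the higher centre does not shrink as the height grows. *)
Lemma arc_crossing xa xb ya yb y y' :
  yb <= ya -> y <= y' -> `|y - ya| <= 1 -> `|y' - yb| <= 1 ->
  disk_arc xb yb y < disk_arc xa ya y -> disk_arc xb yb y' < disk_arc xa ya y'.
Proof.
move=> yab yy h1 h2; rewrite /disk_arc.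
have := @sqrt_circle_increment (y - ya) (y' - ya) (y - yb) (y' - yb) h1 h2.
have -> : y' - ya + (y - yb) = y - ya + (y' - yb) by ring.
move=> /(_ _ _ erefl) H.
have : Num.sqrt (1 - (y - ya) ^+ 2) + Num.sqrt (1 - (y' - yb) ^+ 2) <=
  Num.sqrt (1 - (y' - ya) ^+ 2) + Num.sqrt (1 - (y - yb) ^+ 2) by apply: H; lra.
lra.
Qed.

(** Turns a distance test into a comparison with an arc, so that being far from some centre of a set
    becomes one test against the leftmost of their arcs. *)
Lemma far_arc x t x' y : x <= x' -> `|t - y| < 1 ->
  (1 < (x - x') ^+ 2 + (t - y) ^+ 2) = (disk_arc x t y < x').
Proof.
move=> xx /ltr_normlP[h1 h2]; rewrite /disk_arc -ltrBrDl.
have d0 : 0 <= x' - x by lra.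
have e0 : 0 <= 1 - (y - t) ^+ 2 by nra.
rewrite -[RHS]ltr_sqr ?nnegrE ?sqrtr_ge0 // sqr_sqrtr //.
by apply/idP/idP; lra.
Qed.
End Geometry.

(** * Independent sets in a strip *)

Section Chains.
Variables (R : realType) (n : nat) (px py : nat -> R) (xpos : nat -> nat).

Definition far a b : bool := 1 < (px a - px b) ^+ 2 + (py a - py b) ^+ 2.

Definition before a b : bool := (xpos a < xpos b)%N.

(* Chains are listed from right to left. *)
Definition chain (l : seq nat) : bool :=
  all (fun a => a < n)%N l && pairwise (fun b a => before a b && far a b) l.

Definition best1 j v : Prop :=
  (exists2 l, chain (j :: l) & size (j :: l) = v) /\
  forall l, chain (j :: l) -> (size (j :: l) <= v)%N.

Definition best2 j k v : Prop :=
  (exists2 l, chain (k :: j :: l) & size (k :: j :: l) = v) /\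
  forall l, chain (k :: j :: l) -> (size (k :: j :: l) <= v)%N.

Lemma chain_cons k l :
  chain (k :: l) = [&& (k < n)%N, all (fun a => before a k && far a k) l & chain l].
Proof. by rewrite /chain /= -!andbA; congr (_ && _); rewrite andbCA. Qed.

Lemma chain_lt k l : chain (k :: l) -> (k < n)%N.
Proof. by rewrite chain_cons => /and3P[]. Qed.

Lemma chain_behead k l : chain (k :: l) -> chain l.
Proof. by rewrite chain_cons => /and3P[]. Qed.

Lemma chain_head2 k j l : chain (k :: j :: l) -> before j k && far j k.
Proof. by rewrite chain_cons /= => /and3P[_ /andP[]]. Qed.

Hypothesis height : forall a b, (a < n)%N -> (b < n)%N -> `|py a - py b| < 1.
Hypothesis xsorted :
  forall a b, (a < n)%N -> (b < n)%N -> before a b -> px a <= px b.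

Lemma chain_far_skip h i j k : (h < n)%N -> (i < n)%N -> (j < n)%N -> (k < n)%N ->
  before h i -> before i j -> before j k -> far h i -> far i j -> far j k ->
  far h k.
Proof.
move=> hn iN jn kn hi ij jk; rewrite /far.
by apply: far_skip; rewrite ?xsorted ?height.
Qed.

(** For [h] in [l], [chain_far_skip] along [h], [i], [j], [k] shows that [h] is far from [k]. Only
    [i] may be close to [k]; it is exchanged for [k], and the size is unchanged. *)
Lemma chain_push k j i l : (k < n)%N -> before j k -> far j k ->
  chain (j :: i :: l) -> chain (k :: j :: l).
Proof.
move=> kn bjk fjk c; have := c; rewrite !chain_cons /=.
move=> /and5P[jn /andP[/andP[bij fij] aj] iN ai cl].
rewrite kn jn bjk fjk cl aj !andbT /=; apply/allP => h hl.
have /andP[bhj fhj] := allP aj h hl; have /andP[bhi fhi] := allP ai h hl.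
have hn : (h < n)%N by case/andP: cl => /allP/(_ h hl).
apply/andP; split; first by apply: ltn_trans bhj bjk.
exact: (chain_far_skip hn iN jn kn).
Qed.

Lemma chain_push2 k j i l : (k < n)%N -> before j k -> far j k -> far i k ->
  chain (j :: i :: l) -> chain (k :: j :: i :: l).
Proof.
move=> kn bjk fjk fik c; have := chain_push kn bjk fjk c.
rewrite chain_cons => /and3P[_ /= /andP[_ al] _].
rewrite chain_cons kn c /= bjk fjk fik al /=.
by have /andP[bij _] := chain_head2 c; rewrite /before (ltn_trans bij bjk).
Qed.

Section Step.
Variables (j k : nat) (f : nat -> nat) (v : nat).
Hypotheses (jn : (j < n)%N) (kn : (k < n)%N).
Hypotheses (bjk : before j k) (fjk : far j k).
Hypothesis f_best : forall i, (i < n)%N -> before i j -> far i j -> best2 i j (f i).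
Hypothesis v_best : best1 j v.

Lemma best2_single : v = 1%N -> best2 j k 2.
Proof.
move=> v1; split.
  by exists [::] => //; rewrite !chain_cons kn jn /= bjk fjk.
by move=> l /chain_behead /(proj2 v_best); rewrite v1.
Qed.

Lemma best2_extend e : (e < n)%N -> before e j -> far e j -> f e = v -> far e k ->
  best2 j k v.+1.
Proof.
move=> en be fe fev fek; split; last by move=> l /chain_behead /(proj2 v_best).
have [[l cl sl] _] := f_best en be fe.
by exists (e :: l); [exact: chain_push2|rewrite /= -fev -sl].
Qed.

(** Size [v] is reached by exchanging the predecessor of [j] for [k]. A longer chain would, without
    [k], be optimal among those ending in [j], so its predecessor [i] of [j] would satisfy [f i = v]
    and be far from [k]. *)
Lemma best2_blocked : (1 < v)%N ->
  (forall i, (i < n)%N -> before i j -> far i j -> f i = v -> ~~ far i k) ->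
  best2 j k v.
Proof.
move=> v1 blk; have [[[|i l] cl sl] up] := v_best; first by move: v1; rewrite -sl.
split; first by exists l; [exact: chain_push cl|rewrite -sl].
move=> [|i' l'] c //; have cj := chain_behead c.
have := up _ cj; rewrite leq_eqVlt => /orP[/eqP sz|]; last by [].
have /andP[bij fij] := chain_head2 cj; have iN := chain_lt (chain_behead cj).
have fv : f i' = v.
  apply/eqP; rewrite eqn_leq; apply/andP; split; last first.
    by have [_ le] := f_best iN bij fij; rewrite -sz; apply: le.
  by have [[l2 c2 <-] _] := f_best iN bij fij; apply: up.
have /negP := blk _ iN bij fij fv; case.
by move: c; rewrite chain_cons /= => /and3P[_ /and3P[_ /andP[]]].
Qed.

End Step.

Lemma best1_max j f v : (j < n)%N ->
  (forall i, (i < n)%N -> before i j -> far i j -> best2 i j (f i)) ->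
  (0 < v)%N -> (forall i, (i < n)%N -> before i j -> far i j -> f i <= v)%N ->
  v = 1%N \/ (exists i, [/\ (i < n)%N, before i j, far i j & f i = v]) ->
  best1 j v.
Proof.
move=> jn fb v0 up wit; split.
  case: wit => [->|[i [iN bij fij <-]]].
    by exists [::] => //; rewrite chain_cons jn.
  by have [[l cl sl] _] := fb i iN bij fij; exists (i :: l).
move=> [|i l] c //; have /andP[bij fij] := chain_head2 c.
have iN := chain_lt (chain_behead c).
by apply: leq_trans (up i iN bij fij); have [_ ->] := fb i iN bij fij.
Qed.

End Chains.

(** * A while language and its compilation *)

Inductive iexp : Type :=
| EN
| EC of nat
| EV of nat
| EAdd of iexp & iexp
| ESub of iexp & iexp
| EGet of nat & iexp & iexp.

Inductive rexp : Type :=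
| FC of int
| FV of nat
| FAdd of rexp & rexp
| FSub of rexp & rexp
| FMul of rexp & rexp
| FGet of nat & iexp
| FX of iexp
| FY of iexp.

Inductive bexp : Type :=
| BLe of iexp & iexp
| BRle of rexp & rexp
| BNot of bexp
| BAnd of bexp & bexp.

Inductive cmd : Type :=
| CSkip
| CI of nat & iexp
| CR of nat & rexp
| CSet of nat & iexp & iexp & iexp
| CRSet of nat & iexp & rexp
| COut of iexp & iexp
| CSeq of cmd & cmd
| CIf of bexp & cmd & cmd
| CWhile of bexp & cmd.

(** Bound on the numbers of arrays. Integer and real arrays are numbered separately, as they live in
    two memories; one-dimensional integer arrays occupy row 0. *)
Definition narr := 14%N.

Section Semantics.
Variable R : realType.
Variables (n : nat) (cx cy : nat -> R).

Record hst : Type := Hst {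
  iv : nat -> nat;
  rv : nat -> R;
  ia : nat -> nat -> nat -> nat;
  ra : nat -> nat -> R;
  out : nat -> nat
}.

Definition upd2 (T : Type) (f : nat -> nat -> T) i j (x : T) : nat -> nat -> T :=
  fun i' j' => if (i' == i) && (j' == j) then x else f i' j'.

Definition set_iv h v x := Hst (upd (iv h) v x) (rv h) (ia h) (ra h) (out h).
Definition set_rv h v x := Hst (iv h) (upd (rv h) v x) (ia h) (ra h) (out h).
Definition set_ia h q i j x :=
  Hst (iv h) (rv h) (upd (ia h) q (upd2 (ia h q) i j x)) (ra h) (out h).
Definition set_ra h q i x :=
  Hst (iv h) (rv h) (ia h) (upd (ra h) q (upd (ra h q) i x)) (out h).
Definition set_out h i x := Hst (iv h) (rv h) (ia h) (ra h) (upd (out h) i x).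

Fixpoint ieval h e : nat :=
  match e with
  | EN => n
  | EC k => k
  | EV v => iv h v
  | EAdd a b => (ieval h a + ieval h b)%N
  | ESub a b => (ieval h a - ieval h b)%N
  | EGet q a b => ia h q (ieval h a) (ieval h b)
  end.

(** Evaluation is total; safety keeps array indices below [n], where the memory layout of the
    compiled program is faithful. *)
Fixpoint isafe h e : bool :=
  match e with
  | EAdd a b | ESub a b => isafe h a && isafe h b
  | EGet q a b =>
      [&& (q < narr)%N, isafe h a, isafe h b, ieval h a < n & ieval h b < n]%N
  | _ => true
  end.

Fixpoint reval h e : R :=
  match e with
  | FC z => z%:~R
  | FV v => rv h v
  | FAdd a b => reval h a + reval h b
  | FSub a b => reval h a - reval h b
  | FMul a b => reval h a * reval h b
  | FGet q a => ra h q (ieval h a)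
  | FX a => cx (ieval h a)
  | FY a => cy (ieval h a)
  end.

Fixpoint rsafe h e : bool :=
  match e with
  | FAdd a b | FSub a b | FMul a b => rsafe h a && rsafe h b
  | FGet q a => [&& (q < narr)%N, isafe h a & ieval h a < n]%N
  | FX a | FY a => isafe h a && (ieval h a < n)%N
  | _ => true
  end.

Fixpoint beval h e : bool :=
  match e with
  | BLe a b => (ieval h a <= ieval h b)%N
  | BRle a b => reval h a <= reval h b
  | BNot a => ~~ beval h a
  | BAnd a b => beval h a && beval h b
  end.

(** A conjunction is evaluated from left to right and stops at a false operand, so that a guard can
    protect an array access. *)
Fixpoint bsafe h e : bool :=
  match e with
  | BLe a b => isafe h a && isafe h b
  | BRle a b => rsafe h a && rsafe h b
  | BNot a => bsafe h a
  | BAnd a b => bsafe h a && (beval h a ==> bsafe h b)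
  end.

(* The last argument counts the loop iterations. *)
Inductive ev : cmd -> hst -> hst -> nat -> Prop :=
| ev_skip h : ev CSkip h h 0
| ev_i v e h : isafe h e -> ev (CI v e) h (set_iv h v (ieval h e)) 0
| ev_r v e h : rsafe h e -> ev (CR v e) h (set_rv h v (reval h e)) 0
| ev_set q a b e h :
    [&& (q < narr)%N, isafe h a, isafe h b, isafe h e,
        ieval h a < n & ieval h b < n]%N ->
    ev (CSet q a b e) h (set_ia h q (ieval h a) (ieval h b) (ieval h e)) 0
| ev_rset q a e h :
    [&& (q < narr)%N, isafe h a, rsafe h e & ieval h a < n]%N ->
    ev (CRSet q a e) h (set_ra h q (ieval h a) (reval h e)) 0
| ev_out a e h : [&& isafe h a, isafe h e & ieval h a < n]%N ->
    ev (COut a e) h (set_out h (ieval h a) (ieval h e)) 0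
| ev_seq c1 c2 h1 h2 h3 t1 t2 : ev c1 h1 h2 t1 -> ev c2 h2 h3 t2 ->
    ev (CSeq c1 c2) h1 h3 (t1 + t2)%N
| ev_if b c1 c2 h1 h2 t : bsafe h1 b ->
    ev (if beval h1 b then c1 else c2) h1 h2 t -> ev (CIf b c1 c2) h1 h2 t
| ev_done b c h : bsafe h b -> ~~ beval h b -> ev (CWhile b c) h h 0
| ev_loop b c h1 h2 h3 t1 t2 : bsafe h1 b -> beval h1 b -> ev c h1 h2 t1 ->
    ev (CWhile b c) h2 h3 t2 -> ev (CWhile b c) h1 h3 (t1 + t2).+1%N.

End Semantics.

Section Code.
Local Open Scope nat_scope.

(* Even registers hold [n] (integer register 0) and the variables, odd ones
   are the evaluation stack. *)
Definition tmp d := d.*2.+1.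

(* There is no integer multiplication: address [n + (q * n + i)] holds the
   address of row [i] of the array [q]. *)
Definition row_address d q : seq instr :=
  nseq q.+1 (IAdd d d 0) ++ [:: ILoad d d].

(** The value is left in register [tmp d], the levels above being scratch. There is no move
    instruction: a register is copied by adding it to 0. *)
Fixpoint comp_i d e : seq instr :=
  match e with
  | EN => [:: IConst (tmp d) 0; IAdd (tmp d) (tmp d) 0]
  | EC k => [:: IConst (tmp d) k]
  | EV v => [:: IConst (tmp d) 0; IAdd (tmp d) (tmp d) v.*2.+2]
  | EAdd a b => comp_i d a ++ comp_i d.+1 b ++ [:: IAdd (tmp d) (tmp d) (tmp d.+1)]
  | ESub a b => comp_i d a ++ comp_i d.+1 b ++ [:: ISub (tmp d) (tmp d) (tmp d.+1)]
  | EGet q a b =>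
      comp_i d a ++ comp_i d.+1 b ++ row_address (tmp d) q ++
      [:: IAdd (tmp d) (tmp d) (tmp d.+1); ILoad (tmp d) (tmp d)]
  end.

Definition row0_address d q : seq instr :=
  [:: IConst (tmp d.+1) 0] ++ row_address (tmp d.+1) q ++
  [:: IAdd (tmp d) (tmp d.+1) (tmp d)].

Fixpoint comp_r d e : seq instr :=
  match e with
  | FC z => [:: RConst (tmp d) z]
  | FV v => [:: RConst (tmp d) 0; RAdd (tmp d) (tmp d) v.*2]
  | FAdd a b => comp_r d a ++ comp_r d.+1 b ++ [:: RAdd (tmp d) (tmp d) (tmp d.+1)]
  | FSub a b => comp_r d a ++ comp_r d.+1 b ++ [:: RSub (tmp d) (tmp d) (tmp d.+1)]
  | FMul a b => comp_r d a ++ comp_r d.+1 b ++ [:: RMul (tmp d) (tmp d) (tmp d.+1)]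
  | FGet q a => comp_i d a ++ row0_address d q ++ [:: RLoad (tmp d) (tmp d)]
  | FX a => comp_i d a ++ [:: IAdd (tmp d) (tmp d) (tmp d); RLoad (tmp d) (tmp d)]
  | FY a => comp_i d a ++
      [:: IAdd (tmp d) (tmp d) (tmp d); IConst (tmp d.+1) 1;
          IAdd (tmp d) (tmp d) (tmp d.+1); RLoad (tmp d) (tmp d)]
  end.

(** [base] is the address of the first instruction, as jump targets are absolute. The result is 0 or
    1; with truncated subtraction, [a <= b] is [1 - (a - b)]. *)
Fixpoint comp_b base d e : seq instr :=
  match e with
  | BLe a b => comp_i d a ++ comp_i d.+1 b ++
      [:: ISub (tmp d) (tmp d) (tmp d.+1); IConst (tmp d.+1) 1;
          ISub (tmp d) (tmp d.+1) (tmp d)]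
  | BRle a b =>
      let l := comp_r d a ++ comp_r d.+1 b in
      l ++ [:: IConst (tmp d) 1; JmpRLe (tmp d) (tmp d.+1) (base + size l + 3);
               IConst (tmp d) 0]
  | BNot a => comp_b base d a ++
      [:: IConst (tmp d.+1) 1; ISub (tmp d) (tmp d.+1) (tmp d)]
  | BAnd a b =>
      let l := comp_b base d a in
      let lb := comp_b (base + size l + 2) d b in
      l ++ [:: IConst (tmp d.+1) 0;
               JmpILe (tmp d) (tmp d.+1) (base + size l + 2 + size lb)] ++ lb
  end.

Fixpoint comp_c base c : seq instr :=
  match c with
  | CSkip => [::]
  | CI v e => comp_i 0 e ++ [:: IConst (tmp 1) 0; IAdd v.*2.+2 (tmp 0) (tmp 1)]
  | CR v e => comp_r 0 e ++ [:: RConst (tmp 1) 0; RAdd v.*2 (tmp 0) (tmp 1)]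
  | CSet q a b e => comp_i 0 e ++ comp_i 1 a ++ comp_i 2 b ++
      row_address (tmp 1) q ++
      [:: IAdd (tmp 1) (tmp 1) (tmp 2); IStore (tmp 1) (tmp 0)]
  | CRSet q a e => comp_r 0 e ++ comp_i 1 a ++ row0_address 1 q ++
      [:: RStore (tmp 1) (tmp 0)]
  | COut a e => comp_i 0 e ++ comp_i 1 a ++ [:: IStore (tmp 1) (tmp 0)]
  | CSeq a b =>
      let l := comp_c base a in l ++ comp_c (base + size l) b
  | CIf b c1 c2 =>
      let lb := comp_b base 0 b in
      let l1 := comp_c (base + size lb + 2) c1 in
      let l2 := comp_c (base + size lb + size l1 + 3) c2 in
      lb ++ [:: IConst (tmp 1) 0;
                JmpILe (tmp 0) (tmp 1) (base + size lb + size l1 + 3)] ++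
      l1 ++ [:: Jmp (base + size lb + size l1 + size l2 + 3)] ++ l2
  | CWhile b c =>
      let lb := comp_b base 0 b in
      let l := comp_c (base + size lb + 2) c in
      lb ++ [:: IConst (tmp 1) 0;
                JmpILe (tmp 0) (tmp 1) (base + size lb + size l + 3)] ++
      l ++ [:: Jmp base]
  end.

End Code.

(** * Simulation of the while language by the machine *)

Section Compiler.
Variable R : realType.
Variables (n : nat) (cx cy : nat -> R) (P : program).
Local Notation state := (state R).
Local Notation hst := (hst R).
Local Open Scope nat_scope.

(** The integer memory holds [n] cells of output, then [narr * n] row addresses; the arrays start at
    [narr.+2 * n], beyond both. The real memory places its arrays at the same addresses, beyond the
    coordinates of the input. *)
Definition mem_bound := narr.+2 * n + narr * n * n.
Local Notation B := mem_bound.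

Definition reach t (s s' : state) : Prop :=
  run P t s = Some s' /\
  forall k, k < t ->
    exists2 u, run P k s = Some u & (iextent P u <= B) && (rextent P u <= B).

Definition code_at b l : Prop := forall k i, onth l k = Some i -> onth P (b + k) = Some i.

Lemma code_at_cat b l1 l2 :
  code_at b (l1 ++ l2) <-> code_at b l1 /\ code_at (b + size l1) l2.
Proof.
split=> [h|[h1 h2] k i].
  split=> k i e.
    by apply: h; rewrite onth_cat -onthTE e.
  by rewrite -addnA; apply: h; rewrite onth_cat ltnNge leq_addr /= addKn.
rewrite onth_cat; case: ltnP => [_|le e]; first exact: h1.
by rewrite -(subnKC le) addnA; apply: h2.
Qed.

Lemma code_at0 b i l : code_at b (i :: l) -> onth P b = Some i.
Proof. by move=> c; rewrite -[b]addn0; apply: c. Qed.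

Lemma code_atS b i l : code_at b (i :: l) -> code_at b.+1 l.
Proof. by move=> c k j e; rewrite addSnnS; apply: c. Qed.

Lemma run_add t1 t2 (s s1 : state) :
  run P t1 s = Some s1 -> run P (t1 + t2) s = run P t2 s1.
Proof. by rewrite /run addnC iterD => ->. Qed.

Lemma reach0 s : reach 0 s s.
Proof. by split. Qed.

Lemma reach_trans t1 t2 s s1 s2 : reach t1 s s1 -> reach t2 s1 s2 -> reach (t1 + t2) s s2.
Proof.
move=> [r1 b1] [r2 b2]; split; first by rewrite (run_add _ r1).
move=> k kt; case: (ltnP k t1) => [/b1 //|le].
by rewrite -(subnKC le) (run_add _ r1); apply: b2; lia.
Qed.

Definition extent (i : instr) (s : state) : nat :=
  match i with
  | ILoad _ a | IStore a _ | RLoad _ a | RStore a _ => (ireg s a).+1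
  | _ => 0
  end.

Lemma reach1 i s s' : onth P (pc s) = Some i -> exec i s = Some s' -> extent i s <= B ->
  reach 1 s s'.
Proof.
move=> f e x; split; first by rewrite /run /= /step /fetch f.
case=> // _; exists s => //.
by rewrite /iextent /rextent /fetch f; case: i {f e} x => //= *; apply/andP.
Qed.

(* Only the evaluation stack changes, from level [d] on. *)
Definition stacked d (s s' : state) : Prop :=
  [/\ forall r, ~~ odd r || (r < tmp d) -> ireg s' r = ireg s r,
      forall r, ~~ odd r || (r < tmp d) -> rreg s' r = rreg s r,
      imem s' = imem s & rmem s' = rmem s].

Lemma stacked_refl d s : stacked d s s.
Proof. by split. Qed.

Lemma stacked_trans d d' s s1 s2 : d <= d' -> stacked d s s1 -> stacked d' s1 s2 ->
  stacked d s s2.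
Proof.
move=> dd [a b c e] [a' b' c' e']; split; rewrite ?c' ?e' // => r h.
  by rewrite a' ?a //; case/orP: h => [->//|h]; apply/orP; right; rewrite /tmp in h *; lia.
by rewrite b' ?b //; case/orP: h => [->//|h]; apply/orP; right; rewrite /tmp in h *; lia.
Qed.

(** Code of expressions jumps only forward, whence at most one step per instruction. The effect on
    the state is stated independently of the code being in [P], on which only the run depends. *)
Definition sem l d s s' : Prop :=
  [/\ stacked d s s', pc s' = pc s + size l &
      code_at (pc s) l -> exists2 t, t <= size l & reach t s s'].

Lemma sem_cat l1 l2 d d' s s1 s2 : sem l1 d s s1 -> d <= d' -> sem l2 d' s1 s2 ->
  sem (l1 ++ l2) d s s2.
Proof.
move=> [a1 p1 r1] dd [a2 p2 r2]; split; first exact: stacked_trans a2.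
  by rewrite p2 p1 size_cat addnA.
move=> /code_at_cat [/r1[t1 le1 x1]]; rewrite -p1 => /r2[t2 le2 x2].
by exists (t1 + t2); [rewrite size_cat; lia|exact: reach_trans x2].
Qed.

Lemma sem_weaken l d d' s s' : d <= d' -> sem l d' s s' -> sem l d s s'.
Proof.
by move=> dd [a p r]; split=> //; apply: (stacked_trans dd (stacked_refl d s) a).
Qed.

Lemma sem_instr i d s s' : exec i s = Some s' -> extent i s <= B -> pc s' = (pc s).+1 ->
  stacked d s s' -> sem [:: i] d s s'.
Proof.
move=> e x p a; split => //; first by rewrite p addn1.
move=> c; exists 1 => //; apply: (reach1 _ e x).
by rewrite -[pc s]addn0; apply: c.
Qed.

Lemma stacked_ireg d k s v : d <= k -> stacked d s (set_ireg s (tmp k) v).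
Proof.
move=> dk; split => //= r h; rewrite /upd; case: eqP => // rk.
by move: h; rewrite rk /tmp; lia.
Qed.

Lemma stacked_rreg d k s v : d <= k -> stacked d s (set_rreg s (tmp k) v).
Proof.
move=> dk; split => //= r h; rewrite /upd; case: eqP => // rk.
by move: h; rewrite rk /tmp; lia.
Qed.

Lemma ireg_set (s : state) k v : ireg (set_ireg s k v) k = v.
Proof. by rewrite /= /upd eqxx. Qed.

Definition addr q i j := narr.+2 * n + (q * n + i) * n + j.

Record represents (h : hst) (s : state) : Prop := Rel {
  represents_n : ireg s 0 = n;
  represents_iv : forall v, ireg s v.*2.+2 = iv h v;
  represents_rv : forall v, rreg s v.*2 = rv h v;
  represents_row : forall q i, q < narr -> i < n -> imem s (n + (q * n + i)) = addr q i 0;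
  represents_ia : forall q i j, q < narr -> i < n -> j < n -> imem s (addr q i j) = ia h q i j;
  represents_ra : forall q j, q < narr -> j < n -> rmem s (addr q 0 j) = ra h q j;
  represents_out : forall i, i < n -> imem s i = out h i;
  represents_cx : forall i, i < n -> rmem s i.*2 = cx i;
  represents_cy : forall i, i < n -> rmem s i.*2.+1 = cy i
}.

Lemma represents_stacked h d s s' : represents h s -> stacked d s s' -> represents h s'.
Proof.
move=> [r1 r2 r3 r4 r5 r6 r7 r8 r9] [a b c e].
by split=> *; rewrite ?c ?e ?a ?b /= ?odd_double //; auto.
Qed.

Lemma addr_bound q i j : q < narr -> i < n -> j < n -> addr q i j < B.
Proof.
move=> hq hi hj; rewrite /addr /B -addnA ltn_add2l.
have h : q * n + i < narr * n by apply: leq_trans (_ : q.+1 * n <= _); nia.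
by apply: leq_trans (_ : (q * n + i).+1 * n <= _); nia.
Qed.

(** Beyond the common offset, an address is the number with digits [q], [i], [j] in base [n]. *)
Lemma addr_inj q i j q' i' j' : i < n -> j < n -> i' < n -> j' < n ->
  addr q i j = addr q' i' j' -> [/\ q = q', i = i' & j = j'].
Proof.
move=> hi hj hi' hj'; rewrite /addr -[LHS]addnA -[RHS]addnA => /addnI e.
have n0 : 0 < n by lia.
have jj : j = j' by have := congr1 (modn^~ n) e; rewrite /= !modnMDl !modn_small.
have e2 : q * n + i = q' * n + i'.
  by have := congr1 (divn^~ n) e; rewrite /= !divnMDl // !divn_small // !addn0.
have ii : i = i' by have := congr1 (modn^~ n) e2; rewrite /= !modnMDl !modn_small.
split=> //.
by have := congr1 (divn^~ n) e2; rewrite /= !divnMDl // !divn_small // !addn0.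
Qed.

Lemma sem_nil d s : sem [::] d s s.
Proof.
split; rewrite ?addn0 //.
by move=> _; exists 0 => //; apply: reach0.
Qed.

Definition only_ireg k (s s' : state) : Prop :=
  [/\ forall r, r != k -> ireg s' r = ireg s r, rreg s' = rreg s, imem s' = imem s &
      rmem s' = rmem s].

Lemma sem_adds m k s : ireg s 0 = n -> exists s',
  [/\ sem (nseq m (IAdd (tmp k) (tmp k) 0)) k s s', ireg s' (tmp k) = ireg s (tmp k) + m * n &
      only_ireg (tmp k) s s'].
Proof.
elim: m s => [|m IH] s sn.
  by exists s; split; [exact: sem_nil|rewrite addn0|].
set s1 := set_ireg s (tmp k) (ireg s (tmp k) + ireg s 0).
have [|s' [x v [eo1 eo2 eo3 eo4]]] := IH s1; first by rewrite /= /upd.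
exists s'; split.
- apply: (@sem_cat [:: _] (nseq m _) k k s s1) => //.
  by apply: sem_instr => //; apply: stacked_ireg.
- by rewrite v /= /upd eqxx sn; lia.
- by split=> // r rk; rewrite eo1 //= /upd (negbTE rk).
Qed.

Lemma row_entry_bound q i : q < narr -> i < n -> n + (q * n + i) < B.
Proof.
move=> hq hi; rewrite /B; apply: leq_trans (leq_addr _ _).
have : q.+1 * n <= narr * n by rewrite leq_mul2r hq orbT.
by rewrite !mulSn; lia.
Qed.

Lemma sem_row_address k q s h : represents h s -> q < narr -> ireg s (tmp k) < n -> exists s',
  [/\ sem (row_address (tmp k) q) k s s',
      ireg s' (tmp k) = addr q (ireg s (tmp k)) 0 & only_ireg (tmp k) s s'].
Proof.
move=> hr hq hi; have [s1 [x v [eo1 eo2 eo3 eo4]]] := sem_adds q.+1 k (represents_n hr).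
exists (set_ireg s1 (tmp k) (imem s1 (ireg s1 (tmp k)))); split.
- apply: sem_cat x (leqnn k) _; apply: sem_instr => //; last exact: stacked_ireg.
  by rewrite /= v; have := row_entry_bound hq hi; lia.
- rewrite /= /upd eqxx eo3 v -(represents_row hr) //; congr (imem s _); lia.
- by split => // r rk; rewrite /= /upd (negbTE rk) eo1.
Qed.

Lemma tmp_neqS d : tmp d.+1 != tmp d.
Proof. by rewrite /tmp; lia. Qed.

Lemma tmp_lt d e : d < e -> tmp d < tmp e.
Proof. by rewrite /tmp; lia. Qed.

Lemma represents_sem h l d s s' : represents h s -> sem l d s s' -> represents h s'.
Proof. by move=> hr [a _ _]; apply: represents_stacked a. Qed.

Lemma comp2 h d s (la lb : nat -> seq instr) a b (sa sb : bool) :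
  (forall d s, represents h s -> sa ->
    exists2 s', sem (la d) d s s' & ireg s' (tmp d) = a) ->
  (forall d s, represents h s -> sb ->
    exists2 s', sem (lb d) d s s' & ireg s' (tmp d) = b) ->
  represents h s -> sa -> sb ->
  exists2 s', sem (la d ++ lb d.+1) d s s' &
    ireg s' (tmp d) = a /\ ireg s' (tmp d.+1) = b.
Proof.
move=> Ha Hb hr ha hb; have [s1 x1 v1] := Ha d s hr ha.
have [s2 x2 v2] := Hb d.+1 s1 (represents_sem hr x1) hb.
exists s2; first exact: sem_cat x2.
by split=> //; case: x2 => [[a2 _ _ _] _ _]; rewrite a2 ?v1 // tmp_lt ?orbT.
Qed.

Lemma comp_i_ok h e d s : represents h s -> isafe n h e ->
  exists2 s', sem (comp_i d e) d s s' & ireg s' (tmp d) = ieval n h e.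
Proof.
elim: e d s => [|k|v|a IHa b IHb|a IHa b IHb|q a IHa b IHb] d s hr /=.
- move=> _; set s1 := set_ireg s (tmp d) 0.
  exists (set_ireg s1 (tmp d) (ireg s1 (tmp d) + ireg s1 0)).
    apply: (@sem_cat [:: _] [:: _] d d s s1) => //;
      by apply: sem_instr => //; apply: stacked_ireg.
  by rewrite /= /upd eqxx /= (represents_n hr).
- move=> _; exists (set_ireg s (tmp d) k); last by rewrite /= /upd eqxx.
  by apply: sem_instr => //; apply: stacked_ireg.
- move=> _; set s1 := set_ireg s (tmp d) 0.
  exists (set_ireg s1 (tmp d) (ireg s1 (tmp d) + ireg s1 v.*2.+2)).
    apply: (@sem_cat [:: _] [:: _] d d s s1) => //;
      by apply: sem_instr => //; apply: stacked_ireg.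
  rewrite /= /upd eqxx /= -(represents_iv hr); case: eqP => //; rewrite /tmp; lia.
- case/andP=> sa sb; have [s2 x2 [v1 v2]] := comp2 d IHa IHb hr sa sb.
  exists (set_ireg s2 (tmp d) (ireg s2 (tmp d) + ireg s2 (tmp d.+1))).
    rewrite catA; apply: sem_cat x2 (leqnn _) _.
    by apply: sem_instr => //; apply: stacked_ireg.
  by rewrite /= /upd eqxx v1 v2.
- case/andP=> sa sb; have [s2 x2 [v1 v2]] := comp2 d IHa IHb hr sa sb.
  exists (set_ireg s2 (tmp d) (ireg s2 (tmp d) - ireg s2 (tmp d.+1))).
    rewrite catA; apply: sem_cat x2 (leqnn _) _.
    by apply: sem_instr => //; apply: stacked_ireg.
  by rewrite /= /upd eqxx v1 v2.
case/and5P=> hq sa sb la lb; have [s2 x2 [v1 v2]] := comp2 d IHa IHb hr sa sb.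
have hr2 := represents_sem hr x2.
have la2 : ireg s2 (tmp d) < n by rewrite v1.
have [s3 [x3 v3 [eo1 eo2 eo3 eo4]]] := sem_row_address hr2 hq la2.
set s4 := set_ireg s3 (tmp d) (ireg s3 (tmp d) + ireg s3 (tmp d.+1)).
have v4 : ireg s4 (tmp d) = addr q (ieval n h a) (ieval n h b).
  by rewrite /= /upd eqxx v3 eo1 ?tmp_neqS // v1 v2 /addr addn0.
exists (set_ireg s4 (tmp d) (imem s4 (ireg s4 (tmp d)))); last first.
  by rewrite ireg_set v4 [imem s4]eo3 (represents_ia hr2).
rewrite catA; apply: sem_cat x2 (leqnn _) _; apply: sem_cat x3 (leqnn _) _.
apply: (@sem_cat [:: _] [:: _] d d _ s4) => //.
  by apply: sem_instr => //; apply: stacked_ireg.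
apply: sem_instr => //; last exact: stacked_ireg.
by rewrite /extent v4 addr_bound.
Qed.

Lemma sem_row0_address d q s h : represents h s -> q < narr -> ireg s (tmp d) < n ->
  exists2 s', sem (row0_address d q) d s s' & ireg s' (tmp d) = addr q 0 (ireg s (tmp d)).
Proof.
move=> hr hq hd; set s1 := set_ireg s (tmp d.+1) 0.
have x1 : sem [:: IConst (tmp d.+1) 0] d s s1.
  by apply: sem_instr => //; apply: stacked_ireg.
have z : ireg s1 (tmp d.+1) < n by rewrite ireg_set; lia.
have [s2 [x2 v2 [eo1 eo2 eo3 eo4]]] := sem_row_address (represents_sem hr x1) hq z.
exists (set_ireg s2 (tmp d) (ireg s2 (tmp d.+1) + ireg s2 (tmp d))).
  apply: sem_cat x1 (leqnn d) _; apply: sem_cat (sem_weaken (leqnSn d) x2) (leqnn d) _.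
  by apply: sem_instr => //; apply: stacked_ireg.
rewrite ireg_set v2 eo1 1?eq_sym ?tmp_neqS // ireg_set.
rewrite /s1 /= /upd ifN 1?eq_sym ?tmp_neqS // /addr; lia.
Qed.

Lemma input_bound i : i < n -> i.*2.+1 < B.
Proof. by rewrite /B !mulSn; lia. Qed.

Lemma comp2r h d s (la lb : nat -> seq instr) (a b : R) (sa sb : bool) :
  (forall d s, represents h s -> sa ->
    exists2 s', sem (la d) d s s' & rreg s' (tmp d) = a) ->
  (forall d s, represents h s -> sb ->
    exists2 s', sem (lb d) d s s' & rreg s' (tmp d) = b) ->
  represents h s -> sa -> sb ->
  exists2 s', sem (la d ++ lb d.+1) d s s' &
    rreg s' (tmp d) = a /\ rreg s' (tmp d.+1) = b.
Proof.
move=> Ha Hb hr ha hb; have [s1 x1 v1] := Ha d s hr ha.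
have [s2 x2 v2] := Hb d.+1 s1 (represents_sem hr x1) hb.
exists s2; first exact: sem_cat x2.
by split=> //; case: x2 => [[_ a2 _ _] _ _]; rewrite a2 ?v1 // tmp_lt ?orbT.
Qed.

Lemma rreg_set (s : state) k v : rreg (set_rreg s k v) k = v.
Proof. by rewrite /= /upd eqxx. Qed.

Lemma comp_r_ok h e d s : represents h s -> rsafe n h e ->
  exists2 s', sem (comp_r d e) d s s' & rreg s' (tmp d) = reval n cx cy h e.
Proof.
elim: e d s => [z|v|a IHa b IHb|a IHa b IHb|a IHa b IHb|q a|a|a] d s hr /=.
- move=> _; exists (set_rreg s (tmp d) z%:~R); last by rewrite rreg_set.
  by apply: sem_instr => //; apply: stacked_rreg.
- move=> _; set s1 := set_rreg s (tmp d) 0%:~R.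
  exists (set_rreg s1 (tmp d) (rreg s1 (tmp d) + rreg s1 v.*2)%R).
    apply: (@sem_cat [:: _] [:: _] d d s s1) => //;
      by apply: sem_instr => //; apply: stacked_rreg.
  rewrite rreg_set rreg_set add0r -(represents_rv hr) /= /upd; case: eqP => //.
  by rewrite /tmp; lia.
- case/andP=> sa sb; have [s2 x2 [v1 v2]] := comp2r d IHa IHb hr sa sb.
  exists (set_rreg s2 (tmp d) (rreg s2 (tmp d) + rreg s2 (tmp d.+1))%R).
    rewrite catA; apply: sem_cat x2 (leqnn _) _.
    by apply: sem_instr => //; apply: stacked_rreg.
  by rewrite rreg_set v1 v2.
- case/andP=> sa sb; have [s2 x2 [v1 v2]] := comp2r d IHa IHb hr sa sb.
  exists (set_rreg s2 (tmp d) (rreg s2 (tmp d) - rreg s2 (tmp d.+1))%R).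
    rewrite catA; apply: sem_cat x2 (leqnn _) _.
    by apply: sem_instr => //; apply: stacked_rreg.
  by rewrite rreg_set v1 v2.
- case/andP=> sa sb; have [s2 x2 [v1 v2]] := comp2r d IHa IHb hr sa sb.
  exists (set_rreg s2 (tmp d) (rreg s2 (tmp d) * rreg s2 (tmp d.+1))%R).
    rewrite catA; apply: sem_cat x2 (leqnn _) _.
    by apply: sem_instr => //; apply: stacked_rreg.
  by rewrite rreg_set v1 v2.
- case/and3P=> hq sa la; have [s1 x1 v1] := comp_i_ok d hr sa.
  have hr1 := represents_sem hr x1; rewrite -v1 in la.
  have [s2 x2 v2] := sem_row0_address hr1 hq la.
  exists (set_rreg s2 (tmp d) (rmem s2 (ireg s2 (tmp d)))).
    apply: sem_cat x1 (leqnn _) _; apply: sem_cat x2 (leqnn _) _.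
    apply: sem_instr => //; last exact: stacked_rreg.
    by rewrite /extent v2 addr_bound //; lia.
  by rewrite rreg_set v2 (represents_ra (represents_sem hr1 x2)) ?v1 // -v1.
- case/andP=> sa la; have [s1 x1 v1] := comp_i_ok d hr sa.
  have hr1 := represents_sem hr x1.
  set s2 := set_ireg s1 (tmp d) (ireg s1 (tmp d) + ireg s1 (tmp d)).
  have v2 : ireg s2 (tmp d) = (ieval n h a).*2 by rewrite ireg_set v1 addnn.
  exists (set_rreg s2 (tmp d) (rmem s2 (ireg s2 (tmp d)))).
    apply: sem_cat x1 (leqnn _) _; apply: (@sem_cat [:: _] [:: _] d d _ s2) => //.
      by apply: sem_instr => //; apply: stacked_ireg.
    apply: sem_instr => //; last exact: stacked_rreg.
    by rewrite /extent v2; have := input_bound la; lia.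
  by rewrite rreg_set v2; apply: (represents_cx hr1).
- case/andP=> sa la; have [s1 x1 v1] := comp_i_ok d hr sa.
  have hr1 := represents_sem hr x1.
  set s2 := set_ireg s1 (tmp d) (ireg s1 (tmp d) + ireg s1 (tmp d)).
  set s3 := set_ireg s2 (tmp d.+1) 1.
  set s4 := set_ireg s3 (tmp d) (ireg s3 (tmp d) + ireg s3 (tmp d.+1)).
  have v2 : ireg s4 (tmp d) = (ieval n h a).*2.+1.
    rewrite ireg_set [ireg s3 (tmp d.+1)]ireg_set /s3 /= /upd ifN 1?eq_sym ?tmp_neqS //.
    by rewrite eqxx v1; lia.
  exists (set_rreg s4 (tmp d) (rmem s4 (ireg s4 (tmp d)))).
    apply: sem_cat x1 (leqnn _) _; apply: (@sem_cat [:: _] _ d d _ s2) => //.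
      by apply: sem_instr => //; apply: stacked_ireg.
    apply: (@sem_cat [:: _] _ d d _ s3) => //.
      by apply: sem_instr => //; apply: stacked_ireg.
    apply: (@sem_cat [:: _] [:: _] d d _ s4) => //.
      by apply: sem_instr => //; apply: stacked_ireg.
    apply: sem_instr => //; last exact: stacked_rreg.
    by rewrite /extent v2; have := input_bound la; lia.
  by rewrite rreg_set v2; apply: (represents_cy hr1).
Qed.

Lemma comp_b_ok h e d s : represents h s -> bsafe n cx cy h e ->
  exists2 s', sem (comp_b (pc s) d e) d s s' &
    ireg s' (tmp d) = nat_of_bool (beval n cx cy h e).
Proof.
elim: e d s => [a b|a b|a IHa|a IHa b IHb] d s hr /=.
- case/andP=> sa sb.
  have [s2 x2 [v1 v2]] := comp2 d (@comp_i_ok h a) (@comp_i_ok h b) hr sa sb.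
  set s3 := set_ireg s2 (tmp d) (ireg s2 (tmp d) - ireg s2 (tmp d.+1)).
  set s4 := set_ireg s3 (tmp d.+1) 1.
  exists (set_ireg s4 (tmp d) (ireg s4 (tmp d.+1) - ireg s4 (tmp d))).
    rewrite catA; apply: sem_cat x2 (leqnn _) _.
    apply: (@sem_cat [:: _] _ d d _ s3) => //.
      by apply: sem_instr => //; apply: stacked_ireg.
    apply: (@sem_cat [:: _] [:: _] d d _ s4) => //;
      by apply: sem_instr => //; apply: stacked_ireg.
  rewrite ireg_set [ireg s4 (tmp d.+1)]ireg_set /s4 /= /upd ifN 1?eq_sym ?tmp_neqS //.
  by rewrite eqxx v1 v2; lia.
- case/andP=> sa sb.
  have [s2 x2 [v1 v2]] := comp2r d (@comp_r_ok h a) (@comp_r_ok h b) hr sa sb.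
  set l := comp_r d a ++ comp_r d.+1 b in x2 *.
  set s3 := set_ireg s2 (tmp d) 1.
  have x3 : sem (l ++ [:: IConst (tmp d) 1]) d s s3.
    apply: sem_cat x2 (leqnn _) _.
    by apply: sem_instr => //; apply: stacked_ireg.
  have p3 : pc s3 = pc s + size l + 1.
    by case: x3 => _ -> _; rewrite size_cat addnA.
  set s4 := goto s3 (if (rreg s3 (tmp d) <= rreg s3 (tmp d.+1))%R
                     then pc s + size l + 3 else (pc s3).+1).
  have c4 : code_at (pc s) (l ++ [:: IConst (tmp d) 1;
      JmpRLe (tmp d) (tmp d.+1) (pc s + size l + 3); IConst (tmp d) 0]) -> reach 1 s3 s4.
    move=> c; apply: (@reach1 (JmpRLe (tmp d) (tmp d.+1) (pc s + size l + 3))) => //.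
    rewrite p3 -addnA; apply: c.
    by rewrite onth_cat ltnNge leq_addr /= addKn.
  have c5 : code_at (pc s) (l ++ [:: IConst (tmp d) 1;
      JmpRLe (tmp d) (tmp d.+1) (pc s + size l + 3); IConst (tmp d) 0]) ->
    exists2 t, t <= size l + 1 & reach t s s3.
    move=> c; have [_ _ ] := x3; rewrite size_cat; apply.
    have := c; rewrite -cat1s catA => /code_at_cat[]; done.
  case le: (rreg s3 (tmp d) <= rreg s3 (tmp d.+1))%R in s4 c4.
    exists s4; last by rewrite /= /upd eqxx -v1 -v2 le.
    split; first by case: x3 => [[]].
      by rewrite /= size_cat addnA.
    move=> c; have [t le1 r] := c5 c; exists (t + 1); last exact: reach_trans r (c4 c).
    by rewrite size_cat /=; lia.
  set s5 := set_ireg s4 (tmp d) 0.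
  exists s5; last by rewrite ireg_set -v1 -v2 le.
  split.
  - case: x3 => [st _ _]; apply: stacked_trans (leqnn d) st _.
    exact: (@stacked_ireg d d s4).
  - by rewrite (_ : pc s5 = (pc s3).+2) // p3 size_cat /=; lia.
  move=> c; have [t le1 r] := c5 c; exists (t + (1 + 1)).
    by rewrite size_cat /=; lia.
  apply: reach_trans r _; apply: reach_trans (c4 c) _.
  apply: (@reach1 (IConst (tmp d) 0)) => //.
  have -> : pc s4 = pc s + (size l + 2) by rewrite (_ : pc s4 = (pc s3).+1) // p3; lia.
  by apply: c; rewrite onth_cat ltnNge leq_addr /= addKn.
- move=> sa; have [s2 x2 v2] := IHa d s hr sa.
  set s3 := set_ireg s2 (tmp d.+1) 1.
  exists (set_ireg s3 (tmp d) (ireg s3 (tmp d.+1) - ireg s3 (tmp d))).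
    apply: sem_cat x2 (leqnn _) _.
    apply: (@sem_cat [:: _] [:: _] d d _ s3) => //;
      by apply: sem_instr => //; apply: stacked_ireg.
  rewrite ireg_set [ireg s3 (tmp d.+1)]ireg_set /s3 /= /upd ifN 1?eq_sym ?tmp_neqS //.
  by rewrite v2; case: beval.
case/andP=> sa sb; have [s1 x1 v1] := IHa d s hr sa.
set la := comp_b (pc s) d a in x1 *.
set lb := comp_b (pc s + size la + 2) d b.
set s2 := set_ireg s1 (tmp d.+1) 0.
have v2 : ireg s2 (tmp d) = nat_of_bool (beval n cx cy h a).
  by rewrite -v1 /= /upd ifN // eq_sym tmp_neqS.
have v2' : ireg s2 (tmp d.+1) = 0 by rewrite ireg_set.
have x2 : sem (la ++ [:: IConst (tmp d.+1) 0]) d s s2.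
  apply: sem_cat x1 (leqnn d) _.
  by apply: sem_instr => //; apply: stacked_ireg.
have p2 : pc s2 = pc s + size la + 1 by case: x2 => _ -> _; rewrite size_cat addnA.
set s3 := goto s2 (if ireg s2 (tmp d) <= ireg s2 (tmp d.+1)
                   then pc s + size la + 2 + size lb else (pc s2).+1).
have st3 : stacked d s s3 by case: x2.
have y3 : code_at (pc s) (la ++ [:: IConst (tmp d.+1) 0;
    JmpILe (tmp d) (tmp d.+1) (pc s + size la + 2 + size lb)] ++ lb) ->
    exists2 t, t <= size la + 2 & reach t s s3.
  rewrite -cat1s -catA catA => /code_at_cat[c1 c2].
  have [_ _ /(_ c1) [t le_t rt]] := x2; exists (t + 1).
    by move: le_t; rewrite size_cat /=; lia.
  apply: reach_trans rt _.
  apply: (@reach1 (JmpILe (tmp d) (tmp d.+1) (pc s + size la + 2 + size lb))) => //.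
  by apply: code_at0; rewrite p2 -addnA; move: c2; rewrite size_cat; apply.
case av: (beval n cx cy h a) in sb v2 *; last first.
  exists s3; last by rewrite -v2.
  split=> //; first by rewrite /s3 v2 v2' /= !size_cat /=; lia.
  by move=> /y3[t le_t rt]; exists t => //; rewrite !size_cat /=; lia.
have p3 : pc s3 = pc s + size la + 2.
  by rewrite /s3 v2 v2' (_ : pc (goto _ _) = (pc s2).+1) // p2; lia.
have [s4 [st4 p4 x4] v4] := IHb d s3 (represents_stacked hr st3) sb.
rewrite p3 -/lb in p4 x4.
exists s4 => //; split; first exact: stacked_trans (leqnn d) st3 st4.
  by rewrite p4 !size_cat /=; lia.
move=> c; have [t le_t rt] := y3 c.
have [|u le_u ru] := x4.
  have /code_at_cat[_] : code_at (pc s) ((la ++ [:: IConst (tmp d.+1) 0;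
      JmpILe (tmp d) (tmp d.+1) (pc s + size la + 2 + size lb)]) ++ lb).
    by rewrite -catA; exact: c.
  by rewrite size_cat addnA.
exists (t + u); last exact: reach_trans rt ru.
by rewrite !size_cat /=; lia.
Qed.

Lemma represents_goto h s l : represents h s -> represents h (goto s l).
Proof. by case=> *; split. Qed.

Lemma represents_set_iv h s v x : represents h s -> represents (set_iv h v x) (set_ireg s v.*2.+2 x).
Proof.
case=> *; split=> //= v'; rewrite /upd !eqSS (inj_eq double_inj).
by case: eqP.
Qed.

Lemma represents_set_rv h s v x : represents h s -> represents (set_rv h v x) (set_rreg s v.*2 x).
Proof.
by case=> *; split=> //= v'; rewrite /upd (inj_eq double_inj); case: eqP.
Qed.

Lemma addr_ge q i j : narr.+2 * n <= addr q i j.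
Proof. by rewrite /addr -addnA leq_addr. Qed.

Lemma row_lt_addr q i q' i' j' : q < narr -> i < n -> n + (q * n + i) < addr q' i' j'.
Proof.
move=> hq hi; apply: leq_trans (addr_ge _ _ _).
have : q.+1 * n <= narr * n by rewrite leq_mul2r hq orbT.
by rewrite !mulSn; lia.
Qed.

Lemma small_lt_addr a q i j : a < n + n -> a < addr q i j.
Proof.
move=> h; apply: leq_trans (addr_ge _ _ _); apply: leq_trans h _.
by rewrite !mulSn; lia.
Qed.

Lemma represents_set_ia h s q i j x : q < narr -> i < n -> j < n -> represents h s ->
  represents (set_ia h q i j x) (set_imem s (addr q i j) x).
Proof.
move=> hq hi hj [r1 r2 r3 r4 r5 r6 r7 r8 r9]; split=> //=.
- move=> q' i' hq' hi'; rewrite /upd ifN; first exact: r4.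
  by rewrite neq_ltn row_lt_addr.
- move=> q' i' j' hq' hi' hj'; rewrite /upd /upd2.
  case: eqP => [/(addr_inj hi' hj' hi hj)[-> -> ->]|ne]; first by rewrite !eqxx.
  case: eqP => [qq|_]; last exact: r5.
  case: ifP => [/andP[/eqP ii /eqP jj]|_]; first by case: ne; rewrite qq ii jj.
  by rewrite -qq r5.
- move=> i' hi'; rewrite /upd ifN; first exact: r7.
  by rewrite neq_ltn small_lt_addr //; lia.
Qed.

Lemma represents_set_ra h s q j x : q < narr -> j < n -> represents h s ->
  represents (set_ra h q j x) (set_rmem s (addr q 0 j) x).
Proof.
move=> hq hj [r1 r2 r3 r4 r5 r6 r7 r8 r9]; have n0 : 0 < n by lia.
split=> //=.
- move=> q' j' hq' hj'; rewrite /upd.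
  case: eqP => [/(addr_inj n0 hj' n0 hj)[-> _ ->]|ne]; first by rewrite !eqxx.
  case: eqP => [qq|_]; last exact: r6.
  case: eqP => [jj|_]; first by case: ne; rewrite qq jj.
  by rewrite -qq r6.
- move=> i' hi'; rewrite /upd ifN; first exact: r8.
  by rewrite neq_ltn small_lt_addr //; lia.
- move=> i' hi'; rewrite /upd ifN; first exact: r9.
  by rewrite neq_ltn small_lt_addr //; lia.
Qed.

Lemma represents_set_out h s i x : i < n -> represents h s ->
  represents (set_out h i x) (set_imem s i x).
Proof.
move=> hi [r1 r2 r3 r4 r5 r6 r7 r8 r9]; split=> //=.
- move=> q' i' hq' hi'; rewrite /upd ifN; first exact: r4.
  by rewrite neq_ltn; apply/orP; right; lia.
- move=> q' i' j' hq' hi' hj'; rewrite /upd ifN; first exact: r5.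
  by rewrite neq_ltn; apply/orP; right; apply: small_lt_addr; lia.
- by move=> i' hi'; rewrite /upd; case: eqP => // _; exact: r7.
Qed.

(** Apart from what is charged to its subcommands' iterations, a pass through a loop (test, body,
    jump back) executes each instruction of the loop at most once. With [K] at least the size of the
    code, one iteration of the counter [t] pays for it. *)
Definition simulated c h' t s K : Prop :=
  size (comp_c (pc s) c) <= K -> code_at (pc s) (comp_c (pc s) c) ->
  exists s', [/\ represents h' s', pc s' = pc s + size (comp_c (pc s) c) &
    exists2 t', t' <= size (comp_c (pc s) c) + K * t & reach t' s s'].

Lemma sem_simulated c d h' s s' K : represents h' s' -> sem (comp_c (pc s) c) d s s' ->
  simulated c h' 0 s K.
Proof.
move=> r [_ p x] _ ca; exists s'; split=> //.
by case: (x ca) => t ? ?; exists t => //; lia.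
Qed.

Lemma reach_last l i d s s1 s2 : sem l d s s1 -> exec i s1 = Some s2 ->
  extent i s1 <= B -> pc s2 = (pc s1).+1 -> code_at (pc s) (l ++ [:: i]) ->
  pc s2 = pc s + size (l ++ [:: i]) /\
  exists2 t, t <= size (l ++ [:: i]) & reach t s s2.
Proof.
move=> [_ p1 x1] e x p2 /code_at_cat[/x1[t t1 r] ca].
split; first by rewrite p2 p1 size_cat addn1 addnS.
exists (t + 1); first by rewrite size_cat leq_add2r.
apply: reach_trans r (reach1 _ e x).
by rewrite -[pc s1]addn0 p1; apply: ca.
Qed.

Lemma simulated_last c h' l i d s s1 s2 K : comp_c (pc s) c = l ++ [:: i] ->
  sem l d s s1 -> exec i s1 = Some s2 ->
  extent i s1 <= B -> pc s2 = (pc s1).+1 -> represents h' s2 -> simulated c h' 0 s K.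
Proof.
move=> cE x e ex p r _; rewrite cE => ca.
have [p2 [t le x2]] := reach_last x e ex p ca.
by exists s2; split=> //; exists t => //; lia.
Qed.

Lemma simulate_c c h h' t K : ev n cx cy c h h' t -> forall s, represents h s ->
  simulated c h' t s K.
Proof.
elim=> {c h h' t}.
- by move=> h s r; apply: (@sem_simulated _ 0 _ s s); last exact: sem_nil.
- move=> v e h sa s r; have [s1 x1 v1] := comp_i_ok 0 r sa.
  set s2 := set_ireg s1 (tmp 1) 0.
  have x2 : sem (comp_i 0 e ++ [:: IConst (tmp 1) 0]) 0 s s2.
    by apply: sem_cat x1 (leqnn 0) _; apply: sem_instr => //; apply: stacked_ireg.
  apply: (@simulated_last _ _ _ (IAdd v.*2.+2 (tmp 0) (tmp 1)) _ _ _ _ _ _ x2 erefl) => //.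
    by rewrite -catA.
  rewrite [ireg s2 (tmp 1)]ireg_set addn0 (_ : ireg s2 (tmp 0) = ieval n h e) //.
  exact: represents_set_iv (represents_sem r x2).
- move=> v e h sa s r; have [s1 x1 v1] := comp_r_ok 0 r sa.
  set s2 := set_rreg s1 (tmp 1) 0%:~R.
  have x2 : sem (comp_r 0 e ++ [:: RConst (tmp 1) 0]) 0 s s2.
    by apply: sem_cat x1 (leqnn 0) _; apply: sem_instr => //; apply: stacked_rreg.
  apply: (@simulated_last _ _ _ (RAdd v.*2 (tmp 0) (tmp 1)) _ _ _ _ _ _ x2 erefl) => //.
    by rewrite -catA.
  rewrite [rreg s2 (tmp 1)]rreg_set addr0 (_ : rreg s2 (tmp 0) = reval n cx cy h e) //.
  exact: represents_set_rv (represents_sem r x2).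
- move=> q a b e h /and5P[hq sa sb se /andP[la lb]] s r.
  have [s1 x1 v1] := comp_i_ok 0 r se; have r1 := represents_sem r x1.
  have [s2 x2 [v2 v2']] := comp2 1 (@comp_i_ok h a) (@comp_i_ok h b) r1 sa sb.
  have r2 := represents_sem r1 x2.
  have la2 : ireg s2 (tmp 1) < n by rewrite v2.
  have [s3 [x3 v3 [eo1 eo2 eo3 eo4]]] := sem_row_address r2 hq la2.
  set s4 := set_ireg s3 (tmp 1) (ireg s3 (tmp 1) + ireg s3 (tmp 2)).
  have v4 : ireg s4 (tmp 1) = addr q (ieval n h a) (ieval n h b).
    by rewrite ireg_set v3 eo1 ?v2 ?v2' /addr ?addn0.
  have x4 : sem (comp_i 0 e ++ (comp_i 1 a ++ comp_i 2 b) ++ row_address (tmp 1) q ++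
      [:: IAdd (tmp 1) (tmp 1) (tmp 2)]) 0 s s4.
    apply: sem_cat x1 (leqnn _) _; apply: sem_cat (sem_weaken (leq0n _) x2) (leqnn _) _.
    apply: sem_cat (sem_weaken (leq0n _) x3) (leqnn _) _.
    by apply: sem_instr => //; apply: stacked_ireg.
  apply: (@simulated_last _ _ _ (IStore (tmp 1) (tmp 0)) _ _ _ _ _ _ x4 erefl) => //.
  + by rewrite -(catA (comp_i 0 e)) -(catA (_ ++ _)) -(catA (row_address _ _)) -(catA (comp_i 1 a)).
  + by rewrite /extent v4 addr_bound.
  rewrite v4.
  have -> : ireg s4 (tmp 0) = ieval n h e.
    rewrite -v1 (_ : ireg s4 _ = ireg s3 (tmp 0)) // eo1 //.
    by case: x2 => [[z _ _ _] _ _]; rewrite z.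
  by apply: represents_set_ia => //; apply: represents_sem r x4.
- move=> q a e h /and4P[hq sa se la] s r.
  have [s1 x1 v1] := comp_r_ok 0 r se; have r1 := represents_sem r x1.
  have [s2 x2 v2] := comp_i_ok 1 r1 sa; have r2 := represents_sem r1 x2.
  rewrite -v2 in la; have [s3 x3 v3] := sem_row0_address r2 hq la.
  have x4 : sem (comp_r 0 e ++ comp_i 1 a ++ row0_address 1 q) 0 s s3.
    apply: sem_cat x1 (leqnn _) _; apply: sem_cat (sem_weaken (leq0n _) x2) (leqnn _) _.
    exact: sem_weaken (leq0n _) x3.
  apply: (@simulated_last _ _ _ (RStore (tmp 1) (tmp 0)) _ _ _ _ _ _ x4 erefl) => //.
  + by rewrite -(catA (comp_r 0 e)) -(catA (comp_i 1 a)).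
  + by rewrite /extent v3 addr_bound //; lia.
  rewrite v3 v2.
  have -> : rreg s3 (tmp 0) = reval n cx cy h e.
    by rewrite -v1; case: x2 x3 => [[_ z _ _] _ _] [[_ z' _ _] _ _]; rewrite z' ?z.
  by apply: represents_set_ra; rewrite -?v2 //; apply: represents_sem r x4.
- move=> a e h /and3P[sa se la] s r.
  have [s2 x2 [v2 v2']] := comp2 0 (@comp_i_ok h e) (@comp_i_ok h a) r se sa.
  apply: (@simulated_last _ _ _ (IStore (tmp 1) (tmp 0)) _ _ _ _ _ _ x2 erefl) => //.
  + by rewrite -(catA (comp_i 0 e)).
  + by rewrite /extent v2'; have := input_bound la; lia.
  by rewrite v2 v2'; apply: represents_set_out => //; apply: represents_sem r x2.
- move=> c1 c2 h1 h2 h3 t1 t2 _ IH1 _ IH2 s r /=.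
  rewrite /simulated /= size_cat => sz /code_at_cat[ca1 ca2].
  have [||s1 [r1 p1 [u1 le1 x1]]] := IH1 s r => //; first by lia.
  move: sz ca2; rewrite -p1 => sz ca2.
  have [||s2 [r2 p2 [u2 le2 x2]]] := IH2 s1 r1 => //; first by lia.
  exists s2; split=> //; first by rewrite p2 p1 addnA.
  by exists (u1 + u2); [lia|exact: reach_trans x2].
- move=> b c1 c2 h1 h2 t sb _ IH s r; rewrite /simulated /=.
  set lb := comp_b _ _ _; set l1 := comp_c _ c1; set l2 := comp_c _ c2.
  rewrite !size_cat /= ?size_cat /= => sz /code_at_cat[cb] /(@code_at_cat _ [:: _; _])[cj].
  move=> /code_at_cat[c1a] /(@code_at_cat _ [:: _])[cje c2a].
  have [s1 [st1 p1 x1] v1] := comp_b_ok 0 r sb.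
  have [u1 le1 y1] := x1 cb.
  rewrite -/lb in p1 le1.
  set s2 := set_ireg s1 (tmp 1) 0.
  have r2 : represents h1 s2.
    by apply: represents_stacked (represents_stacked r st1) _; apply: (@stacked_ireg 0).
  have y2 : reach 1 s1 s2.
    apply: (@reach1 (IConst (tmp 1) 0)) => //.
    by rewrite p1; exact: code_at0 cj.
  set s3 := goto s2 (if ireg s2 (tmp 0) <= ireg s2 (tmp 1)
                     then pc s + size lb + size l1 + 3 else (pc s2).+1).
  have y3 : reach 1 s2 s3.
    apply: (@reach1 (JmpILe (tmp 0) (tmp 1) (pc s + size lb + size l1 + 3))) => //.
    by rewrite /= p1; exact: code_at0 (code_atS cj).
  have y := reach_trans y1 (reach_trans y2 y3).
  have r3 : represents h1 s3 by apply: represents_goto.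
  move: IH; have w0 : ireg s2 (tmp 0) = nat_of_bool (beval n cx cy h1 b) by [].
  have w1 : ireg s2 (tmp 1) = 0 by rewrite ireg_set.
  case bv: (beval n cx cy h1 b) => /= IH.
    have p3 : pc s3 = pc s + size lb + 2.
      by rewrite /s3 w0 w1 bv /= p1; lia.
    have [||s4 [r4 p4 [u4 le4 y4]]] := IH s3 r3.
    + by rewrite p3 -/l1; lia.
    + by rewrite p3.
    rewrite p3 -/l1 in p4 le4.
    set s5 := goto s4 (pc s + size lb + size l1 + size l2 + 3).
    have y5 : reach 1 s4 s5.
      apply: (@reach1 (Jmp (pc s + size lb + size l1 + size l2 + 3))) => //.
      by rewrite p4; exact: code_at0 cje.
    exists s5; split; [exact: represents_goto|by rewrite /=; lia|].
    exists (u1 + (1 + 1) + (u4 + 1)); first by lia.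
    by apply: reach_trans y _; apply: reach_trans y4 y5.
  have p3 : pc s3 = pc s + size lb + size l1 + 3.
    by rewrite /s3 w0 w1 bv.
  have e3 : pc s + size lb + 2 + size l1 + 1 = pc s3 by rewrite p3; lia.
  have [||s4 [r4 p4 [u4 le4 y4]]] := IH s3 r3.
  + by rewrite p3 -/l2; lia.
  + by move: c2a; rewrite e3 p3.
  rewrite p3 -/l2 in p4 le4.
  exists s4; split=> //; first by rewrite p4; lia.
  exists (u1 + (1 + 1) + u4); first by lia.
  by apply: reach_trans y y4.
- move=> b c h sb nb s r; rewrite /simulated /=.
  set lb := comp_b _ _ _; set l := comp_c _ c.
  rewrite !size_cat /= ?size_cat /= => sz /code_at_cat[cb] /(@code_at_cat _ [:: _; _])[cj _].
  have [s1 [st1 p1 x1] v1] := comp_b_ok 0 r sb.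
  have [u1 le1 y1] := x1 cb.
  rewrite -/lb in p1 le1.
  set s2 := set_ireg s1 (tmp 1) 0.
  have r2 : represents h s2.
    by apply: represents_stacked (represents_stacked r st1) _; apply: (@stacked_ireg 0).
  have y2 : reach 1 s1 s2.
    apply: (@reach1 (IConst (tmp 1) 0)) => //.
    by rewrite p1; exact: code_at0 cj.
  set s3 := goto s2 (if ireg s2 (tmp 0) <= ireg s2 (tmp 1)
                     then pc s + size lb + size l + 3 else (pc s2).+1).
  have y3 : reach 1 s2 s3.
    apply: (@reach1 (JmpILe (tmp 0) (tmp 1) (pc s + size lb + size l + 3))) => //.
    by rewrite /= p1; exact: code_at0 (code_atS cj).
  have w0 : ireg s2 (tmp 0) = nat_of_bool (beval n cx cy h b) by [].
  have w1 : ireg s2 (tmp 1) = 0 by rewrite ireg_set.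
  exists s3; split; first exact: represents_goto.
    by rewrite /s3 w0 w1 (negbTE nb) /=; lia.
  exists (u1 + (1 + 1)); first by lia.
  exact: reach_trans y1 (reach_trans y2 y3).
move=> b c h1 h2 h3 t1 t2 sb bv _ IH1 _ IH2 s r; rewrite /simulated /=.
set lb := comp_b _ _ _; set l := comp_c _ c.
rewrite !size_cat /= ?size_cat /= => sz ca; have := ca.
move=> /code_at_cat[cb] /(@code_at_cat _ [:: _; _])[cj].
move=> /code_at_cat[cc cje].
have [s1 [st1 p1 x1] v1] := comp_b_ok 0 r sb.
have [u1 le1 y1] := x1 cb.
rewrite -/lb in p1 le1.
set s2 := set_ireg s1 (tmp 1) 0.
have r2 : represents h1 s2.
  by apply: represents_stacked (represents_stacked r st1) _; apply: (@stacked_ireg 0).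
have y2 : reach 1 s1 s2.
  apply: (@reach1 (IConst (tmp 1) 0)) => //.
  by rewrite p1; exact: code_at0 cj.
set s3 := goto s2 (if ireg s2 (tmp 0) <= ireg s2 (tmp 1)
                   then pc s + size lb + size l + 3 else (pc s2).+1).
have y3 : reach 1 s2 s3.
  apply: (@reach1 (JmpILe (tmp 0) (tmp 1) (pc s + size lb + size l + 3))) => //.
  by rewrite /= p1; exact: code_at0 (code_atS cj).
have w0 : ireg s2 (tmp 0) = nat_of_bool (beval n cx cy h1 b) by [].
have w1 : ireg s2 (tmp 1) = 0 by rewrite ireg_set.
have p3 : pc s3 = pc s + size lb + 2.
  by rewrite /s3 w0 w1 bv /= p1; lia.
have r3 : represents h1 s3 by apply: represents_goto.
have [||s4 [r4 p4 [u4 le4 y4]]] := IH1 s3 r3.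
+ by rewrite p3 -/l; lia.
+ by rewrite p3.
rewrite p3 -/l in p4 le4.
set s5 := goto s4 (pc s).
have y5 : reach 1 s4 s5.
  apply: (@reach1 (Jmp (pc s))) => //.
  by rewrite p4; exact: code_at0 cje.
have [||s6 [r6 p6 [u6 le6 y6]]] := IH2 s5 (represents_goto (pc s) r4).
+ by rewrite /= !size_cat /= ?size_cat /= -/lb -/l.
+ exact: ca.
move: p6 le6; rewrite /= !size_cat /= ?size_cat /= -/lb -/l => p6 le6.
exists s6; split=> //.
exists (u1 + (1 + 1) + (u4 + (1 + u6))); first by nia.
apply: reach_trans (reach_trans y1 (reach_trans y2 y3)) _.
by apply: reach_trans y4 (reach_trans y5 y6).
Qed.

End Compiler.

(** * The table of row addresses and the compiled program *)

Definition row_table_init : seq instr :=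
  [:: IConst (tmp 3) 1; IConst (tmp 0) 0] ++ nseq 1 (IAdd (tmp 0) (tmp 0) 0) ++
  [:: IConst (tmp 1) 0] ++ nseq narr.+2 (IAdd (tmp 1) (tmp 1) 0) ++
  [:: IConst (tmp 2) 0] ++ nseq narr.+1 (IAdd (tmp 2) (tmp 2) 0).

(** The row addresses form an arithmetic progression of step [n], so additions suffice. Register
    [tmp 0] points into the table, [tmp 1] is the current row address, [tmp 2] the end of the table
    and [tmp 3] the constant 1. *)
Definition row_table : seq instr :=
  let l := size row_table_init in
  row_table_init ++
  [:: JmpILe (tmp 2) (tmp 0) (l + 5); IStore (tmp 0) (tmp 1);
      IAdd (tmp 1) (tmp 1) 0; IAdd (tmp 0) (tmp 0) (tmp 3); Jmp l].

Definition compile c : program :=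
  row_table ++ comp_c (size row_table) c ++ [:: Halt].

Section Compile.
Variable R : realType.
Variables (n : nat) (c : 'I_n -> R * R) (main : cmd).
Local Open Scope nat_scope.

Definition coord_x (a : nat) : R := oapp (fun i => (c i).1) 0%R (insub a).
Definition coord_y (a : nat) : R := oapp (fun i => (c i).2) 0%R (insub a).

Definition hst0 : hst R :=
  Hst (fun=> 0) (fun=> 0%R) (fun _ _ _ => 0) (fun _ _ => 0%R) (fun=> 0).

Local Notation P := (compile main).
Local Notation reach := (reach n P).

Lemma row_table_loop m s : n + m <= narr.+1 * n ->
  ireg s 0 = n -> ireg s (tmp 0) = n + m -> ireg s (tmp 1) = narr.+2 * n + m * n ->
  ireg s (tmp 2) = narr.+1 * n -> ireg s (tmp 3) = 1 -> pc s = size row_table_init ->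
  exists s' : state R, [/\ (exists2 t, t <= 5 * (narr.+1 * n - (n + m)) + 1 & reach t s s'),
    pc s' = size row_table,
    forall r, ~~ odd r -> ireg s' r = ireg s r, rreg s' = rreg s /\ rmem s' = rmem s
    & forall a, imem s' a =
      if n + m <= a < narr.+1 * n then narr.+2 * n + (a - n) * n else imem s a].
Proof.
have c0 : code_at P 0 P by [].
have /code_at_cat[ca _] : code_at P 0 (row_table ++ (comp_c (size row_table) main ++ [:: Halt])) := c0.
have /code_at_cat[_] := ca; rewrite add0n => cj.
have szE : size row_table = size row_table_init + 5 by rewrite /row_table size_cat.
move: szE cj; set L := size row_table_init; set szT := size row_table => szE cj.
move e: (narr.+1 * n - (n + m)) => k.
elim: k m s e => [|k IH] m s e le sn s0 s1 s2 s3 ps.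
  have [s' s'E] : exists s', s' = goto s (L + 5) by eexists.
  exists s'; split; rewrite ?s'E //.
    exists 1 => //; apply: (@reach1 _ _ _ (JmpILe (tmp 2) (tmp 0) (L + 5))) => //.
      by rewrite ps; exact: code_at0 cj.
    by rewrite /= s2 s0; have -> : narr.+1 * n <= n + m by lia.
  by move=> a; rewrite ifN //; lia.
set x1 := goto s (pc s).+1.
have r1 : reach 1 s x1.
  apply: (@reach1 _ _ _ (JmpILe (tmp 2) (tmp 0) (L + 5))) => //.
    by rewrite ps; exact: code_at0 cj.
  by rewrite /= s2 s0; have -> : narr.+1 * n <= n + m = false by lia.
set x2 := set_imem x1 (ireg x1 (tmp 0)) (ireg x1 (tmp 1)).
have r2 : reach 1 x1 x2.
  apply: (@reach1 _ _ _ (IStore (tmp 0) (tmp 1))) => //.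
    by rewrite /= ps; exact: code_at0 (code_atS cj).
  by rewrite /= s0 /mem_bound; move: e; rewrite !mulSn; lia.
set x3 := set_ireg x2 (tmp 1) (ireg x2 (tmp 1) + ireg x2 0).
have r3 : reach 1 x2 x3.
  apply: (@reach1 _ _ _ (IAdd (tmp 1) (tmp 1) 0)) => //.
  by rewrite /= ps; exact: code_at0 (code_atS (code_atS cj)).
set x4 := set_ireg x3 (tmp 0) (ireg x3 (tmp 0) + ireg x3 (tmp 3)).
have r4 : reach 1 x3 x4.
  apply: (@reach1 _ _ _ (IAdd (tmp 0) (tmp 0) (tmp 3))) => //.
  by rewrite /= ps; exact: code_at0 (code_atS (code_atS (code_atS cj))).
set x5 := goto x4 L.
have r5 : reach 1 x4 x5.
  apply: (@reach1 _ _ _ (Jmp L)) => //.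
  by rewrite /= ps; exact: code_at0 (code_atS (code_atS (code_atS (code_atS cj)))).
have [||||||||s' [[t le_t rt] p' i' [rr' rm'] im']] := IH m.+1 x5 => //.
- by lia.
- by lia.
- by rewrite /= /upd /= s0 s3; lia.
- by rewrite /= /upd /= s1 sn; lia.
exists s'; split=> //.
- exists (1 + (1 + (1 + (1 + (1 + t))))); first by lia.
  do 4 (apply: reach_trans; first by eassumption).
  exact: reach_trans r5 rt.
- by move=> r ro; rewrite i' //= /upd; do 2 (case: eqP => [rE|_]; first by move: ro; rewrite rE).
move=> a; rewrite im' /= /upd s0 s1.
case: (ltngtP a (n + m)) => am.
- by rewrite !ifN //; lia.
- by rewrite -addnS in am *; have -> : n + m.+1 <= a = true by lia.
have -> : a < narr.+1 * n by lia.
by rewrite am addnS ltnn /=; congr (_ + _ * _); lia.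
Qed.

Lemma row_table_ok : exists2 s : state R, represents n coord_x coord_y hst0 s &
  pc s = size row_table /\
  exists2 t, t <= size row_table + 5 * narr * n & reach t (input c) s.
Proof.
have c0 : code_at P 0 P by [].
have /code_at_cat[/code_at_cat[ca _] _] :
  code_at P 0 (row_table ++ (comp_c (size row_table) main ++ [:: Halt])) := c0.
set s0 := input c.
have x1 : sem n P [:: IConst (tmp 3) 1; IConst (tmp 0) 0] 0 s0
    (set_ireg (set_ireg s0 (tmp 3) 1) (tmp 0) 0).
  apply: (@sem_cat _ _ _ [:: _] [:: _] 0 0 _ (set_ireg s0 (tmp 3) 1)) => //;
    by apply: sem_instr => //; apply: stacked_ireg.
set s1 := set_ireg _ (tmp 0) 0 in x1.
have n1 : ireg s1 0 = n by [].
have [s2 [x2 v2 [eo2 p2 q2 m2]]] := @sem_adds R n P 1 0 s1 n1.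
set s3 := set_ireg s2 (tmp 1) 0.
have x3 : sem n P [:: IConst (tmp 1) 0] 0 s2 s3.
  by apply: sem_instr => //; apply: stacked_ireg.
have n3 : ireg s3 0 = n by rewrite /= /upd /= eo2.
have [s4 [x4 v4 [eo4 p4 q4 m4]]] := @sem_adds R n P narr.+2 1 s3 n3.
set s5 := set_ireg s4 (tmp 2) 0.
have x5 : sem n P [:: IConst (tmp 2) 0] 0 s4 s5.
  by apply: sem_instr => //; apply: stacked_ireg.
have n5 : ireg s5 0 = n by rewrite /= /upd /= eo4.
have [s6 [x6 v6 [eo6 p6 q6 m6]]] := @sem_adds R n P narr.+1 2 s5 n5.
have [st ps rs] : sem n P row_table_init 0 s0 s6.
  apply: sem_cat x1 (leqnn 0) _; apply: sem_cat x2 (leqnn 0) _.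
  apply: sem_cat x3 (leqnn 0) _; apply: sem_cat (sem_weaken (leq0n 1) x4) (leqnn 0) _.
  by apply: sem_cat x5 (leqnn 0) _; apply: sem_weaken (leq0n 2) x6.
have [u le_u ru] := rs ca.
have [] := @row_table_loop 0 s6.
- by rewrite !mulSn; lia.
- by rewrite eo6.
- rewrite eo6 // /s5 /= /upd /= eo4 // /s3 /= /upd /= v2 /s1 /= /upd /=; lia.
- rewrite eo6 // /s5 /= /upd /= v4 ireg_set; lia.
- by rewrite v6 ireg_set.
- by rewrite eo6 // /s5 /= /upd /= eo4 // /s3 /= /upd /= eo2.
- exact: ps.
move=> s7 [[t le_t rt] p7 i7 [r7 m7] im7].
case: st => [i6 r6 im6 rm6].
exists s7; last first.
  split=> //; exists (u + t); last exact: reach_trans ru rt.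
  rewrite /row_table size_cat; apply: leq_trans (leq_add le_u le_t) _.
  rewrite -addnA leq_add2l addn0 (mulSn narr n) addKn mulnA.
  by rewrite addnC leq_add2r.
split=> /=.
- by rewrite i7 ?i6.
- by move=> v; rewrite i7 ?i6 //= ?odd_double.
- by move=> v; rewrite r7 r6 //= ?odd_double.
- move=> q i hq hi; rewrite im7 /addr !addn0 addKn ifT //.
  have : q.+1 * n <= narr * n by rewrite leq_mul2r hq orbT.
  by rewrite (mulSn q) (mulSn narr); lia.
- move=> q i j hq hi hj; rewrite im7 ifN ?im6 //.
  by have := addr_ge n q i j; rewrite (mulSn narr.+1); lia.
- move=> q j hq hj; rewrite m7 rm6 /= insubN // -leqNgt.
  by have := addr_ge n q 0 j; rewrite !(mulSn narr.+1) (mulSn narr); lia.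
- by move=> i hi; rewrite im7 ifN ?im6 //; lia.
- by move=> i hi; rewrite m7 rm6 /= doubleK odd_double /coord_x; case: insub.
- by move=> i hi; rewrite m7 rm6 /= uphalf_double odd_double /coord_y; case: insub.
Qed.

Lemma compile_ok h' t : ev n coord_x coord_y main hst0 h' t ->
  exists t' s, [/\ halts_in P (input c) t' s,
    t' <= size P + 5 * narr * n + size P * t,
    space_used P (input c) t' <= 2 * mem_bound n &
    forall i, i < n -> imem s i = out h' i].
Proof.
move=> E; have [s1 r1 [p1 [t1 le1 x1]]] := row_table_ok.
have ca0 : code_at P 0 P by [].
have := ca0; rewrite {2}/compile => /code_at_cat[_]; rewrite add0n => /code_at_cat[cm ch].
have [||s2 [r2 p2 [t2 le2 x2]]] := simulate_c (P := P) (K := size P) E r1.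
- by rewrite p1 /compile !size_cat; lia.
- by rewrite p1.
rewrite p1 in p2 le2.
have [rx bx] := reach_trans x1 x2.
exists (t1 + t2), s2; split.
- split=> //; rewrite /fetch p2 -[X in onth _ X]addn0; exact: ch.
- have : size row_table + size (comp_c (size row_table) main) <= size P.
    by rewrite /compile !size_cat; lia.
  by move: le1 le2; set a := size row_table; set b := size (comp_c _ _); lia.
- rewrite /space_used mul2n -addnn leq_add //.
    by apply/bigmax_leqP => k _; have [u -> /andP[]] := bx k (ltn_ord k).
  by apply/bigmax_leqP => k _; have [u -> /andP[]] := bx k (ltn_ord k).
- by move=> i hi; rewrite (represents_out r2).
Qed.

End Compile.

(** * Program logic with time credits *)

#[local] Arguments upd {T} f a v b /.
#[local] Arguments upd2 {T} f i j x i' j' /.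

Local Notation "a ;;; b" := (CSeq a b) (at level 60, right associativity).

Definition CFor v body : cmd :=
  CI v (EC 0) ;;; CWhile (BNot (BLe EN (EV v))) (body ;;; CI v (EAdd (EV v) (EC 1))).

Section Hoare.
Variable R : realType.
Variables (n : nat) (cx cy : nat -> R).
Local Notation hst := (hst R).
Local Open Scope nat_scope.
Implicit Types (s : hst) (t : nat) (Q : hst -> nat -> Prop) (vs qs rs : seq nat).

(* [c], run from [s] with [t] credits, each loop iteration costing one credit,
   ends in a state and with a number of remaining credits satisfying [Q]. *)
Definition ok c Q s t : Prop :=
  exists s' t', [/\ ev n cx cy c s s' t', t' <= t & Q s' (t - t')].

Lemma ok_skip Q s t : Q s t -> ok CSkip Q s t.
Proof. by move=> q; exists s, 0; rewrite subn0; split=> //; constructor. Qed.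

Lemma ok_i v e x Q s t : isafe n s e -> ieval n s e = x -> Q (set_iv s v x) t ->
  ok (CI v e) Q s t.
Proof.
move=> h <- q; exists (set_iv s v (ieval n s e)), 0.
by rewrite subn0; split=> //; constructor.
Qed.

Lemma ok_r v e x Q s t : rsafe n s e -> reval n cx cy s e = x -> Q (set_rv s v x) t ->
  ok (CR v e) Q s t.
Proof.
move=> h <- q; exists (set_rv s v (reval n cx cy s e)), 0.
by rewrite subn0; split=> //; constructor.
Qed.

Lemma ok_set q a b e i j x Q s t :
  [&& q < narr, isafe n s a, isafe n s b & isafe n s e] ->
  ieval n s a = i -> ieval n s b = j -> ieval n s e = x -> (i < n) && (j < n) ->
  Q (set_ia s q i j x) t -> ok (CSet q a b e) Q s t.
Proof.
move=> /and4P[h1 h2 h3 h4] <- <- <- /andP[h5 h6] qs.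
exists (set_ia s q (ieval n s a) (ieval n s b) (ieval n s e)), 0.
by rewrite subn0; split=> //; constructor; apply/and5P; split=> //; apply/andP.
Qed.

Lemma ok_rset q a e i x Q s t :
  [&& q < narr, isafe n s a & rsafe n s e] ->
  ieval n s a = i -> reval n cx cy s e = x -> i < n ->
  Q (set_ra s q i x) t -> ok (CRSet q a e) Q s t.
Proof.
move=> /and3P[h1 h2 h3] <- <- h5 qs.
exists (set_ra s q (ieval n s a) (reval n cx cy s e)), 0.
by rewrite subn0; split=> //; constructor; apply/and4P; split.
Qed.

Lemma ok_out a e i x Q s t : isafe n s a && isafe n s e ->
  ieval n s a = i -> ieval n s e = x -> i < n ->
  Q (set_out s i x) t -> ok (COut a e) Q s t.
Proof.
move=> /andP[h1 h2] <- <- h3 qs; exists (set_out s (ieval n s a) (ieval n s e)), 0.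
by rewrite subn0; split=> //; constructor; apply/and3P; split.
Qed.

Lemma ok_seq c1 c2 Q s t : ok c1 (ok c2 Q) s t -> ok (c1 ;;; c2) Q s t.
Proof.
move=> [s1 [t1 [e1 le1 [s2 [t2 [e2 le2 q]]]]]]; exists s2, (t1 + t2); split.
- exact: ev_seq e1 e2.
- lia.
- by rewrite subnDA.
Qed.

Lemma ok_if b c1 c2 Q s t : bsafe n cx cy s b ->
  ok (if beval n cx cy s b then c1 else c2) Q s t -> ok (CIf b c1 c2) Q s t.
Proof.
by move=> sb [s1 [t1 [e1 le1 q]]]; exists s1, t1; split=> //; apply: ev_if.
Qed.

Lemma ok_while (I : hst -> nat -> Prop) b c Q s t :
  I s t ->
  (forall s t, I s t -> bsafe n cx cy s b) ->
  (forall s t, I s t -> beval n cx cy s b -> exists2 t', t = t'.+1 & ok c I s t') ->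
  (forall s t, I s t -> ~~ beval n cx cy s b -> Q s t) ->
  ok (CWhile b c) Q s t.
Proof.
move=> i sb st dn; elim/ltn_ind: t s i => t IH s i; have sbs := sb _ _ i.
case bv: (beval n cx cy s b); last first.
  exists s, 0; rewrite subn0; split=> //; first by apply: ev_done; rewrite ?bv.
  by apply: dn => //; rewrite bv.
have [t1 tE [s1 [u1 [e1 le1 i1]]]] := st _ _ i bv.
have [|s2 [u2 [e2 le2 q2]]] := IH (t1 - u1) _ _ i1; first by lia.
exists s2, (u1 + u2).+1; split; [exact: ev_loop e1 e2|lia|].
by rewrite tE subSS subnDA.
Qed.

Lemma ok_conseq c Q Q' s t : ok c Q s t -> (forall s' t', Q s' t' -> Q' s' t') ->
  ok c Q' s t.
Proof. by move=> [s1 [t1 [e le q]]] h; exists s1, t1; split=> //; apply: h. Qed.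

Lemma ok_frame c Q s t u : ok c Q s t ->
  ok c (fun s' t' => exists2 t1, t' = t1 + u & Q s' t1) s (t + u).
Proof.
move=> [s1 [t1 [e le q]]]; exists s1, t1; split=> //; first by lia.
by exists (t - t1) => //; lia.
Qed.

Lemma ok_seq_post c1 c2 (P Q : hst -> Prop) s t1 t2 :
  ok c1 (fun s' _ => P s') s t1 -> (forall s', P s' -> ok c2 (fun s' _ => Q s') s' t2) ->
  ok (c1 ;;; c2) (fun s' _ => Q s') s (t1 + t2).
Proof.
move=> h1 h2; apply: ok_seq; apply: ok_conseq (ok_frame t2 h1) _.
move=> s' t' [u -> /h2 h]; rewrite addnC; apply: ok_conseq (ok_frame u h) _.
by move=> ? ? [].
Qed.

(** For amortised bounds: each iteration is granted [K] credits beside the one for the loop, and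
    what the body leaves over is handed by [J] to later iterations as a potential. *)
Lemma ok_for (J : nat -> hst -> nat -> Prop) K v body Q s t :
  J 0 (set_iv s v 0) t ->
  (forall i s t, i < n -> iv s v = i -> J i s t ->
    ok body (fun s' t' => iv s' v = i /\ J i.+1 (set_iv s' v i.+1) t') s (t + K)) ->
  (forall s' t', J n s' t' -> Q s' t') ->
  ok (CFor v body) Q s (t + n * K.+1).
Proof.
move=> j0 step dn; apply: ok_seq; apply: ok_i; [by []|by []|].
apply: (@ok_while (fun s' t' => exists2 i, i <= n /\ iv s' v = i &
  exists2 u, t' = u + (n - i) * K.+1 & J i s' u)).
- by exists 0; [rewrite /= eqxx|exists t; rewrite ?subn0].
- by [].
- move=> s1 t1 [i [le vi] [u tE j]] /=; rewrite vi -ltnNge => lt.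
  exists (u + K + (n - i.+1) * K.+1).
    by rewrite tE subnS -{1}(@prednK (n - i)) ?subn_gt0 // mulSn; lia.
  have h := @step i s1 u lt vi j; apply: ok_seq.
  apply: ok_conseq (ok_frame _ h) _ => s2 t2 [w -> [v2 j2]].
  apply: ok_i; [by []|by rewrite /= v2 addn1; reflexivity|].
  by exists i.+1; [rewrite /= eqxx|exists w].
- move=> s1 t1 [i [le vi] [u tE j]] /=; rewrite vi -ltnNge -leqNgt => ge.
  have ni : i = n by lia.
  by rewrite tE ni subnn addn0; apply: dn; rewrite -ni.
Qed.

Lemma ok_for0 (J : nat -> hst -> Prop) K v body s (Q : hst -> Prop) :
  J 0 (set_iv s v 0) ->
  (forall i s, i < n -> iv s v = i -> J i s ->
    ok body (fun s' _ => iv s' v = i /\ J i.+1 (set_iv s' v i.+1)) s K) ->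
  (forall s', J n s' -> Q s') ->
  ok (CFor v body) (fun s' _ => Q s') s (n * K.+1).
Proof.
move=> j0 step dn; rewrite -[n * _]add0n.
apply: (@ok_for (fun i s _ => J i s) K) => [//|i s1 t lt vi j|s' _]; last exact: dn.
by rewrite addnC; apply: ok_conseq (ok_frame t (step i s1 lt vi j)) _ => ? ? [].
Qed.

Definition same (vs qs rs : seq nat) (s0 s : hst) : Prop :=
  [/\ forall v, v \notin vs -> iv s v = iv s0 v,
      forall q, q \notin qs -> ia s q = ia s0 q,
      forall q, q \notin rs -> ra s q = ra s0 q & out s = out s0].

Lemma same_refl vs qs rs s : same vs qs rs s s.
Proof. by split. Qed.

Lemma same_trans vs qs rs s1 s2 s3 :
  same vs qs rs s1 s2 -> same vs qs rs s2 s3 -> same vs qs rs s1 s3.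
Proof.
by move=> [a b c d] [a' b' c' d']; split=> [v h|q h|q h|];
  rewrite ?a' ?b' ?c' ?d' // ?a ?b ?c ?d.
Qed.

Lemma same_sub vs qs rs vs' qs' rs' s1 s2 :
  {subset vs <= vs'} -> {subset qs <= qs'} -> {subset rs <= rs'} ->
  same vs qs rs s1 s2 -> same vs' qs' rs' s1 s2.
Proof.
move=> h1 h2 h3 [a b c d]; split=> // [v h|q h|q h].
- by apply: a; apply: contra h => /h1.
- by apply: b; apply: contra h => /h2.
- by apply: c; apply: contra h => /h3.
Qed.

Lemma same_widen vs qs rs vs' qs' rs' s1 s2 :
  [&& all (mem vs') vs, all (mem qs') qs & all (mem rs') rs] ->
  same vs qs rs s1 s2 -> same vs' qs' rs' s1 s2.
Proof. by move=> /and3P[/allP h1 /allP h2 /allP h3]; apply: same_sub. Qed.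

Lemma same_iv vs qs rs s0 s v x : v \in vs -> same vs qs rs s0 s ->
  same vs qs rs s0 (set_iv s v x).
Proof.
move=> vv [a b c d]; split=> //= w ww; case: eqP => [wv|_]; last exact: a.
by rewrite wv vv in ww.
Qed.

Lemma same_rv vs qs rs s0 s v x : same vs qs rs s0 s ->
  same vs qs rs s0 (set_rv s v x).
Proof. by move=> [a b c d]; split. Qed.

Lemma same_ia vs qs rs s0 s q i j x : q \in qs -> same vs qs rs s0 s ->
  same vs qs rs s0 (set_ia s q i j x).
Proof.
move=> vv [a b c d]; split=> //= w ww; rewrite /upd; case: eqP => [wv|_]; last exact: b.
by rewrite wv vv in ww.
Qed.

Lemma same_ra vs qs rs s0 s q i x : q \in rs -> same vs qs rs s0 s ->
  same vs qs rs s0 (set_ra s q i x).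
Proof.
move=> vv [a b c d]; split=> //= w ww; rewrite /upd; case: eqP => [wv|_]; last exact: c.
by rewrite wv vv in ww.
Qed.

End Hoare.

(** * Insertion sort with a log of its swaps *)

Local Notation aQ := 0%N (only parsing).
Local Notation aC := 1%N (only parsing).
Local Notation vi := 0%N (only parsing).
Local Notation vk := 1%N (only parsing).
Local Notation va := 2%N (only parsing).
Local Notation vb := 3%N (only parsing).
Local Notation vr := 4%N (only parsing).
Local Notation aget q e := (EGet q (EC 0) e) (only parsing).
Local Notation aset q a e := (CSet q (EC 0) a e) (only parsing).

Definition isort (lt : iexp -> iexp -> bexp) : cmd :=
  CFor vi
   (CI vk (EV vi) ;;;
    CWhile (BAnd (BNot (BLe (EV vk) (EC 0)))
                 (lt (aget aQ (EV vk)) (aget aQ (ESub (EV vk) (EC 1)))))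
     (CI va (aget aQ (ESub (EV vk) (EC 1))) ;;;
      CI vb (aget aQ (EV vk)) ;;;
      aset aQ (ESub (EV vk) (EC 1)) (EV vb) ;;;
      aset aQ (EV vk) (EV va) ;;;
      CSet aC (EV va) (EV vb) (EV vr) ;;;
      CI vk (ESub (EV vk) (EC 1)))).

Section Sort.
Variable R : realType.
Variables (n : nat) (cx cy : nat -> R).
Local Notation hst := (hst R).
Local Open Scope nat_scope.

Section SwapInvariant.
Variables (r : nat) (K : nat -> R) (C0 : nat -> nat -> nat).

(* [Q] enumerates the indices below [n].  Initially it is decreasing, and the
   swap of [a > b] is logged in [C a b], which is [n] as long as [a] precedes
   [b]: every pair is swapped at most once. *)
Definition swap_inv (Q : nat -> nat) (C : nat -> nat -> nat) : Prop :=
  [/\ forall p, p < n -> Q p < n,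
      forall p p', p < n -> p' < n -> Q p = Q p' -> p = p',
      forall p p', p < p' -> p' < n -> Q p' < Q p -> C (Q p) (Q p') = n,
      forall p p', p < p' -> p' < n -> Q p < Q p' ->
        C (Q p') (Q p) <= r /\ (K (Q p) < K (Q p'))%R &
      forall a b, C a b = C0 a b \/ C0 a b = n /\ C a b = r].

(** The potential of the sort: a swap overwrites one entry [n] of the log by a smaller number, so
    this sum bounds the swaps still to come, over all later passes together. *)
Definition unswapped (C : nat -> nat -> nat) : nat :=
  \sum_(a < n) \sum_(b < n) (C a b == n).

Lemma unswapped_upd2 C a b : a < n -> b < n -> C a b = n -> r < n ->
  unswapped C = (unswapped (upd2 C a b r)).+1.
Proof.
move=> an bn cn rn; rewrite /unswapped.
rewrite (bigD1 (Ordinal an)) //= [in RHS](bigD1 (Ordinal an)) //=.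
rewrite (bigD1 (Ordinal bn)) //= [in X in _ = X.+1](bigD1 (Ordinal bn)) //=.
rewrite cn !eqxx /= (ltn_eqF rn) !add0n !add1n !addSn.
congr (_ + _).+1; apply: eq_bigr => i ne.
  by rewrite ifN //; apply: contra ne => /eqP e; apply/eqP/val_inj.
apply: eq_bigr => j _; rewrite ifN // negb_and; apply/orP; left.
by apply: contra ne => /eqP e; apply/eqP/val_inj.
Qed.

(** A pair that was swapped has its keys in strict order. Adjacent keys in the wrong order thus
    belong to a pair still in its initial order, with log entry [n]: no pair is swapped twice. *)
Lemma swap_inv_swap Q Q' C k : r < n -> 0 < k -> k < n -> swap_inv Q C ->
  (K (Q k) < K (Q k.-1))%R ->
  (forall p, Q' p = if p == k then Q k.-1 else if p == k.-1 then Q k else Q p) ->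
  swap_inv Q' (upd2 C (Q k.-1) (Q k) r) /\ C (Q k.-1) (Q k) = n.
Proof.
move=> rn k0 kn [ran inj before after log] lt QE.
have k1n : k.-1 < n by lia.
have kk : k.-1 < k by lia.
have ba : Q k < Q k.-1.
  case: (ltngtP (Q k) (Q k.-1)) => //.
    by move=> /(after _ _ kk kn)[_ lt']; move: (lt_trans lt lt'); rewrite ltxx.
  by move/(inj _ _ kn k1n); lia.
have Cn : C (Q k.-1) (Q k) = n := before _ _ kk kn ba.
(* The transposition of two adjacent positions preserves the order of every other pair of positions,
   so the old invariant transfers to all pairs but the swapped one. *)
pose sg p := if p == k then k.-1 else if p == k.-1 then k else p.
have QsE p : Q' p = Q (sg p) by rewrite QE /sg; case: eqP => // _; case: eqP.
have sgn p : p < n -> sg p < n by rewrite /sg; do ?[case: eqP => ?]; lia.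
have sgm p p' : p < p' -> (p == k.-1) && (p' == k) || (sg p < sg p').
  by rewrite /sg; do ?[case: eqP => ?]; lia.
split=> //; split.
- by move=> p pn; rewrite QsE; apply/ran/sgn.
- move=> p p' pn pn'; rewrite !QsE => /(inj _ _ (sgn _ pn) (sgn _ pn')).
  by rewrite /sg; do ?[case: eqP => ?]; lia.
- move=> p p' pp pn'; have pn : p < n by lia.
  case/orP: (sgm _ _ pp) => [/andP[/eqP pE /eqP pE']|lt'].
    by rewrite !QE pE pE' eqxx ifN ?eqxx; [lia|lia].
  rewrite !QsE => ltQ; rewrite /= ifN; first by apply: before => //; exact: sgn.
  apply/negP => /andP[/eqP/(inj _ _ (sgn _ pn) k1n) e1 /eqP/(inj _ _ (sgn _ pn') kn) e2].
  by move: e1 e2; rewrite /sg; do ?[case: eqP => ?]; lia.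
- move=> p p' pp pn'; have pn : p < n by lia.
  case/orP: (sgm _ _ pp) => [/andP[/eqP pE /eqP pE']|lt'].
    by rewrite !QE pE pE' !eqxx ifN ?eqxx /= ?eqxx //; lia.
  rewrite !QsE => ltQ; rewrite /= ifN; first by apply: after => //; exact: sgn.
  apply/negP => /andP[/eqP/(inj _ _ (sgn _ pn') k1n) e1 /eqP/(inj _ _ (sgn _ pn) kn) e2].
  by move: lt'; rewrite e1 e2; lia.
- move=> a b /=; case: ifP => [/andP[/eqP -> /eqP ->]|_]; last exact: log.
  by right; split=> //; case: (log (Q k.-1) (Q k)) => [<-|[]].
Qed.

End SwapInvariant.

Definition key_cmp (K : nat -> R) (lt : iexp -> iexp -> bexp) (s : hst) : Prop :=
  forall e1 e2, isafe n s e1 -> isafe n s e2 -> ieval n s e1 < n -> ieval n s e2 < n ->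
  bsafe n cx cy s (lt e1 e2) /\
  beval n cx cy s (lt e1 e2) = (K (ieval n s e1) < K (ieval n s e2))%R.

Local Notation same_sort := (same [:: vi; vk; va; vb] [:: aQ; aC] [::]).

Lemma isort_ok lt K C0 s0 t : iv s0 vr < n ->
  swap_inv (iv s0 vr) K C0 (ia s0 aQ 0) (ia s0 aC) -> unswapped (ia s0 aC) <= t ->
  (forall s, same_sort s0 s -> key_cmp K lt s) ->
  ok n cx cy (isort lt) (fun s t' =>
    [/\ same_sort s0 s, swap_inv (iv s0 vr) K C0 (ia s aQ 0) (ia s aC),
        forall p p', p < p' -> p' < n -> (K (ia s aQ 0 p) <= K (ia s aQ 0 p'))%R &
        unswapped (ia s aC) <= t']) s0 (t + n).
Proof.
set r := iv s0 vr => rn inv0 le0 cmpP; have n0 : 0 < n by lia.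
have -> : t + n = t + n * 0.+1 by rewrite muln1.
apply: (@ok_for _ _ _ _ (fun i s t' =>
  [/\ same_sort s0 s, swap_inv r K C0 (ia s aQ 0) (ia s aC),
      forall p p', p < p' -> p' < i -> (K (ia s aQ 0 p) <= K (ia s aQ 0 p'))%R &
      unswapped (ia s aC) <= t'])) => //.
  by split=> //; apply: same_iv => //; apply: same_refl.
move=> i s1 t1 iN vi1 [sm1 inv1 srt1 le1]; rewrite addn0.
apply: ok_seq; apply: ok_i; [by []|by rewrite /= vi1; reflexivity|].
(* Only [p' = vk] is exempted: the element being inserted is already at most everything to its
   right, and is yet to be compared with its left. *)
apply: (@ok_while _ _ _ _ (fun s t' => [/\ same_sort s0 s, iv s vi = i, iv s vk <= i,
  swap_inv r K C0 (ia s aQ 0) (ia s aC) &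
  (forall p p', p < p' -> p' <= i -> p' != iv s vk ->
    (K (ia s aQ 0 p) <= K (ia s aQ 0 p'))%R) /\
  unswapped (ia s aC) <= t'])).
- split=> //=; first exact: same_iv.
  by split=> // p p' pp pi ne; apply: srt1 => //; lia.
- move=> s t' [sm vis ki inv [srt le]] /=.
  have ran := let: And5 z _ _ _ _ := inv in z.
  have kn : iv s vk < n by lia.
  have k1n : iv s vk - 1 < n by lia.
  by have [||||-> _] := cmpP _ sm (aget aQ (EV vk)) (aget aQ (ESub (EV vk) (EC 1)));
    rewrite /= ?n0 ?kn ?k1n ?ran ?implybT.
- move=> s t' [sm vis ki inv [srt le]] /= /andP[k0].
  have ran := let: And5 z _ _ _ _ := inv in z.
  have kn : iv s vk < n by lia.
  have k1n : iv s vk - 1 < n by lia.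
  have [||||_ ->] := cmpP _ sm (aget aQ (EV vk)) (aget aQ (ESub (EV vk) (EC 1)));
    rewrite /= ?n0 ?kn ?k1n ?ran //.
  set k := iv s vk in kn k1n k0 ki srt *; rewrite -ltnNge in k0.
  rewrite subn1 => ltK.
  have [inv' Cn] := swap_inv_swap rn k0 kn inv ltK (fun p => erefl).
  have un := unswapped_upd2 (ran _ k1n) (ran _ kn).
  rewrite -subn1 in Cn un; have := un _ _ Cn rn => uE.
  exists t'.-1; first by rewrite prednK //; apply: leq_trans le; rewrite uE.
  set a := ia s aQ 0 (k - 1); set b := ia s aQ 0 k.
  apply: ok_seq; apply: (@ok_i _ _ _ _ _ _ a) => //; first by rewrite /= n0 k1n.
  apply: ok_seq; apply: (@ok_i _ _ _ _ _ _ b) => //; first by rewrite /= n0 kn.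
  apply: ok_seq; apply: (@ok_set _ _ _ _ _ _ _ _ 0 (k - 1) b) => //=; rewrite ?n0 ?k1n //.
  apply: ok_seq; apply: (@ok_set _ _ _ _ _ _ _ _ 0 k a) => //=; rewrite ?n0 ?kn //.
  apply: ok_seq; apply: (@ok_set _ _ _ _ _ _ _ _ a b r) => //=.
  - by case: sm => [-> //].
  - by rewrite !ran.
  apply: (@ok_i _ _ _ _ _ _ (k - 1)) => //=; split=> //=.
  - by do ?[apply: same_iv => //|apply: same_ia => //].
  - lia.
  - by rewrite /a subn1.
  split; last by rewrite -ltnS prednK -?uE //; apply: leq_trans le; rewrite uE.
  move=> p p' pp pi ne; rewrite (negbTE ne).
  have bk (q : nat) : q < k -> q != k - 1 -> (K (ia s aQ 0 q) <= K a)%R.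
    by move=> qk q1; apply: srt; lia.
  case: (p =P k) => pk; case: (p' =P k) => pk'; first by lia.
  - by rewrite /a; apply: srt; lia.
  - by case: (p =P k - 1) => pk1; [rewrite /a /b subn1 ltW|apply: bk; lia].
  - case: (p =P k - 1) => pk1; last by apply: srt => //; apply/eqP.
    by rewrite /b; apply: srt; lia.
move=> s t' [sm vis ki inv [srt le]] /=.
have ran := let: And5 z _ _ _ _ := inv in z.
have kn : iv s vk < n by lia.
have k1n : iv s vk - 1 < n by lia.
have [||||_ ->] := cmpP _ sm (aget aQ (EV vk)) (aget aQ (ESub (EV vk) (EC 1)));
  rewrite /= ?n0 ?kn ?k1n ?ran //.
rewrite negb_and -leNgt => stop; split=> //; split=> //; first exact: same_iv.
move=> p p' pp pi; case: (p' =P iv s vk) => [pk|/eqP pk]; last exact: srt.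
have ge : (K (ia s aQ 0 (iv s vk - 1)) <= K (ia s aQ 0 (iv s vk)))%R.
  by case/orP: stop => [|//]; lia.
rewrite pk; case: (p =P iv s vk - 1) => [->//|pk1].
by apply: le_trans ge; apply: srt; lia.
Qed.

End Sort.

(** * Sorting and crossings *)

Local Notation rPX := 2%N (only parsing).
Local Notation rPY := 3%N (only parsing).

(** The decreasing start suits the sweep: when indices increase with the heights of the centres,
    [arc_crossing] lets a pair [a > b] pass only from [a] before [b] to [b] before [a]. *)
Definition init_sort : cmd :=
  CFor vi (aset aQ (EV vi) (ESub (ESub EN (EC 1)) (EV vi))) ;;;
  CFor vi (CFor vk (CSet aC (EV vi) (EV vk) EN)).

Definition sort_by (lt : iexp -> iexp -> bexp) : cmd :=
  init_sort ;;; (CI vr (EC 0) ;;; isort lt).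

Definition sort_vars := [:: vi; vk; va; vb; vr].
Local Notation same_sweep := (same sort_vars [:: aQ; aC] [::]).

Section Sweep.
Variable R : realType.
Variables (n : nat) (cx cy : nat -> R).
Local Notation hst := (hst R).
Local Open Scope nat_scope.
Local Notation ok := (ok n cx cy).

Definition fresh_sort (s : hst) : Prop :=
  (forall p, p < n -> ia s aQ 0 p = n - 1 - p) /\
  (forall a b, a < n -> b < n -> ia s aC a b = n).

Lemma init_sort_ok s0 :
  ok init_sort (fun s _ => same_sweep s0 s /\ fresh_sort s) s0 (n * 1 + n * (n * 1).+1).
Proof.
apply: (@ok_seq_post _ _ _ _ _ _ (fun s => same_sweep s0 s /\
   forall p, p < n -> ia s aQ 0 p = n - 1 - p)).
  apply: (@ok_for0 _ _ _ _ (fun i s => same_sweep s0 s /\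
   forall p, p < i -> ia s aQ 0 p = n - 1 - p)) => //.
    by split=> //; apply: same_iv => //; apply: same_refl.
  move=> i s iN vE [sm h]; apply: (@ok_set _ _ _ _ _ _ _ _ 0 i (n - 1 - i)) => //=.
  - by rewrite vE.
  - by rewrite iN andbT; lia.
  split=> //; split; first by apply: same_iv => //; apply: same_ia.
  by move=> p pi /=; case: eqP => [->//|ne]; apply: h; lia.
move=> s1 [sm1 h1].
apply: (@ok_for0 _ _ _ _ (fun i s => [/\ same_sweep s0 s,
   forall p, p < n -> ia s aQ 0 p = n - 1 - p &
   forall a b, a < i -> b < n -> ia s aC a b = n])) => [|i s2 iN vE [sm2 h2 c2]|s []//].
  by split=> //; apply: same_iv.
apply: (@ok_for0 _ _ _ _ (fun j s => [/\ iv s vi = i, same_sweep s0 s,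
   forall p, p < n -> ia s aQ 0 p = n - 1 - p &
   forall a b, a < i -> b < n -> ia s aC a b = n] /\ forall b, b < j -> ia s aC i b = n)).
- by split=> //; split=> //; apply: same_iv.
- move=> j s3 jN vjE [[viE sm3 h3 c3] d3].
  apply: (@ok_set _ _ _ _ _ _ _ _ i j n) => //=; first by rewrite iN jN.
  split=> //; split; first split=> //.
  + by apply: same_iv => //; apply: same_ia.
  + by move=> a b ai bn /=; case: ifP => // _; apply: c3.
  + by move=> b bj /=; case: ifP => // /negbT; rewrite eqxx /= => ne; apply: d3; lia.
- move=> s3 [[viE sm3 h3 c3] d3]; split=> //; split=> //; first exact: same_iv.
  move=> a b; rewrite ltnS leq_eqVlt => /orP[/eqP->|ai] bn; [exact: d3|exact: c3].
Qed.

Lemma fresh_swap_inv r (K : nat -> R) s : fresh_sort s ->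
  swap_inv n r K (ia s aC) (ia s aQ 0) (ia s aC).
Proof.
move=> [q c]; split.
- by move=> p pn; rewrite q; lia.
- by move=> p p' pn pn'; rewrite !q; lia.
- by move=> p p' pp pn ?; rewrite c ?q; lia.
- by move=> p p' pp pn; rewrite !q; lia.
- by left.
Qed.

Lemma unswapped_le (C : nat -> nat -> nat) : unswapped n C <= n * n.
Proof.
rewrite /unswapped; apply: leq_trans (_ : \sum_(a < n) \sum_(b < n) 1 <= _).
  by apply: leq_sum => a _; apply: leq_sum => b _; case: (_ == _).
by rewrite !sum_nat_const !card_ord muln1.
Qed.

Definition enumerates (Q : nat -> nat) : Prop :=
  (forall p, p < n -> Q p < n) /\
  (forall p p', p < n -> p' < n -> Q p = Q p' -> p = p').

(** A loop costs [n * K.+1] if its body costs [K]. The last bracket pays for the insertion sort: at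
    most [n * n] swaps and [n] outer iterations. *)
Definition sort_time := n * 1 + n * (n * 1).+1 + (n * n + n).

Lemma sort_by_ok lt K s0 : 0 < n -> (forall s, same_sweep s0 s -> key_cmp n cx cy K lt s) ->
  ok (sort_by lt) (fun s _ => [/\ same_sweep s0 s, enumerates (ia s aQ 0) &
    forall p p', p < p' -> p' < n -> (K (ia s aQ 0 p) <= K (ia s aQ 0 p'))%R])
    s0 sort_time.
Proof.
move=> n0 cmpP; apply: ok_seq_post (init_sort_ok s0) _ => s1 [sm1 f1].
apply: ok_seq; apply: (@ok_i _ _ _ _ _ _ 0) => //.
have sub s : same [:: vi; vk; va; vb] [:: aQ; aC] [::] (set_iv s1 vr 0) s -> same_sweep s0 s.
  move=> sm; apply: (@same_trans _ _ _ _ _ (set_iv s1 vr 0)); first exact: same_iv.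
  by apply: same_sub sm => // v; rewrite !inE => /or4P[] ->; rewrite ?orbT.
apply: ok_conseq.
  apply: (@isort_ok _ _ _ _ lt K (ia s1 aC)) => //.
  - exact: fresh_swap_inv.
  - exact: unswapped_le.
  - by move=> s /sub; apply: cmpP.
by move=> s t [/sub sm [q1 q2 _ _ _] srt _].
Qed.

End Sweep.

(** * Comparison of half circles without square roots *)

Section ArcTest.
Variable R : realType.
Implicit Types (d A B : R).

(** The sign of [d] tells on which side it may be moved so that both sides are nonnegative; squaring
    leaves a single mixed product, which is isolated and squared again. *)
Lemma sqrt_le_shift d A B : 0 <= A -> 0 <= B ->
  (Num.sqrt A <= d + Num.sqrt B) =
  if 0 <= d then (A - B - d ^+ 2 <= 0) || ((A - B - d ^+ 2) ^+ 2 <= 4 * d ^+ 2 * B)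
  else (0 <= B - A - d ^+ 2) && (4 * d ^+ 2 * A <= (B - A - d ^+ 2) ^+ 2).
Proof.
move=> A0 B0; have a0 := sqrtr_ge0 A; have b0 := sqrtr_ge0 B.
rewrite -{-1}(sqr_sqrtr A0) -{-1}(sqr_sqrtr B0).
move: (Num.sqrt A) (Num.sqrt B) a0 b0 => a b a0 b0.
case: ifP => [d0|/negbT]; last rewrite -ltNge => d0.
  have -> : (a <= d + b) = (a ^+ 2 <= (d + b) ^+ 2) by rewrite ler_sqr ?nnegrE // addr_ge0.
  have -> : 4 * d ^+ 2 * b ^+ 2 = (2 * d * b) ^+ 2 by ring.
  have db : 0 <= 2 * d * b by rewrite !mulr_ge0.
  case: (leP (a ^+ 2 - b ^+ 2 - d ^+ 2) 0) => h /=.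
    by apply/idP; nra.
  rewrite [RHS]ler_sqr ?nnegrE //; last exact: ltW.
  by apply/idP/idP; lra.
have -> : (a <= d + b) = ((a - d) ^+ 2 <= b ^+ 2).
  by rewrite ler_sqr ?nnegrE; [apply/idP/idP; lra|lra|].
have -> : 4 * d ^+ 2 * a ^+ 2 = (2 * (- d) * a) ^+ 2 by ring.
have da : 0 <= 2 * (- d) * a by rewrite !mulr_ge0 //; lra.
case: (leP 0 (b ^+ 2 - a ^+ 2 - d ^+ 2)) => h /=.
  by rewrite [RHS]ler_sqr ?nnegrE //; apply/idP/idP; lra.
by apply/negbTE; rewrite -ltNge; nra.
Qed.

End ArcTest.

Definition BOr a b := BNot (BAnd (BNot a) (BNot b)).
Definition fsq e := FMul e e.
Definition height2 e := FSub (FC 1) (fsq (FSub (FGet rPY (EV vr)) (FGet rPY e))).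

(* Compares two half circles at height [y]; the RAM has no square roots, hence
   the squarings of [sqrt_le_shift]. *)
Definition arc_le e1 e2 : bexp :=
  let d := FSub (FGet rPX e2) (FGet rPX e1) in
  let A := height2 e1 in
  let B := height2 e2 in
  let E := FSub (FSub A B) (fsq d) in
  let E' := FSub (FSub B A) (fsq d) in
  BOr (BAnd (BRle (FC 0) d)
         (BOr (BRle E (FC 0)) (BRle (fsq E) (FMul (FMul (FC 4) (fsq d)) B))))
      (BAnd (BNot (BRle (FC 0) d))
         (BAnd (BRle (FC 0) E') (BRle (FMul (FMul (FC 4) (fsq d)) A) (fsq E')))).

Definition arc_lt e1 e2 : bexp := BNot (arc_le e2 e1).

Definition sweep : cmd := init_sort ;;; CFor vr (isort arc_lt).

Section SweepOk.
Variable R : realType.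
Variables (n : nat) (cx cy : nat -> R).
Local Notation hst := (hst R).
Local Notation ok := (ok n cx cy).

Definition row_arc (s : hst) r x : R := disk_arc (ra s rPX x) (ra s rPY x) (ra s rPY r).

Lemma arc_lt_cmp s : (iv s vr < n)%N ->
  (forall a b, (a < n)%N -> (b < n)%N -> `|ra s rPY a - ra s rPY b| < 1) ->
  key_cmp n cx cy (row_arc s (iv s vr)) arc_lt s.
Proof.
move=> rn h e1 e2 s1 s2 n1 n2; split.
  by rewrite /= s1 s2 n1 n2 rn /= ?implybT.
have pos x : (x < n)%N -> 0 <= 1 - (ra s rPY (iv s vr) - ra s rPY x) ^+ 2.
  by move=> xn; have /ltr_normlP[] := h _ _ rn xn; nra.
rewrite /row_arc /disk_arc ltNge -lerBrDl addrAC sqrt_le_shift ?pos //=.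
congr (~~ _); rewrite !negb_and !negbK mulr0z mulr1z !expr2.
by case: (leP 0 (ra s 2 _ - ra s 2 _)) => _; rewrite /= ?orbF ?negbK ?negb_or ?negbK.
Qed.

Lemma enumerates_onto Q a : enumerates n Q -> (a < n)%N -> exists2 p, (p < n)%N & Q p = a.
Proof.
move=> [ran inj] an; pose f (i : 'I_n) := Ordinal (ran i (ltn_ord i)).
have f_inj : injective f.
  by move=> i j [/inj e]; apply/val_inj/e.
have [g _ gK] := injF_bij f_inj.
exists (g (Ordinal an)) => //.
by have := congr1 val (gK (Ordinal an)).
Qed.

Definition sweep_time := (n * 1 + n * (n * 1).+1 + (n * n + n * n.+1))%N.

(** The entry of a pair is the first row at which its arcs are found in the new order. A pair never
    swapped keeps the entry [n], which exceeds every row, so it needs no separate case. *)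
Lemma sweep_ok s0 : (0 < n)%N ->
  (forall a b, (a < n)%N -> (b < n)%N -> `|ra s0 rPY a - ra s0 rPY b| < 1) ->
  (forall a b, (a <= b)%N -> (b < n)%N -> ra s0 rPY a <= ra s0 rPY b) ->
  ok sweep (fun s _ => same_sweep s0 s /\
    forall a b r, (b < a)%N -> (a < n)%N -> (r < n)%N ->
      (ia s aC a b <= r)%N = (row_arc s0 r b < row_arc s0 r a)) s0 sweep_time.
Proof.
move=> n0 ht ysort; apply: ok_seq_post (init_sort_ok n cx cy s0) _ => s1 [sm1 [q1 c1]].
(* The invariant between two passes. The condition [i <= r.+1] reaches back to row [i - 1], the last
   one sorted, from which [arc_crossing] carries the strict order to all higher rows; this is what
   makes the log valid input for the next pass. *)
pose link i (Q : nat -> nat) (C : nat -> nat -> nat) := forall p p', (p < p' < n)%N ->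
  if (Q p < Q p')%N then (C (Q p') (Q p) < i)%N /\
     (forall r, (i <= r.+1)%N -> (r < n)%N -> row_arc s0 r (Q p) < row_arc s0 r (Q p'))
  else C (Q p) (Q p') = n.
apply: (@ok_for _ _ _ _ (fun i s t => [/\ same_sweep s0 s, enumerates n (ia s aQ 0),
  link i (ia s aQ 0) (ia s aC),
  (unswapped n (ia s aC) <= t)%N &
  forall a b r, (b < a)%N -> (a < n)%N -> (r < i)%N ->
    (ia s aC a b <= r)%N = (row_arc s0 r b < row_arc s0 r a)])).
- split=> //=.
  + exact: same_iv.
  + by split=> [p pn|p p' pn pn']; rewrite ?q1 //; lia.
  + move=> p p' /andP[pp pn]; rewrite !q1 ?ifN ?c1 //; lia.
  + exact: unswapped_le.
- move=> i s t iN vE [sm [ran inj] lk un spec].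
  have sub s' : same [:: vi; vk; va; vb] [:: aQ; aC] [::] s s' -> same_sweep s0 s'.
    move=> sm'; apply: same_trans sm _.
    by apply: same_sub sm' => // v; rewrite !inE => /or4P[] ->; rewrite ?orbT.
  have rowE s' r x : same_sweep s0 s' -> row_arc s' r x = row_arc s0 r x.
    by move=> [_ _ rE _]; rewrite /row_arc !rE.
  apply: ok_conseq.
    apply: (@isort_ok _ _ _ _ arc_lt (row_arc s0 i) (ia s aC)) un _.
    + by rewrite vE.
    + rewrite vE; split=> //.
      * move=> p p' pp pn lt; have := lk p p'; rewrite pp pn ltnNge (ltnW lt); exact.
      * move=> p p' pp pn lt; have := lk p p'; rewrite pp pn lt => /(_ isT)[l1 l2].
        by split; [exact: ltnW|apply: l2].
      * by left.
    move=> s' sm'; have sm0 := sub _ sm'.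
    have vE' : iv s' vr = i by case: sm' => -> //.
    have := @arc_lt_cmp s'; rewrite vE' => /(_ iN) h e1 e2 h1 h2 h3 h4.
    have [|-> ->] := h _ e1 e2 h1 h2 h3 h4.
      by move=> a b an bn; case: sm0 => _ _ rE _; rewrite !rE // ht.
    by split=> //; rewrite !rowE.
  move=> s' t' [sm' [ran' inj' before after log] srt un'].
  have sm0 := sub _ sm'.
  have vE' : iv s' vr = i by case: sm' => -> //.
  rewrite vE in after log; split=> //; split=> //=.
  + exact: same_iv.
  + move=> p p' /andP[pp pn]; case: ifP => lt.
      have [l1 l2] := after _ _ pp pn lt; split=> // r ir rn.
      have pn0 : (p < n)%N by lia.
      by apply: (arc_crossing _ _ _ _ l2); rewrite ?ysort ?(ltnW lt) ?ran' // ltW ?ht ?ran'.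
    apply: before => //; have pn0 : (p < n)%N by lia.
    have := inj' _ _ pn0 pn; lia.
  + move=> a b r ba an; rewrite ltnS leq_eqVlt => /orP[/eqP->|ri].
      have en : enumerates n (ia s' aQ 0) by [].
      have [p pn pE] := enumerates_onto en an.
      have [p' pn' pE'] := enumerates_onto en (ltn_trans ba an).
      case: (ltngtP p p') => pp.
      * have lt : (ia s' aQ 0 p' < ia s' aQ 0 p)%N by rewrite pE pE'.
        have cn := before _ _ pp pn' lt; rewrite pE pE' in cn.
        rewrite cn leqNgt iN; apply/esym/negbTE; rewrite -leNgt -pE -pE'.
        exact: srt.
      * have lt : (ia s' aQ 0 p' < ia s' aQ 0 p)%N by rewrite pE pE'.
        by have [l1 l2] := after _ _ pp pn lt; rewrite -pE -pE' l1 l2.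
      * by move: ba; rewrite -pE -pE' pp ltnn.
    (* For an earlier row [r], an entry changed by this pass went from [n] to [i], and both exceed
       [r]. *)
    rewrite -spec //; case: (log a b) => [->//|[cn cr]].
    by rewrite cn cr; apply/idP/idP; lia.
- by move=> s t [sm en lk un spec]; split.
Qed.

End SweepOk.

(** * Dynamic programming *)

Section Envelope.
Variables (R : realType) (n : nat) (K : nat -> nat -> R) (C : nat -> nat -> nat).
Variable tight : nat -> Prop.
Local Open Scope nat_scope.

Hypothesis crossing : forall a b r, b < a -> a < n -> r < n ->
  (C a b <= r) = (K r b < K r a)%R.
Hypothesis tight_lt : forall i, tight i -> i < n.

(* The stack [st 0 > ... > st (m - 1)] lists the curves on the lower envelope
   of the tight ones, in the order in which they appear on it. *)
Definition stack lo m (st : nat -> nat) : Prop :=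
  [/\ forall t, t < m -> tight (st t) /\ lo <= st t,
      forall t, t.+1 < m -> st t.+1 < st t &
      forall t, t.+2 < m -> C (st t) (st t.+1) < C (st t.+1) (st t.+2)].

Definition covered m (st : nat -> nat) r i : Prop :=
  exists2 t, t < m & (K r (st t) <= K r i)%R.

Lemma covered_pop lo m st b r i : stack lo m.+2 st -> b < lo -> r < n ->
  C (st m.+1) b <= C (st m) (st m.+1) -> covered m.+2 st r i ->
  covered m.+1 st r i \/ (K r b <= K r i)%R.
Proof.
move=> [S1 S2 S3] blo rn le [t tm Kt].
case: (ltnP t m.+1) => tm1; first by left; exists t.
have tE : t = m.+1 by lia.
rewrite tE in Kt; have [/tight_lt sn lo1] := S1 m.+1 (ltnSn _).
have [/tight_lt sn0 lo0] := S1 m (ltnW (ltnSn _)).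
case: (leqP (C (st m) (st m.+1)) r) => h.
  right; apply: le_trans Kt; apply: ltW; rewrite -(crossing _ sn rn); lia.
left; exists m => //; apply: le_trans Kt; rewrite leNgt -(crossing _ sn0 rn) ?S2 //.
by rewrite -ltnNge.
Qed.

Lemma stack_pop lo m st : stack lo m.+1 st -> stack lo m st.
Proof.
move=> [S1 S2 S3]; split=> t tm; [exact: S1 (ltnW tm)|exact: S2 (ltnW tm)|].
exact: S3 (ltnW tm).
Qed.

Lemma stack_push lo m st st' b : stack lo m st -> b < lo -> tight b ->
  (2 <= m -> C (st m.-2) (st m.-1) < C (st m.-1) b) ->
  (forall t, st' t = if t == m then b else st t) -> stack b m.+1 st'.
Proof.
move=> [S1 S2 S3] blo tb top stE.
have E t : t < m -> st' t = st t by move=> tm; rewrite stE ltn_eqF.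
have Em : st' m = b by rewrite stE eqxx.
split=> t; rewrite ltnS.
- rewrite leq_eqVlt => /orP[/eqP->|tm]; rewrite ?Em // E //.
  by have [h1 h2] := S1 t tm; split=> //; lia.
- rewrite leq_eqVlt => /orP[/eqP tm|tm]; last by rewrite !E ?S2 //; lia.
  by have [|_ lo_t] := S1 t; [lia|rewrite tm Em E; lia].
- rewrite leq_eqVlt => /orP[/eqP tm|tm]; last by rewrite !E ?S3 //; lia.
  rewrite tm Em !E; try lia.
  by move: top; rewrite -tm /=; apply.
Qed.

(** As the crossings increase along the stack, the values at row [r] decrease up to the last
    crossing that is at most [r] and do not decrease after it. The local condition at [q] therefore
    locates the global minimum. *)
Lemma stack_min lo m st q r : stack lo m st -> q < m -> r < n ->
  (forall t, t < q -> C (st t) (st t.+1) <= r) ->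
  (q.+1 < m -> r < C (st q) (st q.+1)) ->
  forall t, t < m -> (K r (st q) <= K r (st t))%R.
Proof.
move=> [S1 S2 S3] qm rn lo_q hi_q.
have sn t : t < m -> st t < n by move=> /S1[/tight_lt].
have up d : q + d < m -> (K r (st q) <= K r (st (q + d)%N))%R /\
    (q + d.+1 < m -> r < C (st (q + d)) (st (q + d.+1))).
  elim: d => [|d IH]; first by rewrite addn0 addn1; split; rewrite ?lexx.
  move=> h; have [|h1 h2] := IH; first by lia.
  have h3 := h2 h; split.
    apply: le_trans h1 _; rewrite leNgt -crossing ?sn ?addnS ?S2 -?addnS //; try lia.
  have := S3 (q + d); rewrite -[(q + d).+1]addnS -[(q + d.+1).+1]addnS.
  by move=> H h4; have := H h4; lia.
have down d : d <= q -> (K r (st q) <= K r (st (q - d)%N))%R.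
  elim: d => [|d IH] dq; first by rewrite subn0.
  apply: le_trans (IH _) _; first by lia.
  have -> : q - d = (q - d.+1).+1 by lia.
  apply: ltW; rewrite -crossing; first by apply: lo_q; lia.
  - by apply: S2; lia.
  - by apply: sn; lia.
  - by [].
move=> t tm; case: (leqP q t) => qt.
  by rewrite -(subnKC qt); apply: (up (t - q) _).1; rewrite subnKC.
by rewrite -(subKn (ltnW qt)); apply: down; apply: leq_subr.
Qed.

End Envelope.

(* [aF] j is the best size of an independent set ending in j, 0 as long as j has
   not been treated; with [aD] j k added to it, the best size of one ending in
   j, k; [aW] j k and [aPRV] j are elements preceding j in an optimal set, the
   former being far from k if possible. *)
Local Notation aF := 2%N (only parsing).
Local Notation aD := 3%N (only parsing).
Local Notation aW := 4%N (only parsing).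
Local Notation aST := 5%N (only parsing).
Local Notation aXO := 6%N (only parsing).
Local Notation aPRV := 10%N (only parsing).
Local Notation vo := 5%N (only parsing).
Local Notation vj := 6%N (only parsing).
Local Notation vbest := 7%N (only parsing).
Local Notation vprv := 8%N (only parsing).
Local Notation vm := 9%N (only parsing).
Local Notation vq := 10%N (only parsing).

Definition far_test e1 e2 : bexp :=
  BNot (BRle (FAdd (fsq (FSub (FGet rPX e1) (FGet rPX e2)))
                   (fsq (FSub (FGet rPY e1) (FGet rPY e2)))) (FC 1)).

(** Positive [aF] marks the centres treated so far. The program treats them by abscissa, so for the
    current centre this is the test [before]. *)
Definition candidate e1 e2 : bexp := BAnd (BLe (EC 1) (aget aF e1)) (far_test e1 e2).

Definition scan : cmd :=
  CI vbest (EC 1) ;;; CI vprv (EV vj) ;;;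
  CFor vi
    (CIf (candidate (EV vi) (EV vj))
       (CI va (EAdd (aget aF (EV vi)) (EGet aD (EV vi) (EV vj))) ;;;
        CIf (BLe (EAdd (EV vbest) (EC 1)) (EV va))
          (CI vbest (EV va) ;;; CI vprv (EV vi)) CSkip)
       CSkip) ;;;
  aset aF (EV vj) (EV vbest) ;;; aset aPRV (EV vj) (EV vprv).

Definition top k := aget aST (ESub (EV vm) (EC k)).

(** Centres are scanned by decreasing index, that is, downwards, since of two arcs the one with the
    higher centre comes first on the envelope. As [vbest] is a maximum, the test [vbest <= ...]
    selects exactly the predecessors that attain it. *)
Definition build_stack : cmd :=
  CI vm (EC 0) ;;;
  CFor vk
    (CI va (ESub (ESub EN (EC 1)) (EV vk)) ;;;
     CIf (BAnd (candidate (EV va) (EV vj))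
            (BLe (EV vbest) (EAdd (aget aF (EV va)) (EGet aD (EV va) (EV vj)))))
       (CWhile (BAnd (BLe (EC 2) (EV vm))
                  (BLe (EGet aC (top 1) (EV va)) (EGet aC (top 2) (top 1))))
          (CI vm (ESub (EV vm) (EC 1))) ;;;
        aset aST (EV vm) (EV va) ;;;
        CI vm (EAdd (EV vm) (EC 1)))
       CSkip).

Definition cur k := aget aST (EAdd (EV vq) (EC k)).

(** Rows are visited upwards, so [vq] never moves back. If the stack is empty, [j] has no
    predecessor in an optimal set: [aD] becomes 1, and [aW] receives whatever is in cell 0 of the
    stack, which is still a valid index. *)
Definition query_stack : cmd :=
  CI vq (EC 0) ;;;
  CFor vr
    (CWhile (BAnd (BLe (EAdd (EV vq) (EC 2)) (EV vm))
               (BLe (EGet aC (cur 0) (cur 1)) (EV vr)))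
       (CI vq (EAdd (EV vq) (EC 1))) ;;;
     CSet aW (EV vj) (EV vr) (cur 0) ;;;
     CIf (BAnd (BLe (EC 1) (EV vm)) (BNot (far_test (cur 0) (EV vr))))
       (CSet aD (EV vj) (EV vr) (EC 0))
       (CSet aD (EV vj) (EV vr) (EC 1))).

Definition dp : cmd :=
  CFor vo (CI vj (aget aXO (EV vo)) ;;; scan ;;; build_stack ;;; query_stack).

Section DP.
Variable R : realType.
Variables (n : nat) (cx cy : nat -> R).
Local Notation hst := (hst R).
Local Open Scope nat_scope.
Local Notation ok := (ok n cx cy).

Lemma bsafe_and s a b : bsafe n cx cy s (BAnd a b) =
  bsafe n cx cy s a && (beval n cx cy s a ==> bsafe n cx cy s b).
Proof. by []. Qed.

Lemma beval_and s a b :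
  beval n cx cy s (BAnd a b) = beval n cx cy s a && beval n cx cy s b.
Proof. by []. Qed.

Lemma far_testE s e1 e2 :
  beval n cx cy s (far_test e1 e2) =
  far (ra s rPX) (ra s rPY) (ieval n s e1) (ieval n s e2).
Proof. by rewrite /= -ltNge /far !expr2. Qed.

Variables (px py : nat -> R) (C : nat -> nat -> nat) (xo xpos : nat -> nat).
Hypothesis n_gt0 : 0 < n.
Hypothesis height : forall a b, a < n -> b < n -> (`|py a - py b| < 1)%R.
Hypothesis xsorted :
  forall a b, a < n -> b < n -> before xpos a b -> (px a <= px b)%R.
Hypothesis xo_lt : forall p, p < n -> xo p < n.
Hypothesis xposK : forall a, a < n -> xo (xpos a) = a.
Hypothesis xoK : forall p, p < n -> xpos (xo p) = p.
Let K r a := disk_arc (px a) (py a) (py r).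
Hypothesis crossing : forall a b r, b < a -> a < n -> r < n ->
  (C a b <= r) = (K r b < K r a)%R.

Local Notation far := (far px py).
Local Notation before := (before xpos).
Local Notation best1 := (best1 n px py xpos).
Local Notation best2 := (best2 n px py xpos).

Definition dp_input (s : hst) : Prop :=
  [/\ ra s rPX = px, ra s rPY = py, ia s aC = C & ia s aXO 0 = xo].

Definition tight (F : nat -> nat) (D : nat -> nat -> nat) j v i : Prop :=
  [/\ i < n, before i j, far i j & F i + D i j = v].

(** The last two clauses provide witnesses for the backtracking. The witness [W j k] is stored per
    pair, because which optimal predecessor of [j] is far from [k] depends on [k]; [prv j] starts
    the backtracking, when no [k] is given yet. *)
Definition dp_inv p (F : nat -> nat) (D W : nat -> nat -> nat) (prv : nat -> nat) : Prop :=
  [/\ forall i, i < n -> (0 < F i) = (xpos i < p),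
      forall i, i < n -> xpos i < p -> best1 i (F i),
      forall i k, i < n -> k < n -> xpos i < p -> before i k -> far i k ->
        best2 i k (F i + D i k),
      forall j k, j < n -> k < n -> xpos j < p -> before j k -> far j k ->
        [/\ D j k <= 1, F j = 1 -> D j k = 1 &
            1 < F j -> tight F D j (F j) (W j k) /\ (D j k = 1 -> far (W j k) k)] &
      forall j, j < n -> xpos j < p -> 1 < F j -> tight F D j (F j) (prv j)].

Lemma far_irr i : ~~ far i i.
Proof. by rewrite /far !subrr expr0n /= addr0 ltr10. Qed.

Lemma candidate_safe s e1 e2 : isafe n s e1 -> isafe n s e2 ->
  ieval n s e1 < n -> ieval n s e2 < n -> bsafe n cx cy s (candidate e1 e2).
Proof. by rewrite /= => -> -> -> ->; rewrite n_gt0 implybT. Qed.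

Lemma candidateE s p e1 e2 : dp_input s ->
  (forall i, i < n -> i != ieval n s e2 -> (0 < ia s aF 0 i) = (xpos i < p)) ->
  xpos (ieval n s e2) = p -> ieval n s e1 < n ->
  beval n cx cy s (candidate e1 e2) =
  before (ieval n s e1) (ieval n s e2) && far (ieval n s e1) (ieval n s e2).
Proof.
move=> [xE yE _ _] F0 xp n1.
have -> : beval n cx cy s (candidate e1 e2) =
  (0 < ia s aF 0 (ieval n s e1)) && beval n cx cy s (far_test e1 e2) by [].
rewrite far_testE xE yE; case: (eqVneq (ieval n s e1) (ieval n s e2)) => [->|ne].
  by rewrite (negbTE (far_irr _)) !andbF.
by rewrite F0 // /before xp.
Qed.

Lemma dp_input_same vs qs rs s s' : same vs qs rs s s' -> aC \notin qs ->
  aXO \notin qs -> rPX \notin rs -> rPY \notin rs -> dp_input s -> dp_input s'.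
Proof.
move=> [_ a b _] h1 h2 h3 h4 [e1 e2 e3 e4].
by split; rewrite ?a ?b.
Qed.

Local Notation scan_same := (same [:: vi; va; vbest; vprv] [:: aF; aPRV] [::]).

Lemma scan_ok s p W prv : dp_input s -> p < n -> iv s vj = xo p ->
  dp_inv p (ia s aF 0) (ia s aD) W prv ->
  let j := xo p in
  ok scan (fun s' _ => exists v b,
    [/\ scan_same s s' /\ iv s' vbest = v, best1 j v,
        forall i, i < n -> before i j -> far i j -> ia s aF 0 i + ia s aD i j <= v,
        0 < v /\ (1 < v -> tight (ia s aF 0) (ia s aD) j v b) &
        (forall i, ia s' aF 0 i = if i == j then v else ia s aF 0 i) /\
        (forall i, ia s' aPRV 0 i = if i == j then b else ia s aPRV 0 i)]) s (n * 1).
Proof.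
move=> inp pn vjE [F0 F1 F2 _ _] j; have jn : j < n := xo_lt pn.
have xj : xpos j = p := xoK pn.
apply: ok_seq; apply: (@ok_i _ _ _ _ _ _ 1) => //.
apply: ok_seq; apply: (@ok_i _ _ _ _ _ _ j) => //.
apply: ok_seq; apply: ok_conseq.
  apply: (@ok_for0 _ _ _ _ (fun i s1 => [/\ same [:: vi; va; vbest; vprv] [::] [::] s s1,
    0 < iv s1 vbest,
    forall i', i' < i -> before i' j -> far i' j -> ia s aF 0 i' + ia s aD i' j <= iv s1 vbest
    & iv s1 vbest = 1 \/ tight (ia s aF 0) (ia s aD) j (iv s1 vbest) (iv s1 vprv)]) 0
    _ _ _ (fun s1 => [/\ same [:: vi; va; vbest; vprv] [::] [::] s s1,
    0 < iv s1 vbest,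
    forall i', i' < n -> before i' j -> far i' j -> ia s aF 0 i' + ia s aD i' j <= iv s1 vbest
    & iv s1 vbest = 1 \/ tight (ia s aF 0) (ia s aD) j (iv s1 vbest) (iv s1 vprv)])).
  - by split=> //; [do 3 apply: same_iv => //; apply: same_refl|left].
  - move=> i s1 iN viE [sm v0 up wit].
    have inp1 : dp_input s1 by apply: dp_input_same sm _ _ _ _ inp.
    have [svE sqE srE so] := sm.
    have vj1 : iv s1 vj = j by rewrite svE.
    have cE : beval n cx cy s1 (candidate (EV vi) (EV vj)) = before i j && far i j.
      rewrite (@candidateE _ p) //= ?vj1 ?viE // => i' iN' _.
      by rewrite sqE // F0.
    apply: ok_if; first by apply: candidate_safe; rewrite /= ?viE ?vj1.
    rewrite cE; case: ifP => [/andP[bij fij]|nb]; last first.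
      apply: ok_skip; split=> //; split=> //=; first exact: same_iv.
      move=> i'; rewrite ltnS leq_eqVlt => /orP[/eqP->|]; last exact: up.
      by move=> b f; rewrite b f in nb.
    apply: ok_seq; apply: (@ok_i _ _ _ _ _ _ (ia s aF 0 i + ia s aD i j)).
    + by rewrite /= viE vj1 iN jn n_gt0.
    + by rewrite /= viE vj1 !sqE.
    apply: ok_if => //=; rewrite addn1; case: ifP => lt.
      apply: ok_seq; apply: (@ok_i _ _ _ _ _ _ (ia s aF 0 i + ia s aD i j)) => //.
      apply: (@ok_i _ _ _ _ _ _ i) => //=; split=> //; split=> //=.
      * by do 4 apply: same_iv => //.
      * by lia.
      * move=> i'; rewrite ltnS leq_eqVlt => /orP[/eqP-> //|lti b f].
        by apply: leq_trans (up i' lti b f) (ltnW lt).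
      * by right.
    apply: ok_skip; split=> //; split=> //=; first by do 2 apply: same_iv => //.
    move=> i'; rewrite ltnS leq_eqVlt => /orP[/eqP-> _ _|]; last exact: up.
    by move/negbT: lt; rewrite -leqNgt.
  - by [].
move=> s1 t1 [sm v0 up wit]; have [svE sqE srE so] := sm.
have vj1 : iv s1 vj = j by rewrite svE.
set v := iv s1 vbest in v0 up wit *; set b := iv s1 vprv in wit *.
apply: ok_seq; apply: (@ok_set _ _ _ _ _ _ _ _ 0 j v) => //=; first by rewrite n_gt0.
apply: (@ok_set _ _ _ _ _ _ _ _ 0 j b) => //=; first by rewrite n_gt0.
exists v, b; split.
- split=> //; do 2 apply: same_ia => //.
  by apply: same_sub sm.
- apply: (@best1_max _ _ _ _ _ _ (fun i => ia s aF 0 i + ia s aD i j)) => //.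
  + by move=> i iN bij fij; apply: F2 => //; rewrite -xj.
  + by case: wit => [->|[iN bij fij E]]; [left|right; exists b].
- by [].
- by split=> // v1; case: wit => // E; rewrite E in v1.
- by split=> i; rewrite /= sqE.
Qed.

Local Notation stack_same := (same [:: vk; va; vm] [:: aST] [::]).

Lemma build_stack_ok s p v : dp_input s -> p < n -> iv s vj = xo p -> iv s vbest = v ->
  (forall i, i < n -> i != xo p -> (0 < ia s aF 0 i) = (xpos i < p)) ->
  (forall t, t < n -> ia s aST 0 t < n) ->
  (forall i, i < n -> before i (xo p) -> far i (xo p) ->
     ia s aF 0 i + ia s aD i (xo p) <= v) ->
  let T := tight (ia s aF 0) (ia s aD) (xo p) v in
  ok build_stack (fun s' _ =>
    [/\ stack_same s s', forall t, t < n -> ia s' aST 0 t < n, iv s' vm <= n,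
        stack C T 0 (iv s' vm) (ia s' aST 0) &
        forall r i, r < n -> T i -> covered K (iv s' vm) (ia s' aST 0) r i])
    s (n * 2).
Proof.
set j := xo p => inp pn vjE vbE F0 ST0 up T; have jn : j < n := xo_lt pn.
have xj : xpos j = p := xoK pn.
have T_lt i : T i -> i < n by case.
have -> : n * 2 = 0 + n * 2 by [].
apply: ok_seq; apply: (@ok_i _ _ _ _ _ _ 0) => //.
(* The condition [iv s1 vm <= t1] keeps one credit for each entry of the stack: it is deposited at
   the push and pays for the pop. *)
apply: (@ok_for _ _ _ _ (fun u s1 t1 =>
  [/\ stack_same s s1, forall t, t < n -> ia s1 aST 0 t < n,
      iv s1 vm <= u /\ iv s1 vm <= t1, stack C T (n - u) (iv s1 vm) (ia s1 aST 0) &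
      forall r i, r < n -> T i -> n - u <= i -> covered K (iv s1 vm) (ia s1 aST 0) r i])).
- split=> //=; first by do 2 apply: same_iv => //; apply: same_refl.
  by move=> r i rn /T_lt iN; rewrite subn0 leqNgt iN.
- move=> u s1 t1 un vkE [sm ST1 [mu mt] stk cov].
  have inp1 : dp_input s1 by apply: dp_input_same sm _ _ _ _ inp.
  have [svE sqE srE so] := sm.
  set b := n - 1 - u; have bn : b < n by rewrite /b; lia.
  apply: ok_seq; apply: (@ok_i _ _ _ _ _ _ b) => //; first by rewrite /= vkE.
  set s2 := set_iv s1 va b.
  have sm2 : stack_same s s2 by apply: same_iv.
  have cE : beval n cx cy s2 (candidate (EV va) (EV vj)) = before b j && far b j.
    have inp2 : dp_input s2 by apply: dp_input_same sm2 _ _ _ _ inp.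
    by rewrite (@candidateE _ p) //= svE // vjE // sqE.
  have vj2 : iv s2 vj = j by rewrite /= svE.
  apply: ok_if.
    have vj1 : iv s1 vj = j by rewrite svE.
    by rewrite bsafe_and candidate_safe /= ?vj1 // n_gt0 bn jn implybT.
  have -> : beval n cx cy s2 (BAnd (candidate (EV va) (EV vj))
      (BLe (EV vbest) (EAdd (aget aF (EV va)) (EGet aD (EV va) (EV vj))))) =
      [&& before b j, far b j & v <= ia s aF 0 b + ia s aD b j].
    by rewrite beval_and cE -andbA /= !svE // vbE vjE !sqE.
  case: ifP => [/and3P[bj fj le]|nt]; last first.
    apply: ok_skip; split=> //; split=> //=.
    + exact: same_iv.
    + by rewrite addn1; split; apply: leqW.
    + case: stk => S1 S2 S3; split=> // t tm; have [h1 h2] := S1 t tm; split=> //; lia.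
    + move=> r i rn Ti; rewrite leq_eqVlt => /orP[/eqP iE|lt]; last by apply: cov => //; lia.
      case: Ti; rewrite -iE => _ bi fi E; move/negP: nt; case.
      have bE : n - u.+1 = b by rewrite /b; lia.
      by rewrite bE in bi fi E; rewrite bi fi E /=.
  have Tb : T b by split=> //; apply/eqP; rewrite eqn_leq le up.
  apply: ok_seq.
  (* While entries are popped, [b], not yet on the stack, takes over the rows that they alone
     covered. *)
  apply: (@ok_while _ _ _ _ (fun s3 t3 => [/\ stack_same s s3, iv s3 vk = u /\ iv s3 va = b,
    iv s3 vm <= u /\ (iv s3 vm).+1 <= t3, ia s3 aST = ia s1 aST &
    stack C T (n - u) (iv s3 vm) (ia s3 aST 0) /\
    forall r i, r < n -> T i -> n - u <= i -> covered K (iv s3 vm) (ia s3 aST 0) r i \/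
      (K r b <= K r i)%R])).
  + split=> //=; first by split=> //; lia.
    by split=> // r i rn Ti lt; left; apply: cov.
  + move=> s3 t3 [sm3 [vk3 va3] [m3 _] st3 _] /=; rewrite va3 bn n_gt0 /= st3.
    case: (leqP 2 (iv s3 vm)) => //= m2.
    have h1 : iv s3 vm - 1 < n by lia.
    have h2 : iv s3 vm - 2 < n by lia.
    by rewrite h1 h2 !ST1.
  + move=> s3 t3 [sm3 [vk3 va3] [m3 mt3] st3 [stk3 cov3]] /= /andP[m2].
    have cE3 : ia s3 aC = C by case: (dp_input_same sm3 _ _ _ _ inp).
    rewrite cE3 va3 => le3.
    have mE : iv s3 vm = (iv s3 vm - 2).+2 by lia.
    have e1 : iv s3 vm - 1 = (iv s3 vm - 2).+1 by lia.
    move: mE e1 stk3 cov3 le3; set m := iv s3 vm - 2 => mE e1; rewrite e1 mE => stk3 cov3 le3.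
    exists t3.-1; first by lia.
    apply: (@ok_i _ _ _ _ _ _ m.+1) => //=.
    split=> //=.
    * exact: same_iv.
    * by split; lia.
    split; first exact: stack_pop stk3.
    move=> r i rn Ti lt; case: (cov3 r i rn Ti lt) => h; last by right.
    apply: (covered_pop crossing T_lt stk3 _ rn le3 h); rewrite /b; lia.
  move=> s3 t3 [sm3 [vk3 va3] [m3 mt3] st3 [stk3 cov3]] stop.
  have cE3 : ia s3 aC = C by case: (dp_input_same sm3 _ _ _ _ inp).
  have top : 2 <= iv s3 vm -> C (ia s3 aST 0 (iv s3 vm).-2) (ia s3 aST 0 (iv s3 vm).-1) <
      C (ia s3 aST 0 (iv s3 vm).-1) b.
    move=> m2; move: stop; rewrite /= m2 va3 cE3 subn1 subn2 /=.
    by rewrite -ltnNge.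
  have mn : iv s3 vm < n by lia.
  apply: ok_seq; apply: (@ok_set _ _ _ _ _ _ _ _ 0 (iv s3 vm) b) => //=.
    by rewrite n_gt0 mn.
  apply: (@ok_i _ _ _ _ _ _ (iv s3 vm).+1) => //=; first by rewrite addn1.
  split=> //; split=> //=.
  + by apply: same_iv => //; apply: same_iv => //; apply: same_ia.
  + by move=> t tn; case: ifP => // _; rewrite st3 ST1.
  + have -> : n - u.+1 = b by rewrite /b; lia.
    apply: (stack_push stk3 _ Tb top) => //; rewrite /b; lia.
  + move=> r i rn Ti lt.
    have cb : (K r b <= K r i)%R -> exists2 t, t < (iv s3 vm).+1 &
        (K r (if t == iv s3 vm then b else ia s3 aST 0 t) <= K r i)%R.
      by exists (iv s3 vm) => //; rewrite eqxx.
    case: (ltnP i (n - u)) => iu.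
      by apply: cb; have -> : i = b by rewrite /b; lia.
    case: (cov3 r i rn Ti iu) => [[t tm Kt]|]; last exact: cb.
    by exists t; [exact: leqW|rewrite /= ltn_eqF].
- move=> s1 t1 [sm ST1 [mu _] stk cov]; split=> //.
  + by move: stk; rewrite subnn.
  + by move=> r i rn Ti; apply: cov => //; rewrite subnn.
Qed.

Local Notation query_same := (same [:: vr; vq] [:: aD; aW] [::]).

Lemma query_stack_ok s j m (T : nat -> Prop) : dp_input s -> j < n -> iv s vj = j ->
  iv s vm = m -> m <= n -> (forall t, t < n -> ia s aST 0 t < n) ->
  (forall i, T i -> i < n) -> stack C T 0 m (ia s aST 0) ->
  (forall r i, r < n -> T i -> covered K m (ia s aST 0) r i) ->
  ok query_stack (fun s' _ => [/\ query_same s s',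
      forall i k, i != j -> ia s' aD i k = ia s aD i k /\ ia s' aW i k = ia s aW i k,
      forall r, r < n -> m = 0 -> ia s' aD j r = 1 &
      forall r, r < n -> 0 < m -> let e := ia s' aW j r in
        [/\ T e, ia s' aD j r = far e r & forall i, T i -> (K r e <= K r i)%R]])
    s (n + n * 1).
Proof.
move=> inp jn vjE vmE mn STn T_lt stk cov; set st := ia s aST 0 in STn stk cov.
have sub (s1 s2 : hst) : same [:: vq] [::] [::] s1 s2 -> query_same s1 s2.
  by apply: same_sub => // v; rewrite !inE => ->; rewrite orbT.
apply: ok_seq; apply: (@ok_i _ _ _ _ _ _ 0) => //.
(* The potential [n - iv s1 vq] pays for the moves of the pointer over all rows together. *)
apply: (@ok_for _ _ _ _ (fun r s1 t1 => [/\ query_same s s1,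
      forall i k, i != j -> ia s1 aD i k = ia s aD i k /\ ia s1 aW i k = ia s aW i k,
      forall r', r' < r -> m = 0 -> ia s1 aD j r' = 1,
      forall r', r' < r -> 0 < m -> let e := ia s1 aW j r' in
        [/\ T e, ia s1 aD j r' = far e r' & forall i, T i -> (K r' e <= K r' i)%R] &
      [/\ 0 < m -> iv s1 vq < m, m = 0 -> iv s1 vq = 0,
          forall t, t < iv s1 vq -> C (st t) (st t.+1) <= r & n - iv s1 vq <= t1]])) => //.
- split=> //=; first by do 2 apply: same_iv => //; apply: same_refl.
  by split=> //; lia.
- move=> r s1 t1 rn vrE [sm keep D0 D1 [qm q0 qlo qt]]; rewrite addn0.
  apply: ok_seq.
  apply: (@ok_while _ _ _ _ (fun s2 t2 => [/\ same [:: vq] [::] [::] s1 s2,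
      0 < m -> iv s2 vq < m, m = 0 -> iv s2 vq = 0,
      forall t, t < iv s2 vq -> C (st t) (st t.+1) <= r & n - iv s2 vq <= t2])).
  + by split=> //; apply: same_refl.
  + move=> s2 t2 [sm2 qm2 q02 qlo2 qt2] /=.
    have [svE sqE _ _] := same_trans sm (sub _ _ sm2).
    have vm2 : iv s2 vm = m by rewrite svE.
    rewrite vm2 n_gt0 sqE // addn0.
    case: (leqP (iv s2 vq + 2) m) => //= h.
    have h0 : iv s2 vq < n by lia.
    have h1 : iv s2 vq + 1 < n by lia.
    by rewrite h0 h1 !STn.
  + move=> s2 t2 [sm2 qm2 q02 qlo2 qt2] /=.
    have sms := same_trans sm (sub _ _ sm2); have [svE sqE _ _] := sms.
    have cE : ia s2 aC = C by case: (dp_input_same sms _ _ _ _ inp).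
    have vr2 : iv s2 vr = r by case: sm2 => -> //.
    have vm2 : iv s2 vm = m by rewrite svE.
    rewrite vm2 vr2 cE sqE // addn0 addn1 -/st => /andP[h le].
    exists t2.-1; first by lia.
    apply: (@ok_i _ _ _ _ _ _ (iv s2 vq).+1) => //=; first by rewrite addn1.
    split=> //=; first exact: same_iv.
    * by lia.
    * by lia.
    * move=> t; rewrite ltnS leq_eqVlt => /orP[/eqP->//|]; exact: qlo2.
    * by lia.
  move=> s2 t2 [sm2 qm2 q02 qlo2 qt2] stop.
  have sms := same_trans sm (sub _ _ sm2); have [svE sqE _ _] := sms.
  have inp2 := dp_input_same sms _ _ _ _ inp.
  have vr2 : iv s2 vr = r by case: sm2 => -> //.
  have vj2 : iv s2 vj = j by rewrite svE.
  have vm2 : iv s2 vm = m by rewrite svE.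
  have ia2 q : ia s2 q = ia s1 q by case: sm2 => _ ->.
  have qn : iv s2 vq < n by case: (posnP m) => m0; [rewrite q02|have := qm2 m0; lia].
  have hi : (iv s2 vq).+1 < m -> r < C (st (iv s2 vq)) (st (iv s2 vq).+1).
    move=> h; have [] := inp2 isT isT isT isT => _ _ cE _.
    move: stop; rewrite /= vm2 vr2 cE sqE // addn0 addn1 addn2 -/st h /=.
    by rewrite -ltnNge.
  set e := st (iv s2 vq).
  have en : e < n by apply: STn.
  apply: ok_seq; apply: (@ok_set _ _ _ _ _ _ _ _ j r e) => //=.
  - by rewrite addn0 n_gt0 qn.
  - by rewrite addn0 sqE.
  - by rewrite jn rn.
  set s3 := set_ia s2 aW j r e.
  have fE : beval n cx cy s3 (far_test (cur 0) (EV vr)) = far e r.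
    have [xE yE _ _] := inp2 isT isT isT isT.
    by rewrite far_testE [ra s3 rPX]xE [ra s3 rPY]yE /= addn0 vr2 sqE.
  have fin d : d = (if (0 < m) && ~~ far e r then 0 else 1) ->
    let s' := set_ia s3 aD j r d in
    iv s' vr = r /\ [/\ query_same s (set_iv s' vr r.+1),
      forall i k, i != j -> ia s' aD i k = ia s aD i k /\ ia s' aW i k = ia s aW i k,
      forall r', r' < r.+1 -> m = 0 -> ia s' aD j r' = 1,
      forall r', r' < r.+1 -> 0 < m -> let e := ia s' aW j r' in
        [/\ T e, ia s' aD j r' = far e r' & forall i, T i -> (K r' e <= K r' i)%R] &
      [/\ 0 < m -> iv s' vq < m, m = 0 -> iv s' vq = 0,
          forall t, t < iv s' vq -> C (st t) (st t.+1) <= r.+1 & n - iv s' vq <= t2]].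
    move=> dE s'; split=> //; split=> //=.
    + by apply: same_iv => //; do 2 apply: same_ia => //.
    + by move=> i k ij; rewrite (negbTE ij) /= !ia2; apply: keep.
    + move=> r' le m0; rewrite eqxx /= ia2; case: eqP => [_|ne].
        by rewrite dE m0.
      by apply: D0 => //; lia.
    + move=> r' le m0; rewrite eqxx /= !ia2; case: eqP => [->|ne]; last by apply: D1 => //; lia.
      have Te : T e by have [S1 _ _] := stk; have [] := S1 _ (qm2 m0).
      split=> //; first by rewrite dE m0; case: far.
      move=> i Ti; have [t tm Kt] := cov r i rn Ti; apply: le_trans Kt.
      exact: (stack_min crossing T_lt stk (qm2 m0) rn qlo2 hi).
    + by split=> // t /qlo2 /leqW.
  apply: ok_if.
    rewrite bsafe_and /= vm2 vr2 rn addn0 n_gt0 qn sqE //.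
    by rewrite -/st en implybT.
  rewrite beval_and [beval _ _ _ _ (BNot _)]/= -[~~ _ as X in _ && X]/(~~ beval n cx cy s3 (far_test (cur 0) (EV vr))) fE.
  rewrite (_ : beval _ _ _ _ _ = (0 < m)); last by rewrite /= vm2.
  case: ifP => c.
    apply: (@ok_set _ _ _ _ _ _ _ _ j r 0) => //=; first by rewrite jn rn.
    by apply: fin; rewrite c.
  apply: (@ok_set _ _ _ _ _ _ _ _ j r 1) => //=; first by rewrite jn rn.
  by apply: fin; rewrite c.
by move=> s1 t1 [sm keep D0 D1 _].
Qed.

Definition dp_vars := [:: vi; vk; va; vr; vo; vj; vbest; vprv; vm; vq].
Local Notation dp_same := (same dp_vars [:: aF; aD; aW; aST; aPRV] [::]).

Lemma before_neq i j : before i j -> i != j.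
Proof. by move=> b; apply/eqP => e; move: b; rewrite e /before ltnn. Qed.

Lemma farE i k : i < n -> k < n -> before i k -> far i k = (K k i < px k)%R.
Proof. by move=> iN kn b; apply: far_arc; [exact: xsorted|exact: height]. Qed.

Lemma dp_inv_step p m F D W prv F' D' W' prv' v b : p < n -> let j := xo p in
  dp_inv p F D W prv -> best1 j v -> 0 < v -> (1 < v -> tight F D j v b) ->
  (forall i, F' i = if i == j then v else F i) ->
  (forall i, prv' i = if i == j then b else prv i) ->
  (forall i k, i != j -> D' i k = D i k /\ W' i k = W i k) ->
  (forall i, tight F D j v i -> 0 < m) -> (0 < m -> exists i, tight F D j v i) ->
  (forall k, k < n -> m = 0 -> D' j k = 1) ->
  (forall k, k < n -> 0 < m -> let e := W' j k in
     [/\ tight F D j v e, D' j k = far e k &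
         forall i, tight F D j v i -> (K k e <= K k i)%R]) ->
  dp_inv p.+1 F' D' W' prv'.
Proof.
move=> pn j [I1 I2 I3 I4 I5] jbest v0 bT F'E prv'E keep Tm mT Dm0 Dm.
have jn : j < n := xo_lt pn; have xj : xpos j = p := xoK pn.
have F'j : F' j = v by rewrite F'E eqxx.
have F'i i : i != j -> F' i = F i by move=> ne; rewrite F'E (negbTE ne).
have xlt i : i < n -> i != j -> (xpos i < p.+1) = (xpos i < p).
  move=> iN ne; rewrite ltnS leq_eqVlt; case: eqP => // e.
  by move: ne; rewrite -(xposK iN) e eqxx.
have f_best i : i < n -> before i j -> far i j -> best2 i j (F i + D i j).
  by move=> iN bij; apply: I3 => //; rewrite -xj.
(* A tight [i] has [F i >= 1], and [F i = 1] forces [D i j = 1]; so a tight centre exists only if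
   [v >= 2]. *)
have v1m : v = 1 -> m = 0.
  move=> v1; case: (posnP m) => // /mT [i [iN bij fij E]].
  have xi : xpos i < p by rewrite -xj.
  have [_ h _] := I4 i j iN jn xi bij fij.
  have := I1 i iN; rewrite xi; lia.
(* A centre tight for [j0] precedes it, hence differs from [j], and only entries of [j] have
   changed. *)
have tight' j0 w i : j0 < n -> xpos j0 <= p -> tight F D j0 w i -> tight F' D' j0 w i.
  move=> j0n xj0 [iN bi fi E]; split=> //.
  have ne : i != j.
    by apply/eqP => e; move: bi; rewrite e /before xj ltnNge xj0.
  by rewrite F'i // (keep i j0 ne).1.
split.
- move=> i iN; case: (eqVneq i j) => [->|ne]; first by rewrite F'j v0 xj ltnSn.
  by rewrite F'i // I1 // xlt.
- move=> i iN; case: (eqVneq i j) => [->|ne]; first by rewrite F'j.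
  by rewrite xlt // F'i //; apply: I2.
- move=> i k iN kn; case: (eqVneq i j) => [->|ne]; last first.
    by rewrite xlt // F'i // (keep i k ne).1; apply: I3.
  move=> _ bjk fjk; rewrite F'j.
  case: (posnP m) => m0.
    have v1 : v = 1.
      by case: (ltnP 1 v) => [/bT/Tm|]; [rewrite m0|lia].
    by rewrite v1 Dm0 //; apply: (best2_single jn kn bjk fjk jbest v1).
  (* Among the tight centres, [e] has the leftmost arc at the height of [k]: either [e] is far from
     [k], or none of them is. *)
  have [[en be fe Ee] De emin] := Dm k kn m0; rewrite De.
  case fek: (far (W' j k) k).
    rewrite addn1; apply: (best2_extend height xsorted kn bjk fjk f_best jbest en be fe Ee).
    exact: fek.
  rewrite addn0; apply: (best2_blocked height xsorted kn bjk fjk f_best jbest).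
    case: (ltnP 1 v) => // v1; have := v1m; lia.
  move=> i' iN' bi' fi' Ei'; rewrite farE //; last exact: ltn_trans bi' bjk.
  rewrite -leNgt; apply: le_trans (emin i' _); last by split.
  by rewrite leNgt -farE ?fek //; apply: ltn_trans be bjk.
- move=> i k iN kn; case: (eqVneq i j) => [->|ne]; last first.
    rewrite xlt // F'i // (keep i k ne).1 => xi bik fik.
    have [h1 h2 h3] := I4 i k iN kn xi bik fik; split=> // Fi.
    have [Tw fw] := h3 Fi; rewrite (keep i k ne).2; split=> //.
    by apply: tight' => //; apply: ltnW.
  move=> _ bjk fjk; rewrite F'j; case: (posnP m) => m0.
    rewrite Dm0 //; split=> // v1; have := Tm b (bT v1); lia.
  have [Te De emin] := Dm k kn m0; rewrite De; split.
  + by case: far.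
  + by move/v1m; lia.
  + by move=> _; split; [apply: tight'; rewrite ?xj|case: far].
- move=> i iN; case: (eqVneq i j) => [->|ne].
    rewrite F'j prv'E eqxx => _ v1; apply: tight' => //; first by rewrite xj.
    exact: bT.
  rewrite xlt // F'i // prv'E (negbTE ne) => xi Fi.
  by apply: tight' => //; [apply: ltnW|apply: I5].
Qed.

Definition dp_time := n * (n * 1 + (n * 2 + (n + n * 1))).+1.

Lemma dp_ok s0 : dp_input s0 -> (forall i, i < n -> ia s0 aF 0 i = 0) ->
  (forall t, t < n -> ia s0 aST 0 t < n) ->
  ok dp (fun s _ => dp_same s0 s /\
    dp_inv n (ia s aF 0) (ia s aD) (ia s aW) (ia s aPRV 0)) s0 dp_time.
Proof.
move=> inp F0 ST0.
apply: (@ok_for0 _ _ _ _ (fun p s => [/\ dp_same s0 s,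
  dp_inv p (ia s aF 0) (ia s aD) (ia s aW) (ia s aPRV 0) &
  forall t, t < n -> ia s aST 0 t < n])) => //; last by move=> s [].
  split=> //=; first by apply: same_iv => //; apply: same_refl.
  split=> // i iN; rewrite ?F0 //.
move=> p s pn voE [sm inv STn]; set j := xo p.
have jn : j < n := xo_lt pn; have xj : xpos j = p := xoK pn.
have inp1 : dp_input s by apply: dp_input_same sm _ _ _ _ inp.
apply: ok_seq; apply: (@ok_i _ _ _ _ _ _ j).
- by rewrite /= voE n_gt0 pn.
- by rewrite /= voE; case: inp1 => _ _ _ ->.
set s1 := set_iv s vj j.
have sm1 : dp_same s0 s1 by apply: same_iv.
have inp1' : dp_input s1 by apply: dp_input_same sm1 _ _ _ _ inp.
have vj1 : iv s1 vj = j by [].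
have STn1 : forall t, t < n -> ia s1 aST 0 t < n by [].
have invs : dp_inv p (ia s1 aF 0) (ia s1 aD) (ia s1 aW) (ia s1 aPRV 0) by [].
have vo1 : iv s1 vo = p by [].
move: s1 sm1 inp1' vj1 STn1 invs vo1 => s1 sm1 inp1' vj1 STn1 invs vo1.
apply: ok_seq_post (scan_ok inp1' pn vj1 invs) _.
move=> s2 [v [b [[sm2 vb2] jbest up [v0 bT] [F2 prv2]]]].
have [sv2 sq2 sr2 so2] := sm2.
have inp2 : dp_input s2 by apply: dp_input_same sm2 _ _ _ _ inp1'.
have [I1 _ _ _ _] := invs.
have D2 : ia s2 aD = ia s1 aD by rewrite sq2.
have F2i i : i != j -> ia s2 aF 0 i = ia s1 aF 0 i by move=> ne; rewrite F2 (negbTE ne).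
have TE i : tight (ia s2 aF 0) (ia s2 aD) j v i <-> tight (ia s1 aF 0) (ia s1 aD) j v i.
  by rewrite D2; split=> -[iN bi fi E]; split=> //; [rewrite -F2i|rewrite F2i];
    rewrite ?(before_neq bi).
have vj2 : iv s2 vj = j by rewrite sv2.
have STn2 : forall t, t < n -> ia s2 aST 0 t < n by rewrite sq2.
have F02 i : i < n -> i != xo p -> (0 < ia s2 aF 0 i) = (xpos i < p).
  by move=> iN ne; rewrite F2i // I1.
have up2 i : i < n -> before i (xo p) -> far i (xo p) ->
    ia s2 aF 0 i + ia s2 aD i (xo p) <= v.
  by move=> iN bi fi; rewrite D2 F2i ?(before_neq bi) // up.
apply: ok_seq_post (build_stack_ok inp2 pn vj2 vb2 F02 STn2 up2) _.
move=> s3 [sm3 STn3 mn stk cov].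
have [sv3 sq3 sr3 so3] := sm3.
have inp3 : dp_input s3 by apply: dp_input_same sm3 _ _ _ _ inp2.
have vj3 : iv s3 vj = j by rewrite sv3.
have T_lt i : tight (ia s2 aF 0) (ia s2 aD) j v i -> i < n by case.
apply: ok_conseq (query_stack_ok inp3 jn vj3 erefl mn STn3 T_lt stk cov) _.
move=> s4 t4 [sm4 keep Dm0 Dm].
have [sv4 sq4 sr4 so4] := sm4.
have smA : dp_same s1 s4.
  apply: (@same_trans _ _ _ _ s1 s2); first exact: same_widen sm2.
  by apply: (@same_trans _ _ _ _ s2 s3); [exact: same_widen sm3|exact: same_widen sm4].
split; first by rewrite sv4 // sv3 // sv2.
split=> /=.
- by apply: same_iv => //; apply: same_trans sm1 smA.
- apply: (@dp_inv_step p (iv s3 vm) (ia s1 aF 0) (ia s1 aD) (ia s1 aW) (ia s1 aPRV 0)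
    _ _ _ _ v b pn invs jbest v0 bT).
  + by move=> i; rewrite sq4 // sq3 // F2.
  + by move=> i; rewrite sq4 // sq3 // prv2.
  + by move=> i k ne; have [-> ->] := keep i k ne; rewrite !sq3 // !sq2.
  + by move=> i /TE Ti; have [t tm _] := cov 0 i n_gt0 Ti; lia.
  + move=> m0; have [S1 _ _] := stk; have [/TE T0 _] := S1 0 m0.
    by exists (ia s3 aST 0 0).
  + by move=> k kn m0; apply: Dm0.
  + move=> k kn m0; have [/TE h1 h2 h3] := Dm k kn m0; split=> // i /TE.
    exact: h3.
- by move=> t tn; rewrite sq4 // STn3.
Qed.

End DP.

(** * Strips *)

Local Notation aOID := 7%N (only parsing).
Local Notation aPAR := 8%N (only parsing).
Local Notation aSID := 9%N (only parsing).
Local Notation aSEL := 11%N (only parsing).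
Local Notation rTX := 0%N (only parsing).
Local Notation rTY := 1%N (only parsing).
Local Notation vs := 11%N (only parsing).
Local Notation vp := 12%N (only parsing).
Local Notation rt := 0%N (only parsing).
Local Notation rs := 1%N (only parsing).
Local Notation rw := 2%N (only parsing).

(** Since [cx a - cx b + 1 < 3 + cx a ^+ 2 + cx b ^+ 2], the sum of squares bounds the horizontal
    spread without a search for extremes. The loop invariant treats [a != b] apart, because each
    square is added only once. *)
Definition width : cmd :=
  CR rw (FC 3) ;;; CFor vi (CR rw (FAdd (FV rw) (fsq (FX (EV vi))))).

(** [rt] is the base of the current strip and [rs] its horizontal shift, which grows by [rw] per
    strip. The parity is toggled along with the strip number [vs], from which the machine could not
    read it off directly. *)
Definition strips : cmd :=
  CR rs (FC 0) ;;; CI vs (EC 0) ;;; CI vp (EC 0) ;;; CR rt (FY (aget aQ (EC 0))) ;;;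
  CFor vi
    (CI va (aget aQ (EV vi)) ;;;
     CIf (BRle (FAdd (FV rt) (FC 1)) (FY (EV va)))
       (CR rt (FY (EV va)) ;;; CR rs (FAdd (FV rs) (FV rw)) ;;;
        CI vs (EAdd (EV vs) (EC 1)) ;;; CI vp (ESub (EC 1) (EV vp)))
       CSkip ;;;
     CRSet rTX (EV va) (FAdd (FX (EV va)) (FV rs)) ;;;
     CRSet rTY (EV va) (FSub (FY (EV va)) (FV rt)) ;;;
     aset aSID (EV va) (EV vs) ;;;
     aset aPAR (EV va) (EV vp)).

(** Renumbers the moved centres by height, so that the index of a centre is also its row in the
    sweep; [aOID] leads back to the original numbers. *)
Definition gather : cmd :=
  CFor vi
    (CI va (aget aQ (EV vi)) ;;;
     aset aOID (EV vi) (EV va) ;;;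
     CRSet rPX (EV vi) (FGet rTX (EV va)) ;;;
     CRSet rPY (EV vi) (FGet rTY (EV va))).

Definition copy_order : cmd := CFor vi (aset aXO (EV vi) (aget aQ (EV vi))).

Definition y_lt e1 e2 : bexp := BNot (BRle (FY e2) (FY e1)).
Definition real_lt q e1 e2 : bexp := BNot (BRle (FGet q e2) (FGet q e1)).

Section Strips.
Variable R : realType.
Variables (n : nat) (cx cy : nat -> R).
Local Notation hst := (hst R).
Local Notation ok := (ok n cx cy).
Hypothesis n_gt0 : (0 < n)%N.

Definition wide (w : R) : Prop :=
  3 <= w /\ forall a b, (a < n)%N -> (b < n)%N -> cx a + 1 < cx b + w.

Lemma width_ok s0 : ok width (fun s _ => same [:: vi] [::] [::] s0 s /\ wide (rv s rw))
  s0 (n * 1)%N.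
Proof.
apply: ok_seq; apply: (@ok_r _ _ _ _ _ _ 3) => //.
apply: (@ok_for0 _ _ _ _ (fun i s => [/\ same [:: vi] [::] [::] s0 s, 3 <= rv s rw,
  forall a, (a < i)%N -> 3 + cx a ^+ 2 <= rv s rw &
  forall a b, (a < i)%N -> (b < i)%N -> a != b ->
    3 + cx a ^+ 2 + cx b ^+ 2 <= rv s rw])).
- by split=> //; apply: same_iv => //; apply: same_rv; apply: same_refl.
- move=> i s iN viE [sm w3 w1 w2].
  apply: (@ok_r _ _ _ _ _ _ (rv s rw + cx i ^+ 2)).
  + by rewrite /= viE iN.
  + by rewrite /= viE expr2.
  have q0 := sqr_ge0 (cx i).
  split=> //; split=> /=; first by apply: same_iv => //; apply: same_rv.
  + by lra.
  + move=> a; rewrite ltnS leq_eqVlt => /orP[/eqP->|/w1]; lra.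
  + move=> a b; rewrite !ltnS (leq_eqVlt a) (leq_eqVlt b) => /orP[/eqP->|ai] /orP[/eqP->|bi] ne.
    * by rewrite eqxx in ne.
    * by have := w1 b bi; lra.
    * by have := w1 a ai; lra.
    * by have := w2 a b ai bi ne; lra.
- move=> s [sm w3 w1 w2]; split=> //; split=> // a b an bn.
  case: (eqVneq a b) => [->|ne]; first by lra.
  have := w2 a b an bn ne; have := sqr_ge0 (cx a - 1); have := sqr_ge0 (cx b + 1).
  by rewrite !sqrrB !sqrrD; have := sqr_ge0 (cx a); have := sqr_ge0 (cx b); nra.
Qed.

Definition strip_spec (sid par : nat -> nat) (tx ty : nat -> R) : Prop :=
  [/\ forall a, (a < n)%N -> 0 <= ty a < 1 /\ par a = odd (sid a),
      forall a b, (a < n)%N -> (b < n)%N -> sid a = sid b ->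
        tx a - tx b = cx a - cx b /\ ty a - ty b = cy a - cy b,
      forall a b, (a < n)%N -> (b < n)%N -> (sid a < sid b)%N -> tx a + 1 < tx b &
      forall a b, (a < n)%N -> (b < n)%N -> (sid a + 2 <= sid b)%N -> cy a + 1 < cy b].

Section StripStep.
Variables (Q : nat -> nat) (w : R).
Hypothesis Q_enum : enumerates n Q.
Hypothesis y_sorted :
  forall p p', (p < p')%N -> (p' < n)%N -> cy (Q p) <= cy (Q p').
Hypothesis w_wide : wide w.

(** The third clause compares the old centres with the base [t] and the shift [sh] of the current
    strip, not with its members, so that a centre that joins the strip inherits the comparisons with
    all earlier strips. *)
Definition strip_inv i (t sh : R) (k : nat) (sid par : nat -> nat) (tx ty : nat -> R) : Prop :=
  [/\ forall p, (i <= p)%N -> (p < n)%N -> t <= cy (Q p),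
      forall p, (p < i)%N -> let a := Q p in
        [/\ 0 <= ty a < 1, par a = odd (sid a) & (sid a <= k)%N],
      forall p, (p < i)%N -> let a := Q p in
        [/\ sid a = k -> tx a = cx a + sh /\ ty a = cy a - t,
            (sid a < k)%N -> cy a < t /\ forall b, (b < n)%N -> tx a + 1 < cx b + sh &
            (sid a + 2 <= k)%N -> cy a + 1 < t],
      forall p p', (p < i)%N -> (p' < i)%N -> sid (Q p) = sid (Q p') ->
        tx (Q p) - tx (Q p') = cx (Q p) - cx (Q p') /\
        ty (Q p) - ty (Q p') = cy (Q p) - cy (Q p') &
      forall p p', (p < i)%N -> (p' < i)%N ->
        ((sid (Q p) < sid (Q p'))%N -> tx (Q p) + 1 < tx (Q p')) /\
        ((sid (Q p) + 2 <= sid (Q p'))%N -> cy (Q p) + 1 < cy (Q p'))].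

Lemma strip_inv_new i t sh k sid par tx ty : (i < n)%N -> t + 1 <= cy (Q i) ->
  strip_inv i t sh k sid par tx ty ->
  strip_inv i (cy (Q i)) (sh + w) k.+1 sid par tx ty.
Proof.
move=> iN le [I1 I2 I3 I4 I5]; have [w3 ww] := w_wide; split=> //.
- move=> p; rewrite leq_eqVlt => /orP[/eqP->//|ip pn]; exact: y_sorted.
- by move=> p pi a; have [h1 h2 h3] := I2 p pi; split=> //; apply: leqW.
move=> p pi a; have [/andP[h1 h1'] h2 h3] := I2 p pi; have [c1 c2 c3] := I3 p pi.
have an : (a < n)%N by apply: Q_enum.1; lia.
split.
- by move=> e; move: h3; rewrite e ltnn.
- rewrite ltnS leq_eqVlt => /orP[/eqP e|lt].
    have [txE tyE] := c1 e; split; first by rewrite tyE in h1'; rewrite /a; lra.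
    by move=> b bn; rewrite txE; have := ww a b an bn; lra.
  have [yl xl] := c2 lt; split; first by rewrite /a; lra.
  by move=> b bn; have := xl b bn; rewrite -/a; lra.
(* A centre two strips below the new one lies strictly below the old base [t], and the new base is
   at least [t + 1]. *)
- move=> lt; have lt' : (sid a < k)%N by lia.
  by have [yl _] := c2 lt'; rewrite /a; lra.
Qed.

Lemma strip_inv_add i t sh k sid par tx ty sid' par' tx' ty' : (i < n)%N ->
  cy (Q i) < t + 1 -> strip_inv i t sh k sid par tx ty ->
  (forall a, sid' a = if a == Q i then k else sid a) ->
  (forall a, par' a = if a == Q i then nat_of_bool (odd k) else par a) ->
  (forall a, tx' a = if a == Q i then cx (Q i) + sh else tx a) ->
  (forall a, ty' a = if a == Q i then cy (Q i) - t else ty a) ->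
  strip_inv i.+1 t sh k sid' par' tx' ty'.
Proof.
move=> iN lt [I1 I2 I3 I4 I5] sE pE xE yE; have [Q_lt Q_inj] := Q_enum.
have ne p : (p < i)%N -> (Q p == Q i) = false.
  by move=> pi; apply/eqP => /Q_inj e; have := e _ iN; lia.
have old p : (p < i)%N -> [/\ sid' (Q p) = sid (Q p), par' (Q p) = par (Q p),
    tx' (Q p) = tx (Q p) & ty' (Q p) = ty (Q p)].
  by move=> pi; rewrite sE pE xE yE ne.
have new : [/\ sid' (Q i) = k, par' (Q i) = odd k, tx' (Q i) = cx (Q i) + sh &
    ty' (Q i) = cy (Q i) - t] by rewrite sE pE xE yE eqxx.
have [ns np nx ny] := new; have ti := I1 i (leqnn i) iN.
have iP p : (p < i.+1)%N -> p = i \/ (p < i)%N by lia.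
split.
- by move=> p ip; apply: I1; lia.
- move=> p /iP[->|pi] /=; first by rewrite ns np ny; split=> //; lra.
  by have [-> -> _ ->] := old p pi; apply: I2.
- move=> p /iP[->|pi] /=.
    by rewrite ns nx ny; split=> //; [rewrite ltnn|lia].
  by have [-> _ -> ->] := old p pi; apply: I3.
- move=> p p' /iP[->|pi] /iP[->|pi'].
  + by rewrite !subrr.
  + have [e1 e2 e3 e4] := old p' pi'; rewrite ns nx ny e1 e3 e4 => e.
    have [h _ _] := I3 p' pi'; have [-> ->] := h (esym e); split; lra.
  + have [e1 e2 e3 e4] := old p pi; rewrite ns nx ny e1 e3 e4 => e.
    have [h _ _] := I3 p pi; have [-> ->] := h e; split; lra.
  + have [-> _ -> ->] := old p pi; have [-> _ -> ->] := old p' pi'; exact: I4.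
- move=> p p' /iP[->|pi] /iP[->|pi'].
  + by rewrite ltnn; split=> //; lia.
  + have [e1 _ e3 _] := old p' pi'; rewrite ns nx e1 e3.
    by have [_ _ le] := I2 p' pi'; split; lia.
  + have [e1 _ e3 _] := old p pi; rewrite ns nx e1 e3.
    have [_ h2 h3] := I3 p pi; split; first by move=> /h2[_]; apply; apply: Q_lt.
    by move=> /h3; lra.
  + have [-> _ -> _] := old p pi; have [-> _ -> _] := old p' pi'; exact: I5.
Qed.

End StripStep.

Definition strip_vars := [:: vi; va; vs; vp].
Local Notation strip_same := (same strip_vars [:: aSID; aPAR] [:: rTX; rTY]).

Lemma strips_ok s0 : enumerates n (ia s0 aQ 0) ->
  (forall p p', (p < p')%N -> (p' < n)%N -> cy (ia s0 aQ 0 p) <= cy (ia s0 aQ 0 p')) ->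
  wide (rv s0 rw) ->
  ok strips (fun s _ => strip_same s0 s /\
    strip_spec (ia s aSID 0) (ia s aPAR 0) (ra s rTX) (ra s rTY)) s0 (n * 1)%N.
Proof.
set Q := ia s0 aQ 0 => Qen ysrt ww; have [Q_lt Q_inj] := Qen.
apply: ok_seq; apply: (@ok_r _ _ _ _ _ _ 0) => //.
apply: ok_seq; apply: (@ok_i _ _ _ _ _ _ 0%N) => //.
apply: ok_seq; apply: (@ok_i _ _ _ _ _ _ 0%N) => //.
apply: ok_seq; apply: (@ok_r _ _ _ _ _ _ (cy (Q 0%N))) => //.
  by rewrite /= n_gt0 Q_lt.
apply: (@ok_for0 _ _ _ _ (fun i s => [/\ strip_same s0 s,
  rv s rw = rv s0 rw, iv s vp = odd (iv s vs) &
  strip_inv Q i (rv s rt) (rv s rs) (iv s vs)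
    (ia s aSID 0) (ia s aPAR 0) (ra s rTX) (ra s rTY)])).
- split=> //=.
    by do ?[exact: same_refl|apply: same_iv => //|apply: same_rv].
  split=> // p; case: p => [|p] _ pn //; exact: ysrt.
- move=> i s iN viE [sm wE vpE inv]; have [svE sqE srE so] := sm.
  have QE : ia s aQ 0 = Q by rewrite sqE.
  apply: ok_seq; apply: (@ok_i _ _ _ _ _ _ (Q i)).
  + by rewrite /= viE iN n_gt0.
  + by rewrite /= viE QE.
  apply: ok_seq; apply: (@ok_conseq _ _ _ _ _ (fun s1 _ => [/\ iv s1 va = Q i, iv s1 vi = i &
    [/\ strip_same s0 s1, rv s1 rw = rv s0 rw, iv s1 vp = odd (iv s1 vs),
    cy (Q i) < rv s1 rt + 1 &
    strip_inv Q i (rv s1 rt) (rv s1 rs) (iv s1 vs)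
      (ia s1 aSID 0) (ia s1 aPAR 0) (ra s1 rTX) (ra s1 rTY)]])).
    apply: ok_if; first by rewrite /= Q_lt.
    rewrite [beval _ _ _ _ _]/=; case: (leP (rv s rt + 1) (cy (Q i))) => lt.
      apply: ok_seq; apply: (@ok_r _ _ _ _ _ _ (cy (Q i))) => //; first by rewrite /= Q_lt.
      apply: ok_seq; apply: (@ok_r _ _ _ _ _ _ (rv s rs + rv s0 rw)) => //; first by rewrite /= wE.
      apply: ok_seq; apply: (@ok_i _ _ _ _ _ _ (iv s vs).+1) => //; first by rewrite /= addn1.
      apply: (@ok_i _ _ _ _ _ _ (odd (iv s vs).+1)) => //.
        by rewrite /= vpE; case: odd.
      split=> //; split=> //=.
      * by do ?[exact: sm|apply: same_iv => //|apply: same_rv].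
      * by lra.
      * exact: (strip_inv_new Qen ysrt ww iN lt inv).
    by apply: ok_skip; split=> //; split=> //; apply: same_iv.
  move=> s1 t1 [va1 vi1 [sm1 w1 vp1 lt inv1]].
  apply: ok_seq; apply: (@ok_rset _ _ _ _ _ _ _ (Q i) (cx (Q i) + rv s1 rs)) => //=.
  + by rewrite va1 Q_lt.
  + by rewrite va1.
  + exact: Q_lt.
  apply: ok_seq; apply: (@ok_rset _ _ _ _ _ _ _ (Q i) (cy (Q i) - rv s1 rt)) => //=.
  + by rewrite va1 Q_lt.
  + by rewrite va1.
  + exact: Q_lt.
  apply: ok_seq; apply: (@ok_set _ _ _ _ _ _ _ _ 0%N (Q i) (iv s1 vs)) => //=.
    by rewrite n_gt0 Q_lt.
  apply: (@ok_set _ _ _ _ _ _ _ _ 0%N (Q i) (odd (iv s1 vs))) => //=.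
    by rewrite n_gt0 Q_lt.
  split=> //; split=> //=.
  + by apply: same_iv => //; do 2 (apply: same_ia => //); do 2 apply: same_ra => //.
  + by apply: (strip_inv_add Qen iN lt inv1).
- move=> s [sm wE vpE [I1 I2 I3 I4 I5]]; split=> //; split.
  + by move=> a /(enumerates_onto Qen)[p pn <-]; have [] := I2 p pn.
  + move=> a b /(enumerates_onto Qen)[p pn <-] /(enumerates_onto Qen)[p' pn' <-].
    exact: I4.
  + move=> a b /(enumerates_onto Qen)[p pn <-] /(enumerates_onto Qen)[p' pn' <-].
    exact: (I5 p p' pn pn').1.
  + move=> a b /(enumerates_onto Qen)[p pn <-] /(enumerates_onto Qen)[p' pn' <-].
    exact: (I5 p p' pn pn').2.
Qed.

End Strips.

(** The three sorts and the sweep share [aQ] and [aC]: the result of each sort is used up or copied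
    before the next initialisation, and the log left in [aC] at the end is that of the sweep. *)
Definition prepare : cmd :=
  sort_by y_lt ;;; width ;;; strips ;;; sort_by (real_lt rTY) ;;; gather ;;;
  sort_by (real_lt rPX) ;;; copy_order ;;; sweep ;;; dp.

Section Prepare.
Variable R : realType.
Variables (n : nat) (cx cy : nat -> R).
Local Notation hst := (hst R).
Local Open Scope nat_scope.
Local Notation ok := (ok n cx cy).
Hypothesis n_gt0 : 0 < n.

Lemma y_lt_cmp s : key_cmp n cx cy cy y_lt s.
Proof. by move=> e1 e2 s1 s2 n1 n2; rewrite /= s1 s2 n1 n2 ltNge. Qed.

Lemma real_lt_cmp q s : q < narr -> key_cmp n cx cy (ra s q) (real_lt q) s.
Proof. by move=> qn e1 e2 s1 s2 n1 n2; rewrite /= qn s1 s2 n1 n2 ltNge. Qed.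

Lemma gather_ok s0 : (forall p, p < n -> ia s0 aQ 0 p < n) ->
  ok gather (fun s _ => [/\ same [:: vi; va] [:: aOID] [:: rPX; rPY] s0 s,
    forall r, r < n -> ia s aOID 0 r = ia s0 aQ 0 r,
    forall r, r < n -> ra s rPX r = ra s0 rTX (ia s0 aQ 0 r) &
    forall r, r < n -> ra s rPY r = ra s0 rTY (ia s0 aQ 0 r)]) s0 (n * 1).
Proof.
move=> Qn.
apply: (@ok_for0 _ _ _ _ (fun i s => [/\ same [:: vi; va] [:: aOID] [:: rPX; rPY] s0 s,
    forall r, r < i -> ia s aOID 0 r = ia s0 aQ 0 r,
    forall r, r < i -> ra s rPX r = ra s0 rTX (ia s0 aQ 0 r) &
    forall r, r < i -> ra s rPY r = ra s0 rTY (ia s0 aQ 0 r)])) => //.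
  by split=> //; apply: same_iv => //; apply: same_refl.
move=> i s iN viE [sm h1 h2 h3]; have [svE sqE srE so] := sm.
set a := ia s0 aQ 0 i; have an : a < n by apply: Qn.
apply: ok_seq; apply: (@ok_i _ _ _ _ _ _ a).
- by rewrite /= viE n_gt0 iN.
- by rewrite /= viE sqE.
apply: ok_seq; apply: (@ok_set _ _ _ _ _ _ _ _ 0 i a) => //=; first by rewrite n_gt0 iN.
apply: ok_seq; apply: (@ok_rset _ _ _ _ _ _ _ i (ra s0 rTX a)) => //=; first by rewrite srE.
apply: (@ok_rset _ _ _ _ _ _ _ i (ra s0 rTY a)) => //=; first by rewrite srE.
split=> //; split=> /=.
- by do ?[exact: sm|apply: same_iv => //|apply: same_ia => //|apply: same_ra => //].
- by move=> r ri; case: eqP => [->//|ne]; apply: h1; lia.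
- by move=> r ri; case: eqP => [->//|ne]; apply: h2; lia.
- by move=> r ri; case: eqP => [->//|ne]; apply: h3; lia.
Qed.

Lemma copy_order_ok s0 :
  ok copy_order (fun s _ => same [:: vi] [:: aXO] [::] s0 s /\
    forall r, r < n -> ia s aXO 0 r = ia s0 aQ 0 r) s0 (n * 1).
Proof.
apply: (@ok_for0 _ _ _ _ (fun i s => same [:: vi] [:: aXO] [::] s0 s /\
    forall r, r < i -> ia s aXO 0 r = ia s0 aQ 0 r)) => //.
  by split=> //; apply: same_iv => //; apply: same_refl.
move=> i s iN viE [sm h]; have [svE sqE srE so] := sm.
apply: (@ok_set _ _ _ _ _ _ _ _ 0 i (ia s0 aQ 0 i)) => /=.
- by rewrite viE n_gt0 iN.
- by [].
- by [].
- by rewrite viE sqE.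
- by rewrite n_gt0 iN.
split=> //; split=> /=.
- by do ?[exact: sm|apply: same_iv => //|apply: same_ia => //].
- by move=> r ri; case: eqP => [->//|ne]; apply: h; lia.
Qed.

(** The program stores the order [xo] only; the rank [xpos] exists in the specification. *)
Definition inverse_orders (xo xpos : nat -> nat) : Prop :=
  [/\ forall p, p < n -> xo p < n, forall a, a < n -> xo (xpos a) = a,
      forall p, p < n -> xpos (xo p) = p & forall a, a < n -> xpos a < n].

Lemma enumerates_inverse Q : enumerates n Q -> exists xpos, inverse_orders Q xpos.
Proof.
move=> en; have [Qn Qinj] := en; exists (fun a => index a (mkseq Q n)).
have mem a : a < n -> a \in mkseq Q n.
  move=> /(enumerates_onto en)[p pn <-]; apply/mapP; exists p => //.
  by rewrite mem_iota.
have lt a : a < n -> index a (mkseq Q n) < n.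
  by move=> an; have := mem a an; rewrite -index_mem size_mkseq.
have K a : a < n -> Q (index a (mkseq Q n)) = a.
  by move=> an; rewrite -(nth_mkseq 0 Q (lt a an)) nth_index ?mem.
by split=> // p pn; apply: Qinj; rewrite ?K ?lt ?Qn.
Qed.

Definition prepared (s : hst) : Prop := exists xpos,
  [/\ enumerates n (ia s aOID 0),
      strip_spec n cx cy (ia s aSID 0) (ia s aPAR 0) (ra s rTX) (ra s rTY),
      forall r, r < n -> ra s rPX r = ra s rTX (ia s aOID 0 r) /\
                         ra s rPY r = ra s rTY (ia s aOID 0 r),
      (forall a b, a < n -> b < n -> before xpos a b -> (ra s rPX a <= ra s rPX b)%R) /\
      inverse_orders (ia s aXO 0) xpos &
      dp_inv n (ra s rPX) (ra s rPY) xpos n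
        (ia s aF 0) (ia s aD) (ia s aW) (ia s aPRV 0)].

Definition prepare_time :=
  sort_time n + (n * 1 + (n * 1 + (sort_time n + (n * 1 + (sort_time n +
  (n * 1 + (sweep_time n + dp_time n))))))).

Lemma prepare_ok :
  ok prepare (fun s _ => prepared s /\ ia s aSEL = fun _ _ => 0) (hst0 R) prepare_time.
Proof.
set s0 := hst0 R.
apply: ok_seq_post (sort_by_ok n_gt0 (fun s _ => @y_lt_cmp s)) _.
move=> s1 [sm1 en1 srt1].
apply: ok_seq_post (width_ok n cx cy s1) _ => s2 [sm2 ww2].
have [v2 q2 r2 eo2] := sm2; have Q2 : ia s2 aQ 0 = ia s1 aQ 0 by rewrite q2.
rewrite -Q2 in en1 srt1.
apply: ok_seq_post (strips_ok n_gt0 en1 srt1 ww2) _ => s3 [sm3 spec3].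
apply: (@ok_seq_post _ _ _ _ _ _ (fun s => [/\ same_sweep s3 s, enumerates n (ia s aQ 0) &
    forall p p', p < p' -> p' < n -> (ra s3 rTY (ia s aQ 0 p) <= ra s3 rTY (ia s aQ 0 p'))%R])).
  apply: sort_by_ok => // s [_ _ rE _]; rewrite -(rE rTY) //.
  exact: real_lt_cmp.
move=> s4 [sm4 en4 srt4].
apply: ok_seq_post (gather_ok en4.1) _ => s5 [sm5 oid5 px5 py5].
apply: (@ok_seq_post _ _ _ _ _ _ (fun s => [/\ same_sweep s5 s, enumerates n (ia s aQ 0) &
    forall p p', p < p' -> p' < n -> (ra s5 rPX (ia s aQ 0 p) <= ra s5 rPX (ia s aQ 0 p'))%R])).
  apply: sort_by_ok => // s [_ _ rE _]; rewrite -(rE rPX) //.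
  exact: real_lt_cmp.
move=> s6 [sm6 en6 srt6].
apply: ok_seq_post (copy_order_ok s6) _ => s7 [sm7 xo7].
have [v3 q3 r3 eo3] := sm3; have [v4 q4 r4 eo4] := sm4; have [v5 q5 r5 eo5] := sm5.
have [v6 q6 r6 eo6] := sm6; have [v7 q7 r7 eo7] := sm7.
set tx := ra s3 rTX in spec3; set ty := ra s3 rTY in spec3 srt4.
set oid := ia s5 aOID 0 in oid5.
have oid_en : enumerates n oid.
  split=> [p pn|p p' pn pn']; rewrite !oid5 //; first exact: en4.1.
  exact: en4.2.
have pxE r : r < n -> ra s7 rPX r = tx (oid r).
  by move=> rn; rewrite r7 // r6 // px5 // r4 // oid5.
have pyE r : r < n -> ra s7 rPY r = ty (oid r).
  by move=> rn; rewrite r7 // r6 // py5 // r4 // oid5.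
have [spec_ty _ _ _] := spec3.
have height7 a b : a < n -> b < n -> (`|ra s7 rPY a - ra s7 rPY b| < 1)%R.
  move=> an bn; rewrite !pyE // ltr_norml.
  have [/andP[h1 h2] _] := spec_ty _ (oid_en.1 a an).
  have [/andP[h3 h4] _] := spec_ty _ (oid_en.1 b bn).
  by apply/andP; split; lra.
have ysrt7 a b : a <= b -> b < n -> (ra s7 rPY a <= ra s7 rPY b)%R.
  rewrite leq_eqVlt => /orP[/eqP->//|ab] bn; rewrite !pyE //; last exact: ltn_trans bn.
  by rewrite !oid5 //; [apply: srt4|apply: ltn_trans bn].
have xo_en : enumerates n (ia s7 aXO 0).
  split=> [p pn|p p' pn pn']; rewrite !xo7 //; first exact: en6.1.
  exact: en6.2.
have xsrt7 p p' : p < p' -> p' < n -> (ra s7 rPX (ia s7 aXO 0 p) <= ra s7 rPX (ia s7 aXO 0 p'))%R.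
  move=> pp pn'; rewrite !xo7 //; last exact: ltn_trans pn'.
  by rewrite r7 // r6 //; apply: srt6.
apply: ok_seq_post (sweep_ok cx cy n_gt0 height7 ysrt7) _ => s8 [sm8 cross8].
have [v8 q8 r8 eo8] := sm8.
have [xpos inv] := enumerates_inverse xo_en; have [xo_lt xposK xoK xpos_lt] := inv.
have xsorted a b : a < n -> b < n -> before xpos a b -> (ra s7 rPX a <= ra s7 rPX b)%R.
  move=> an bn ab; rewrite -(xposK a an) -(xposK b bn).
  by apply: xsrt7 => //; apply: xpos_lt.
have inp8 : dp_input (ra s7 rPX) (ra s7 rPY) (ia s8 aC) (ia s7 aXO 0) s8.
  by split; [rewrite r8|rewrite r8| |rewrite q8].
(* Arrays not yet written hold the initial zeros: [aF] marks every centre as untreated, the cells of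
   the stack are valid indices, and [aSEL] selects nothing. *)
have zero q : q \notin [:: aQ; aC; aSID; aPAR; aOID; aXO] -> ia s8 q = fun _ _ => 0.
  rewrite !inE !negb_or => /and5P[h1 h2 h3 h4 /andP[h5 h6]].
  have [_ q1 _ _] := sm1.
  rewrite q8 ?inE ?negb_or ?h1 // q7 ?inE // q6 ?inE ?negb_or ?h1 // q5 ?inE //.
  by rewrite q4 ?inE ?negb_or ?h1 // q3 ?inE ?negb_or ?h3 // q2 // q1 ?inE ?negb_or ?h1.
apply: ok_conseq.
  apply: (dp_ok cx cy n_gt0 height7 xsorted xo_lt xposK xoK cross8 inp8).
  - by move=> i _; rewrite zero.
  - by move=> i _; rewrite zero.
move=> s9 t9 [sm9 inv9]; have [v9 q9 r9 eo9] := sm9.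
split; last by rewrite q9 // zero.
exists xpos; split.
- by rewrite q9 // q8 // q7 // q6.
- rewrite !r9 // !r8 // !r7 // !r6 // !r5 // !r4 //.
  by rewrite !q9 // !q8 // !q7 // !q6 // !q5 // !q4.
- move=> r rn; rewrite !r9 // !r8 // pxE // pyE //.
  by rewrite !q9 // !q8 // !q7 // !q6 // !r7 // !r6 // !r5 // !r4.
- split; last by rewrite q9 // q8.
  by move=> a b an bn ab; rewrite r9 // r8 //; apply: xsorted.
- by rewrite !r9 // !r8.
Qed.

End Prepare.

(** * Extraction of the answer *)

Definition select_best : cmd :=
  CI vbest (EC 0) ;;; CI vk (EC 0) ;;;
  CFor vi
    (CIf (BLe (EAdd (EV vbest) (EC 1)) (aget aF (EV vi)))
       (CI vbest (aget aF (EV vi)) ;;; CI vk (EV vi)) CSkip).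

(** With [aD = 0], the centre [va] is the one that [chain_push] drops: it is not selected, yet the
    trace continues through it, because the rest of the chain is that of an optimal chain ending in
    [va], [j]. *)
Definition backtrack : cmd :=
  aset aSEL (EV vk) (EC 1) ;;;
  CIf (BLe (EC 2) (aget aF (EV vk)))
    (CI vj (aget aPRV (EV vk)) ;;; aset aSEL (EV vj) (EC 1) ;;;
     CWhile (BLe (EC 2) (aget aF (EV vj)))
       (CI va (EGet aW (EV vj) (EV vk)) ;;;
        aset aSEL (EV va) (EGet aD (EV vj) (EV vk)) ;;;
        CI vk (EV vj) ;;; CI vj (EV va)))
    CSkip.

Definition parity_at e := aget aPAR (aget aOID e).

Definition count_parities : cmd :=
  CI vs (EC 0) ;;; CI vp (EC 0) ;;;
  CFor vi
    (CIf (BLe (EC 1) (aget aSEL (EV vi)))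
       (CIf (BLe (EC 1) (parity_at (EV vi)))
          (CI vp (EAdd (EV vp) (EC 1))) (CI vs (EAdd (EV vs) (EC 1))))
       CSkip).

Definition emit : cmd :=
  CIf (BLe (EV vs) (EV vp)) (CI vb (EC 1)) (CI vb (EC 0)) ;;;
  CFor vi
    (CI va (aget aOID (EV vi)) ;;;
     CIf (BAnd (BLe (EC 1) (aget aSEL (EV vi)))
            (BAnd (BLe (aget aPAR (EV va)) (EV vb)) (BLe (EV vb) (aget aPAR (EV va)))))
       (COut (EV va) (EC 1)) (COut (EV va) (EC 0))).

Definition finish : cmd := select_best ;;; backtrack ;;; count_parities ;;; emit.

Section Finish.
Variable R : realType.
Variables (n : nat) (cx cy : nat -> R).
Local Notation hst := (hst R).
Local Open Scope nat_scope.
Local Notation ok := (ok n cx cy).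
Hypothesis n_gt0 : 0 < n.

Lemma select_best_ok s0 : (forall i, i < n -> 0 < ia s0 aF 0 i) ->
  ok select_best (fun s _ => [/\ same [:: vi; vk; vbest] [::] [::] s0 s, iv s vk < n &
    forall i, i < n -> ia s0 aF 0 i <= ia s0 aF 0 (iv s vk)]) s0 (n * 1).
Proof.
move=> F0; apply: ok_seq; apply: (@ok_i _ _ _ _ _ _ 0) => //.
apply: ok_seq; apply: (@ok_i _ _ _ _ _ _ 0) => //.
apply: (@ok_for0 _ _ _ _ (fun i s => [/\ same [:: vi; vk; vbest] [::] [::] s0 s, iv s vk < n,
    forall i', i' < i -> ia s0 aF 0 i' <= iv s vbest &
    iv s vbest <= ia s0 aF 0 (iv s vk)])).
- by split=> //; do ?[exact: same_refl|apply: same_iv => //].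
- move=> i s iN viE [sm kn up le]; have [svE sqE _ _] := sm.
  apply: ok_if; first by rewrite /= viE n_gt0 iN.
  rewrite [beval _ _ _ _ _]/= viE sqE // addn1; case: ifP => lt.
    apply: ok_seq; apply: (@ok_i _ _ _ _ _ _ (ia s0 aF 0 i)).
    + by rewrite /= viE n_gt0 iN.
    + by rewrite /= viE sqE.
    apply: (@ok_i _ _ _ _ _ _ i) => //; split=> //; split=> //=.
      by do ?[exact: sm|apply: same_iv => //].
    move=> i'; rewrite ltnS leq_eqVlt => /orP[/eqP-> //|/up]; lia.
  apply: ok_skip; split=> //; split=> //=; first exact: same_iv.
  move=> i'; rewrite ltnS leq_eqVlt => /orP[/eqP->|/up //]; lia.
- move=> s [sm kn up le]; split=> // i iN; exact: leq_trans (up i iN) le.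
Qed.

Section Backtrack.
Variables (px py : nat -> R) (xpos : nat -> nat).
Hypothesis height : forall a b, a < n -> b < n -> (`|py a - py b| < 1)%R.
Hypothesis xsorted :
  forall a b, a < n -> b < n -> before xpos a b -> (px a <= px b)%R.
Hypothesis xpos_lt : forall a, a < n -> xpos a < n.
Local Notation far := (far px py).
Local Notation before := (before xpos).
Local Notation chain := (chain n px py xpos).

Lemma backtrack_ok s0 k v : iv s0 vk = k -> k < n -> ia s0 aF 0 k = v ->
  ia s0 aSEL = (fun _ _ => 0) ->
  dp_inv n px py xpos n (ia s0 aF 0) (ia s0 aD) (ia s0 aW) (ia s0 aPRV 0) ->
  ok backtrack (fun s _ => same [:: vk; vj; va] [:: aSEL] [::] s0 s /\
    exists l, [/\ chain l, size l = v & forall r, r < n -> ia s aSEL 0 r = (r \in l)])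
  s0 n.
Proof.
set F := ia s0 aF 0; set D := ia s0 aD; set W := ia s0 aW.
move=> vkE kn Fk sel0 [I1 I2 I3 I4 I5].
have F_gt0 i : i < n -> 0 < F i by move=> iN; rewrite I1 // xpos_lt.
apply: ok_seq; apply: (@ok_set _ _ _ _ _ _ _ _ 0 k 1) => //=; first by rewrite n_gt0 kn.
set s1 := set_ia s0 aSEL 0 k 1.
have sm1 : same [:: vk; vj; va] [:: aSEL] [::] s0 s1.
  by apply: same_ia => //; apply: same_refl.
apply: ok_if; first by rewrite /= vkE n_gt0 kn.
rewrite [beval _ _ _ _ _]/= vkE -/F Fk.
case: ifP => v2; last first.
  apply: ok_skip; split=> //; exists [:: k]; split.
  - by rewrite chain_cons kn.
  - by have := F_gt0 k kn; rewrite /= Fk; lia.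
  - by move=> r rn /=; rewrite inE sel0; case: eqP.
have [] := I5 k kn (xpos_lt kn); first by rewrite Fk.
set j := ia s0 aPRV 0 k => jn bjk fjk FE.
apply: ok_seq; apply: (@ok_i _ _ _ _ _ _ j) => //=; first by rewrite vkE n_gt0 kn.
  by rewrite vkE.
apply: ok_seq; apply: (@ok_set _ _ _ _ _ _ _ _ 0 j 1) => //=; first by rewrite n_gt0 jn.
(* [tl] is the part already selected, from right to left. Its completion is unknown, so the
   invariant holds for any optimal [l] to the left of the current pair. As [j] moves left, [xpos j]
   bounds the iterations that remain. *)
apply: (@ok_while _ _ _ _ (fun s t => exists j k tl,
  [/\ same [:: vk; vj; va] [:: aSEL] [::] s0 s, [/\ iv s vj = j, iv s vk = k, j < n & k < n],
      [/\ before j k, far j k & xpos j <= t],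
      (forall r, r < n -> ia s aSEL 0 r = (r \in tl)) /\
      (forall x, x \in tl -> xpos j <= xpos x) &
      forall l, chain (k :: j :: l) -> size (k :: j :: l) = F j + D j k ->
        chain (tl ++ l) /\ size (tl ++ l) = v])).
- exists j, k, [:: k; j]; split.
  + by do ?[exact: sm1|apply: same_iv => //|apply: same_ia => //].
  + by [].
  + by split=> //; apply/ltnW/xpos_lt.
  + split=> [r rn|x]; first by rewrite /= !inE sel0; do 2 case: eqP.
    by rewrite !inE => /orP[]/eqP->; rewrite // ltnW.
  + by move=> l cl sl; split=> //; rewrite -Fk -FE.
- by move=> s t [j1 [k1 [tl [_ [vjE _ j1n _] _ _ _]]]]; rewrite /= vjE n_gt0 j1n.
- move=> s t [j1 [k1 [tl [sm [vjE vkE' j1n k1n] [bjk1 fjk1 xt] [selE tlx] ext]]]].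
  have [svE sqE _ _] := sm; rewrite /= vjE sqE // -/F => Fj.
  have [Dle _ /(_ Fj)[[iN bij fij Ei] Df]] := I4 j1 k1 j1n k1n (xpos_lt j1n) bjk1 fjk1.
  set i := W j1 k1 in iN bij fij Ei Df.
  have xi : xpos i < xpos j1 by [].
  exists t.-1; first by rewrite prednK //; lia.
  apply: ok_seq; apply: (@ok_i _ _ _ _ _ _ i).
  + by rewrite /= vjE vkE' j1n k1n.
  + by rewrite /= vjE vkE' sqE.
  apply: ok_seq; apply: (@ok_set _ _ _ _ _ _ _ _ 0 i (D j1 k1)) => //=.
  + by rewrite vjE vkE' j1n k1n.
  + by rewrite vjE vkE' sqE.
  + by rewrite n_gt0 iN.
  apply: ok_seq; apply: (@ok_i _ _ _ _ _ _ j1) => //.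
  apply: (@ok_i _ _ _ _ _ _ i) => //.
  have itl : i \notin tl by apply/negP => /tlx; lia.
  have same' s' : s' = set_iv (set_iv (set_ia (set_iv s va i) aSEL 0 i (D j1 k1)) vk j1) vj i ->
     same [:: vk; vj; va] [:: aSEL] [::] s0 s'.
    by move=> ->; do ?[exact: sm|apply: same_iv => //|apply: same_ia => //].
  case: (posnP (D j1 k1)) => D0.
    exists i, j1, tl; split.
    * exact: same'.
    * by [].
    * by split=> //; lia.
    * split=> [r rn /=|x /tlx]; last by lia.
      by rewrite D0 selE //; case: eqP => // ->; rewrite (negbTE itl).
    * move=> l cl sl; apply: ext.
        exact: (chain_push height xsorted k1n bjk1 fjk1 cl).
      by rewrite D0 addn0 -Ei -sl.
  have D1 : D j1 k1 = 1 by lia.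
  exists i, j1, (rcons tl i); split.
  * exact: same'.
  * by [].
  * by split=> //; lia.
  * split=> [r rn /=|x]; last by rewrite mem_rcons inE => /orP[/eqP->//|/tlx]; lia.
    by rewrite D1 selE // mem_rcons inE; case: eqP.
  * move=> l cl sl; rewrite -cats1 -catA; apply: ext.
      exact: (chain_push2 height xsorted k1n bjk1 fjk1 (Df D1) cl).
    by rewrite D1 addn1 -Ei -sl.
- move=> s t [j1 [k1 [tl [sm [vjE vkE' j1n k1n] [bjk1 fjk1 xt] [selE tlx] ext]]]].
  have [svE sqE _ _] := sm; rewrite /= vjE sqE // -/F -ltnNge => Fj.
  have F1 : F j1 = 1 by have := F_gt0 j1 j1n; lia.
  have [_ /(_ F1) D1 _] := I4 j1 k1 j1n k1n (xpos_lt j1n) bjk1 fjk1.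
  have [||c sz] := ext [::].
  + by rewrite !chain_cons k1n j1n /= bjk1 fjk1.
  + by rewrite F1 D1.
  by split=> //; exists tl; rewrite cats0 in c sz; split.
Qed.

End Backtrack.

Local Notation par_of s r := (ia s aPAR 0 (ia s aOID 0 r)).

Lemma count_parities_ok s0 : (forall r, r < n -> ia s0 aOID 0 r < n) ->
  ok count_parities (fun s _ => [/\ same [:: vi; vs; vp] [::] [::] s0 s,
    iv s vs = \sum_(r < n) ((0 < ia s0 aSEL 0 r) && (par_of s0 r == 0)) &
    iv s vp = \sum_(r < n) ((0 < ia s0 aSEL 0 r) && (par_of s0 r != 0))]) s0 (n * 1).
Proof.
move=> oid_lt; apply: ok_seq; apply: (@ok_i _ _ _ _ _ _ 0) => //.
apply: ok_seq; apply: (@ok_i _ _ _ _ _ _ 0) => //.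
apply: (@ok_for0 _ _ _ _ (fun i s => [/\ same [:: vi; vs; vp] [::] [::] s0 s,
    iv s vs = \sum_(r < i) ((0 < ia s0 aSEL 0 r) && (par_of s0 r == 0)) &
    iv s vp = \sum_(r < i) ((0 < ia s0 aSEL 0 r) && (par_of s0 r != 0))])) => //.
  by split; rewrite ?big_ord0 //; do ?[exact: same_refl|apply: same_iv => //].
move=> i s iN viE [sm vsE vpE]; have [svE sqE _ _] := sm.
apply: ok_if; first by rewrite /= viE n_gt0 iN.
rewrite [beval _ _ _ _ _]/= viE sqE //; case: ifP => sel; last first.
  apply: ok_skip; split=> //; split=> /=; first exact: same_iv.
  - by rewrite big_ord_recr /= sel addn0.
  - by rewrite big_ord_recr /= sel addn0.
apply: ok_if; first by rewrite /= viE n_gt0 iN !sqE // oid_lt.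
rewrite [beval _ _ _ _ _]/= viE !sqE // lt0n; case: ifP => odd_i.
  apply: (@ok_i _ _ _ _ _ _ (iv s vp + 1)) => //; split=> //; split=> /=.
  - by do ?[exact: sm|apply: same_iv => //].
  - by rewrite big_ord_recr /= sel vsE (negbTE odd_i) addn0.
  - by rewrite big_ord_recr /= sel vpE odd_i.
apply: (@ok_i _ _ _ _ _ _ (iv s vs + 1)) => //; split=> //; split=> /=.
- by do ?[exact: sm|apply: same_iv => //].
- by rewrite big_ord_recr /= sel vsE (negbFE odd_i).
- by rewrite big_ord_recr /= sel vpE odd_i addn0.
Qed.

Lemma emit_ok s0 : enumerates n (ia s0 aOID 0) ->
  ok emit (fun s _ => forall r, r < n ->
    out s (ia s0 aOID 0 r) =
    (0 < ia s0 aSEL 0 r) && (par_of s0 r == nat_of_bool (iv s0 vs <= iv s0 vp))) s0 (n * 1).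
Proof.
move=> [oid_lt oid_inj]; set b := nat_of_bool _.
apply: ok_seq; apply: (@ok_conseq _ _ _ _ _ (fun s t =>
  same [:: vb] [::] [::] s0 s /\ iv s vb = b /\ t = n * 1)).
  apply: ok_if => //; rewrite /b [beval _ _ _ _ _]/=; case: ifP => _.
    by apply: (@ok_i _ _ _ _ _ _ 1) => //; split=> //; apply: same_iv => //; apply: same_refl.
  by apply: (@ok_i _ _ _ _ _ _ 0) => //; split=> //; apply: same_iv => //; apply: same_refl.
move=> s1 t1 [sm1 [vb1 ->]]; have [_ q1 _ _] := sm1.
apply: (@ok_for0 _ _ _ _ (fun i s => [/\ forall q, ia s q = ia s0 q, iv s vb = b &
  forall r, r < i -> out s (ia s0 aOID 0 r) =
    (0 < ia s0 aSEL 0 r) && (par_of s0 r == b)])) => //.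
- by split=> // q; rewrite /= q1.
- move=> i s iN viE [sq vbE h]; set a := ia s0 aOID 0 i.
  have an : a < n by apply: oid_lt.
  apply: ok_seq; apply: (@ok_i _ _ _ _ _ _ a).
  + by rewrite /= viE n_gt0 iN.
  + by rewrite /= viE sq.
  have fin x : x = nat_of_bool ((0 < ia s0 aSEL 0 i) && (ia s0 aPAR 0 a == b)) ->
    let s' := set_out (set_iv s va a) a x in
    iv s' vi = i /\ [/\ forall q, ia (set_iv s' vi i.+1) q = ia s0 q, iv s' vb = b &
      forall r, r < i.+1 -> out s' (ia s0 aOID 0 r) =
        (0 < ia s0 aSEL 0 r) && (par_of s0 r == b)].
    move=> -> s'; split=> //; split=> //= r.
    rewrite ltnS leq_eqVlt => /orP[/eqP->|ri]; first by rewrite eqxx.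
    case: eqP => [/oid_inj e|_]; last exact: h.
    by have := e (ltn_trans ri iN) iN; lia.
  apply: ok_if; first by rewrite /= viE n_gt0 iN an !implybT.
  rewrite [beval _ _ _ _ _]/= viE vbE !sq -eqn_leq.
  case: ifP => c.
    by apply: (@ok_out _ _ _ _ _ _ a 1) => //; apply: fin; rewrite c.
  by apply: (@ok_out _ _ _ _ _ _ a 0) => //; apply: fin; rewrite c.
- by move=> s [].
Qed.

End Finish.

(** * Correctness and complexity *)

Section ChainSets.
Variables (R : realType) (n : nat) (px py : nat -> R) (xpos : nat -> nat).
Local Notation chain := (chain n px py xpos).

Lemma far_sym a b : far px py a b = far px py b a.
Proof. by rewrite /far -[px a - px b]opprB -[py a - py b]opprB !sqrrN. Qed.

Lemma chain_far l x y : chain l -> x \in l -> y \in l -> x != y -> far px py x y.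
Proof.
elim: l => // k l IH; rewrite chain_cons => /and3P[_ /allP kl cl].
rewrite !inE => /orP[/eqP->|xl] /orP[/eqP->|yl] ne; last exact: IH.
- by rewrite eqxx in ne.
- by have /andP[_] := kl y yl; rewrite far_sym.
- by have /andP[_] := kl x xl.
Qed.

Lemma chain_uniq l : chain l -> uniq l.
Proof.
elim: l => //= k l IH; rewrite chain_cons => /and3P[_ /allP kl cl].
rewrite IH // andbT; apply/negP => /kl/andP[].
by rewrite /before ltnn.
Qed.

Lemma chain_all_lt l x : chain l -> x \in l -> (x < n)%N.
Proof. by case/andP=> /allP h _ /h. Qed.

Hypothesis xpos_inj : forall a b, (a < n)%N -> (b < n)%N -> xpos a = xpos b -> a = b.

Lemma chain_of_far l : uniq l -> {in l, forall x, (x < n)%N} ->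
  {in l &, forall x y, x != y -> far px py x y} ->
  exists2 l', chain l' & size l' = size l.
Proof.
move=> ul ln lf; pose leT b a := (xpos a <= xpos b)%N.
exists (sort leT l); last by rewrite size_sort.
have leT_total : total leT by move=> a b; apply: leq_total.
have leT_trans : transitive leT by move=> b a d h1 h2; apply: leq_trans h2 h1.
apply/andP; split; first by apply/allP => x; rewrite mem_sort => /ln.
have : pairwise leT (sort leT l).
  by rewrite -sorted_pairwise // sort_sorted.
have : uniq (sort leT l) by rewrite sort_uniq.
have sub : {subset sort leT l <= l} by move=> x; rewrite mem_sort.
elim: (sort leT l) sub => //= k s IH sub /andP[ks us] /andP[/allP ks' ps].
rewrite IH ?us //; last by move=> x xs; apply: sub; rewrite inE xs orbT.
rewrite andbT; apply/allP => x xs.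
have xl : x \in l by apply: sub; rewrite inE xs orbT.
have kl : k \in l by apply: sub; rewrite inE eqxx.
have ne : x != k by apply/eqP => e; rewrite -e xs in ks.
rewrite lf // andbT /before ltn_neqAle [(_ <= _)%N]ks' // andbT.
by apply/eqP => /xpos_inj e; move: ne; rewrite e ?eqxx // ln.
Qed.

End ChainSets.

(** The midpoint of two close centres lies in both disks. Conversely, a common point at distance at
    most one half from both gives the bound by the parallelogram law. *)
Lemma udgP (R : realType) (n : nat) (c : 'I_n -> R * R) (i j : 'I_n) :
  udg c i j = (i != j) && (((c i).1 - (c j).1) ^+ 2 + ((c i).2 - (c j).2) ^+ 2 <= 1).
Proof.
rewrite /udg; congr (_ && _); move: (c i) (c j) => [a1 a2] [b1 b2] /=.
have sq (x y x' y' : R) : (eucl_dist (x, y) (x', y') <= 2^-1) =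
    ((x - x') ^+ 2 + (y - y') ^+ 2 <= 4^-1).
  rewrite /eucl_dist /= -{1}[2^-1]ger0_norm ?invr_ge0 // -sqrtr_sqr ler_psqrt.
  - by rewrite exprVn; congr (_ <= _^-1); ring.
  - by rewrite nnegrE addr_ge0 ?sqr_ge0.
  - by rewrite nnegrE sqr_ge0.
apply/asboolP/idP => [[[q1 q2] [/=]]|le].
  rewrite /unit_disk /= !sq => h1 h2.
  have := sqr_ge0 ((a1 - q1) + (b1 - q1)); have := sqr_ge0 ((a2 - q2) + (b2 - q2)).
  nra.
have e4 : (2 : R) ^+ 2 = 4 by ring.
exists ((a1 + b1) / 2, (a2 + b2) / 2); split; rewrite /unit_disk /= sq.
  have -> : a1 - (a1 + b1) / 2 = (a1 - b1) / 2 by field.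
  have -> : a2 - (a2 + b2) / 2 = (a2 - b2) / 2 by field.
  by rewrite !expr_div_n -mulrDl e4; lra.
have -> : b1 - (a1 + b1) / 2 = - ((a1 - b1) / 2) by field.
have -> : b2 - (a2 + b2) / 2 = - ((a2 - b2) / 2) by field.
by rewrite !sqrrN !expr_div_n -mulrDl e4; lra.
Qed.

(** At [n = 0] the bound [K * n ^ 2] vanishes, while the running time does not; hence the
    restriction to positive [n]. *)
Lemma natr_bigO_sqr (R : realType) (f : nat -> nat) (K : nat) :
  (forall n, (0 < n)%N -> (f n <= K * n ^ 2)%N) ->
  (fun n : nat => (f n)%:R : R) =O_\oo (fun n : nat => n%:R ^+ 2 : R).
Proof.
move=> h; apply/eqOP; exists K%:R; split; first exact: realn.
move=> k Kk; exists 1%N => // n /= n1.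
rewrite !ger0_norm ?exprn_ge0 // -natrX.
apply: le_trans (_ : (K * n ^ 2)%:R <= _); first by rewrite ler_nat h.
by rewrite natrM ler_wpM2r // ltW.
Qed.

Section StripFar.
Variables (R : realType) (n : nat) (cx cy tx ty : nat -> R) (sid par : nat -> nat).
Hypothesis spec : strip_spec n cx cy sid par tx ty.

Lemma far_of_dx (x y : nat -> R) a b : x a + 1 < x b -> far x y a b.
Proof. by move=> h; rewrite /far; have := sqr_ge0 (y a - y b); nra. Qed.

Lemma far_of_dy (x y : nat -> R) a b : y a + 1 < y b -> far x y a b.
Proof. by move=> h; rewrite /far; have := sqr_ge0 (x a - x b); nra. Qed.

Lemma strip_far_eq a b : (a < n)%N -> (b < n)%N -> sid a = sid b ->
  far tx ty a b = far cx cy a b.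
Proof.
by move=> an bn e; have [_ h _ _] := spec; rewrite /far; have [-> ->] := h a b an bn e.
Qed.

Lemma strip_far_neq a b : (a < n)%N -> (b < n)%N -> sid a != sid b -> far tx ty a b.
Proof.
move=> an bn; have [_ _ h _] := spec; rewrite neq_ltn => /orP[lt|lt].
  by apply: far_of_dx; apply: h.
by rewrite far_sym; apply: far_of_dx; apply: h.
Qed.

Lemma strip_far_parity a b : (a < n)%N -> (b < n)%N -> par a = par b ->
  far tx ty a b -> far cx cy a b.
Proof.
move=> an bn pE; case: (eqVneq (sid a) (sid b)) => [e|ne].
  by rewrite strip_far_eq.
have [h _ _ h4] := spec; have [_ pa] := h a an; have [_ pb] := h b bn.
have oE : odd (sid a) = odd (sid b) by move: pE; rewrite pa pb; do 2 case: odd.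
move: ne; rewrite neq_ltn => /orP[lt|lt] _.
  by apply: far_of_dy; apply: h4 => //; move: oE; lia.
by rewrite far_sym; apply: far_of_dy; apply: h4 => //; move: oE; lia.
Qed.

End StripFar.

Lemma size_sum_mem (n : nat) (l : seq nat) : uniq l -> {in l, forall x, (x < n)%N} ->
  size l = (\sum_(r < n) (nat_of_ord r \in l))%N.
Proof.
move=> ul ln; have /perm_size-> : perm_eq l [seq x <- iota 0 n | x \in l].
  apply: uniq_perm => //; first by rewrite filter_uniq ?iota_uniq.
  move=> x; rewrite mem_filter mem_iota /=.
  by case xl: (x \in l) => //=; rewrite (ln _ xl).
rewrite size_filter -sum1_count big_mkcond /= -[X in iota 0 X]subn0 -/(index_iota 0 n).
by rewrite big_mkord; apply: eq_bigr => i _; case: (_ \in l).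
Qed.

(** * The approximation factor *)

Section Answer.
Variables (R : realType) (n : nat) (c : 'I_n -> R * R).
Hypothesis n_gt0 : (0 < n)%N.
Local Notation cx := (coord_x c).
Local Notation cy := (coord_y c).

Lemma far_coord (i j : 'I_n) : udg c i j = (i != j) && ~~ far cx cy i j.
Proof.
by rewrite udgP /far /coord_x /coord_y !valK /= -leNgt.
Qed.

Definition answered (o : nat -> nat) : Prop :=
  let S := [set i : 'I_n | o i != 0%N]%SET in
  independent (udg c) S /\
  forall OPT : {set 'I_n}, independent (udg c) OPT -> (#|OPT| <= 2 * #|S|)%N.

Lemma card_sum_perm (f : 'I_n -> 'I_n) (S : {set 'I_n}) : injective f ->
  #|S| = (\sum_(r < n) (f r \in S))%N.
Proof.
move=> fi; rewrite -sum1_card big_mkcond (reindex_inj fi) /=.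
by apply: eq_bigr => i _; case: (_ \in S).
Qed.

(** Moving the strips apart keeps an independent set far, so the optimum is at most [v]; the more
    frequent parity in [l] retains at least half of [v]. Within one parity, far after the move
    implies far before it. *)
Lemma answered_of xpos l v (oid : nat -> nat) (o : nat -> nat)
  (b : bool) (F : nat -> nat) (px py : nat -> R) tx ty sid par :
  enumerates n oid -> strip_spec n cx cy sid par tx ty ->
  (forall r, (r < n)%N -> px r = tx (oid r) /\ py r = ty (oid r)) ->
  (forall a a', (a < n)%N -> (a' < n)%N -> xpos a = xpos a' -> a = a') ->
  (forall i, (i < n)%N -> best1 n px py xpos i (F i)) ->
  (forall i, (i < n)%N -> (F i <= v)%N) ->
  chain n px py xpos l -> size l = v ->
  b = (\sum_(r < n) ((nat_of_ord r \in l) && (par (oid r) == 0)) <=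
       \sum_(r < n) ((nat_of_ord r \in l) && (par (oid r) != 0)))%N ->
  (forall r, (r < n)%N -> o (oid r) = (r \in l) && (par (oid r) == nat_of_bool b)) ->
  answered o.
Proof.
move=> oen spec pE xinj Fbest Fv cl sl bE oE; have [oid_lt oid_inj] := oen.
pose f (r : 'I_n) : 'I_n := Ordinal (oid_lt r (ltn_ord r)).
have f_inj : injective f.
  by move=> r r' /(congr1 val) /= e; apply/val_inj/(oid_inj _ _ (ltn_ord r) (ltn_ord r') e).
have farE r r' : (r < n)%N -> (r' < n)%N -> far px py r r' = far tx ty (oid r) (oid r').
  by move=> rn rn'; rewrite /far; have [-> ->] := pE r rn; have [-> ->] := pE r' rn'.
have [g fK gK] := injF_bij f_inj.
rewrite /answered; set S := [set i | _]%SET.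
have fS r : (f r \in S) = (nat_of_ord r \in l) && (par (oid r) == nat_of_bool b).
  by rewrite inE /= oE //; case: (_ && _).
split.
  apply/forall_inP => i iS; apply/forall_inP => j jS; rewrite far_coord.
  apply/negP => /andP[ij /negP]; apply.
  move: ij iS jS; rewrite -(gK i) -(gK j) (inj_eq f_inj) !fS.
  move: (g i) (g j) => r r' rr /andP[rl /eqP rb] /andP[rl' /eqP rb'].
  apply: (strip_far_parity spec (oid_lt r (ltn_ord r)) (oid_lt r' (ltn_ord r'))).
    by rewrite rb rb'.
  rewrite -farE //; exact: (chain_far cl).
move=> OPT ind.
have [|||l' cl' sl'] := @chain_of_far R n px py xpos xinj
    [seq nat_of_ord r | r <- enum [set r | f r \in OPT]%SET].
- by rewrite map_inj_uniq ?enum_uniq //; apply: val_inj.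
- by move=> x /mapP[r _ ->].
- move=> x y /mapP[r + ->] /mapP[r' + ->]; rewrite !mem_enum !inE => rO rO' ne.
  have ne' : f r != f r' by rewrite (inj_eq f_inj); apply: contra ne => /eqP->.
  have /forall_inP/(_ _ rO)/forall_inP/(_ _ rO') := ind.
  rewrite far_coord ne' /= negbK => fr; rewrite farE //.
  case: (eqVneq (sid (oid r)) (sid (oid r'))) => [e|e].
    by rewrite (strip_far_eq spec) ?oid_lt.
  by apply: (strip_far_neq spec); rewrite ?oid_lt.
have szO : size l' = #|OPT|.
  rewrite sl' size_map -cardE.
  have -> : [set r | f r \in OPT]%SET = f @^-1: OPT by apply/setP => r; rewrite !inE.
  by rewrite on_card_preimset //; exists g => // x _; rewrite ?fK ?gK.
have Ov : (#|OPT| <= v)%N.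
  rewrite -szO; case: l' cl' {sl' szO} => // k l' cl'.
  have kn := chain_lt cl'; apply: leq_trans (Fv k kn).
  by have [_] := Fbest k kn; apply.
apply: leq_trans Ov _; rewrite -sl.
rewrite (size_sum_mem (chain_uniq cl) (fun x => @chain_all_lt R n px py xpos l x cl)).
rewrite (card_sum_perm S f_inj) (eq_bigr _ (fun r _ => congr1 nat_of_bool (fS r))).
have -> : (\sum_(r < n) (nat_of_ord r \in l) =
    \sum_(r < n) ((nat_of_ord r \in l) && (par (oid r) == 0%N)) +
    \sum_(r < n) ((nat_of_ord r \in l) && (par (oid r) != 0%N)))%N.
  by rewrite -big_split /=; apply: eq_bigr => r _; case: (_ \in l); case: eqP.
have -> : (\sum_(r < n) ((nat_of_ord r \in l) && (par (oid r) == nat_of_bool b)))%N =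
  if b then (\sum_(r < n) ((nat_of_ord r \in l) && (par (oid r) != 0)))%N
  else (\sum_(r < n) ((nat_of_ord r \in l) && (par (oid r) == 0)))%N.
  case: {bE oE fS} b => //; apply: eq_bigr => r _; congr (nat_of_bool (_ && _)).
  by have [/(_ _ (oid_lt r (ltn_ord r)))[_ ->] _ _ _] := spec; case: odd.
have aux (A B : nat) : (A + B <= 2 * (if A <= B then B else A))%N.
  by case: (leqP A B); lia.
by rewrite bE; apply: aux.
Qed.

Definition finish_time := (n * 1 + (n + (n * 1 + n * 1)))%N.

Lemma finish_ok s0 : prepared n cx cy s0 -> ia s0 aSEL = (fun _ _ => 0%N) ->
  ok n cx cy finish (fun s _ => answered (out s)) s0 finish_time.
Proof.
move=> [xpos [oen spec pE [xsrt [xo_lt xposK xoK xpos_lt]] inv]] sel0.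
have [I1 I2 _ _ _] := inv; have [oid_lt oid_inj] := oen.
have F_gt0 i : (i < n)%N -> (0 < ia s0 aF 0 i)%N by move=> iN; rewrite I1 // xpos_lt.
apply: ok_seq_post (select_best_ok cx cy n_gt0 F_gt0) _ => s1 [sm1 kn up].
have [v1 q1 r1 eo1] := sm1.
have height a b : (a < n)%N -> (b < n)%N -> `|ra s0 rPY a - ra s0 rPY b| < 1.
  move=> an bn; have [_ ->] := pE a an; have [_ ->] := pE b bn.
  have [h _ _ _] := spec.
  have [/andP[? ?] _] := h _ (oid_lt a an); have [/andP[? ?] _] := h _ (oid_lt b bn).
  by rewrite ltr_norml; apply/andP; split; lra.
set k := iv s1 vk in kn up; set v := ia s0 aF 0 k.
apply: (@ok_seq_post _ _ _ _ _ _ (fun s => same [:: vk; vj; va] [:: aSEL] [::] s1 s /\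
    exists l, [/\ chain n (ra s0 rPX) (ra s0 rPY) xpos l, size l = v &
      forall r, (r < n)%N -> ia s aSEL 0 r = (r \in l)])).
  apply: (backtrack_ok cx cy n_gt0 height xsrt xpos_lt (k := k)) => //; by rewrite ?q1.
move=> s2 [sm2 [l [cl sl sel]]]; have [v2 q2 r2 eo2] := sm2.
have oidE : ia s2 aOID = ia s0 aOID by rewrite q2 // q1.
have parE : ia s2 aPAR = ia s0 aPAR by rewrite q2 // q1.
apply: (@ok_seq_post _ _ _ _ _ _ (fun s => [/\ same [:: vi; vs; vp] [::] [::] s2 s,
    iv s vs = \sum_(r < n) ((0 < ia s2 aSEL 0 r) && (ia s2 aPAR 0 (ia s2 aOID 0 r) == 0)) &
    iv s vp = \sum_(r < n) ((0 < ia s2 aSEL 0 r) && (ia s2 aPAR 0 (ia s2 aOID 0 r) != 0))]%N)).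
  by apply: count_parities_ok => //; rewrite oidE.
move=> s3 [sm3 vsE vpE]; have [v3 q3 r3 eo3] := sm3.
have oidE3 : ia s3 aOID = ia s0 aOID by rewrite q3.
have parE3 : ia s3 aPAR = ia s0 aPAR by rewrite q3.
apply: ok_conseq.
  by apply: (emit_ok cx cy n_gt0); rewrite oidE3.
move=> s4 t4 outE.
apply: (@answered_of xpos l v (ia s0 aOID 0) (out s4)
  (iv s3 vs <= iv s3 vp)%N (ia s0 aF 0) _ _ _ _ _ _ oen spec pE _ _ up cl sl).
- by move=> a a' an an' e; rewrite -(xposK a an) -(xposK a' an') e.
- by move=> i iN; apply: I2 => //; apply: xpos_lt.
- rewrite vsE vpE; congr (_ <= _)%N; apply: eq_bigr => r _;
    by rewrite sel // oidE parE lt0n; case: (_ \in l).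
- move=> r rn; rewrite -oidE3 outE // oidE3 parE3 q3 // sel //.
  by rewrite lt0n; case: (_ \in l).
Qed.

End Answer.

(** For [n = 0] even cell 0 of an array, which [strips] reads at once, is out of bounds. *)
Definition misudg_cmd : cmd := CIf (BLe EN (EC 0)) CSkip (prepare ;;; finish).

(** The sum is [14 * n ^ 2 + 21 * n]. *)
Lemma total_time_le n : (0 < n)%N -> (prepare_time n + finish_time n <= 40 * n ^ 2)%N.
Proof.
rewrite -mulnn /prepare_time /finish_time /sort_time /sweep_time /dp_time; nia.
Qed.

Theorem theorem5 (R : realType) :
  exists (P : program) (T M : nat -> nat),
    [/\ (fun n : nat => (T n)%:R : R) =O_\oo (fun n : nat => n%:R ^+ 2 : R),
        (fun n : nat => (M n)%:R : R) =O_\oo (fun n : nat => n%:R ^+ 2 : R) &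
        approximates_MISUDG R 2 P T M].
Proof.
exists (compile misudg_cmd); set S := size (compile misudg_cmd).
exists (fun n => S + 5 * narr * n + S * (prepare_time n + finish_time n))%N.
exists (fun n => 2 * mem_bound n)%N; split.
- apply: (@natr_bigO_sqr _ _ (41 * S + 5 * narr)) => n n0.
  have n1 : (n <= n * n)%N by rewrite leq_pmulr.
  have := total_time_le n0; rewrite -mulnn.
  by move: (prepare_time n + finish_time n)%N S => t z; rewrite /narr; nia.
- apply: (@natr_bigO_sqr _ _ 100) => n n0.
  by rewrite -mulnn /mem_bound /narr; nia.
move=> n c _.
pose cx := coord_x c; pose cy := coord_y c.
have [h [t [E le ans]]] : ok n cx cy misudg_cmd (fun s _ => answered c (out s)) (hst0 R)
    (prepare_time n + finish_time n).
  apply: ok_if => //; rewrite [beval _ _ _ _ _]/= leqNgt; case: (posnP n) => n0 /=.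
    apply: ok_skip; split.
      by apply/forall_inP => i; have := ltn_ord i; rewrite {2}n0.
    by move=> OPT _; apply: leq_trans (max_card _) _; rewrite card_ord n0.
  apply: ok_seq_post (prepare_ok cx cy n0) _ => s [prep sel0].
  exact: finish_ok.
have [t' [s [halt le_t' space outE]]] := compile_ok E.
have outS : output n s = [set i : 'I_n | out h i != 0%N]%SET.
  by apply/setP => i; rewrite !inE outE.
exists t', s; rewrite outS; split=> //.
- by apply: leq_trans le_t' _; rewrite leq_add2l leq_mul2l le orbT.
- by case: ans.
- by move=> OPT [ind _]; case: ans => _; apply.
Qed.
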